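(* Let $X$ be a separable Banach space and $T:X\to X$ a bounded linear operator. Suppose there exist a dense set $\mathcal D\subset X$ and maps $S_n:\mathcal D\to X$, $n\geq0$, such that for every $x\in\mathcal D$: (i) $\sum_{n\geq0}T^nx$ converges unconditionally; (ii) $\sum_{n\geq0}S_nx$ converges unconditionally; (iii) $T^nS_nx=x$ for all $n$ and $T^mS_nx=S_{n-m}x$ for all $n>m$. Then there exists a $T$-invariant Borel probability measure $\mu$ on $X$ with full support, with respect to which $T$ is strongly mixing, such that every continuous polynomial $X\to\mathbb R$ belongs to $L^2(X,\mathcal B,\mu)$. Suppose moreover that there exists $\alpha>1/2$ such that for every $x\in\mathcal D$, $\|T^nx\|=O(n^{-\alpha})$ and $\|S_nx\|=O(n^{-\alpha})$. Then (the measure can be chosen so that) for any polynomials $f,g$ there is $C_{f,g,\alpha}$ with, for all $n\geq1$, $|\mathrm{Cov}(f\circ T^n,g)|\leq C_{f,g,\alpha}n^{1-2\alpha}$ if $\alpha\in(1/2,1)$, $\leq C_{f,g,\alpha}\frac{\log(n+1)}n$ if $\alpha=1$, $\leq C_{f,g,\alpha}n^{-\alpha}$ if $\alpha>1$; and if $\alpha>1$, for every polynomial $f$ with $\int f\,d\mu=0$, $\frac1{\sqrt n}(f+f\circ T+\dots+f\circ T^{n-1})$ converges in distribution to a Gaussian random variable with zero mean and finite variance.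
   Context: A homogeneous polynomial of degree $d$ on $X$ is $x\mapsto Q(x,\dots,x)$ with $Q$ a bounded symmetric $d$-linear form on $X$; a polynomial is a finite sum of homogeneous polynomials. $T$-invariant: $\mu(T^{-1}A)=\mu(A)$; full support: $\mu(U)>0$ for nonempty open $U$; strongly mixing: $\mu(A\cap T^{-n}B)\to\mu(A)\mu(B)$ for Borel $A,B$. $\mathrm{Cov}(f,g)=\int fg\,d\mu-\int f\,d\mu\int g\,d\mu$. *)

(* Defs.v *)
From HB Require Import structures.
From mathcomp Require Import all_boot all_order all_algebra.
From mathcomp Require Import all_classical all_reals all_analysis.

Set Implicit Arguments.
Unset Strict Implicit.
Unset Printing Implicit Defensive.

Import Order.TTheory GRing.Theory Num.Def Num.Theory.
Import numFieldNormedType.Exports.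

Local Open Scope classical_set_scope.
Local Open Scope ring_scope.

Definition borel (X : topologicalType) := g_sigma_algebraType (@open X).

Section Defs.
Variable R : realType.

Definition separable (X : topologicalType) :=
  exists Dc : set X, countable Dc /\ dense Dc.

Definition uncond_summable (X : normedModType R) (u : nat -> X) :=
  forall s : nat -> nat, bijective s -> cvgn (series (u \o s)).

Section Poly.
Variable X : normedModType R.

Definition multilinear (d : nat) (Q : ('I_d -> X) -> R) :=
  forall (i : 'I_d) (v : 'I_d -> X) (a : R) (x y : X),
    Q (fun j => if j == i then a *: x + y else v j)
    = a * Q (fun j => if j == i then x else v j)
      + Q (fun j => if j == i then y else v j).

Definition symmetric_form (d : nat) (Q : ('I_d -> X) -> R) :=
  forall (s : 'I_d -> 'I_d) (v : 'I_d -> X), bijective s -> Q (v \o s) = Q v.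

Definition bounded_form (d : nat) (Q : ('I_d -> X) -> R) :=
  exists C : R, forall v : 'I_d -> X, `|Q v| <= C * \prod_(i < d) `|v i|.

Definition homogeneous_poly (d : nat) (P : X -> R) :=
  exists Q : ('I_d -> X) -> R,
    [/\ multilinear Q, symmetric_form Q, bounded_form Q &
        P = fun x => Q (fun _ => x)].

Definition is_poly (P : X -> R) :=
  exists (N : nat) (Ps : nat -> X -> R),
    (forall k, (k < N)%N -> exists d, homogeneous_poly d (Ps k)) /\
    P = fun x => \sum_(k < N) Ps k x.

Definition continuous_polynomial (P : X -> R) := is_poly P /\ continuous P.
End Poly.

Section Measure.
Variable X : normedModType R.
Variable mu : probability (borel X) R.

Definition T_invariant (T : X -> X) :=
  forall A : set (borel X), measurable A -> mu (T @^-1` A) = mu A.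

Definition full_support :=
  forall U : set X, open U -> U !=set0 -> (0 < mu U)%E.

Definition strongly_mixing (T : X -> X) :=
  forall A B : set (borel X), measurable A -> measurable B ->
    (fun n => mu (A `&` (iter n T) @^-1` B)) @ \oo --> (mu A * mu B)%E.

Definition in_L2 (f : X -> R) :=
  measurable_fun [set: borel X] (f : borel X -> R) /\
  (\int[mu]_x ((f x) ^+ 2)%:E < +oo)%E.

Definition Cov (f g : X -> R) : R :=
  Rintegral mu [set: borel X] (fun x => f x * g x)
  - Rintegral mu [set: borel X] f * Rintegral mu [set: borel X] g.

Definition cvg_in_distribution (Y : nat -> X -> R) (nu : set R -> \bar R) :=
  forall h : R -> R, continuous h -> (exists M : R, forall t, `|h t| <= M) ->
    (fun n => (\int[mu]_x (h (Y n x))%:E)%E) @ \oo --> (\int[nu]_y (h y)%:E)%E.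
End Measure.

(* centered Gaussian law with standard deviation sigma >= 0
   (sigma = 0: the degenerate Gaussian, Dirac mass at 0) *)
Definition centered_gaussian (sigma : R) : set R -> \bar R :=
  fun A => if sigma == 0 then \d_(0 : R) A else normal_prob 0 sigma A.

End Defs.

(* Main.v *)
(* Let (x_k) be a dense sequence in D, extend each forward orbit to the two-sided
   orbit y_(j,k) = T^j x_k for j >= 0 and y_(-j,k) = S_j x_k for j > 0, and let
   (w_(j,k)) be independent bits, with P(w_(j,k) = 1) = p_k depending on k only.
   The law mu of the random vector V = sum w_(j,k) y_(j,k) is T-invariant, since T
   shifts the series, and strongly mixing, since the shift of independent bits is.
   In slice k the partial sums are bounded by some M_k, and are at most 2^-(k+1)
   unless a bit in a finite set B_k is one; choosing p_k so that
   |B_k| p_k exp(M_0 + ... + M_k) <= 2^-(k+1) makes V converge and exp |V|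
   integrable, hence all polynomials square integrable.  Each y_i is a limit of values
   taken with positive probability, hence the full support.
   The polarised Efron-Stein inequality bounds Cov(f o T^n, g) by the sum over i of
   Inf_(tau^n i)(f) Inf_i(g), where the influence of bit (j,k) is
   O(2^-k (1 + |j|)^-alpha) if p_k is small enough; this gives the three rates.
   For alpha > 1 the influences are summable, so that f o V is approximated, uniformly
   over normalised sums, by functions of finitely many bits.  These give m-dependent
   sequences, whose central limit theorem follows from Lindeberg's replacement of
   blocks by Gaussian variables. *)

Require Import Defs.
From HB Require Import structures.
From mathcomp Require Import all_boot all_order all_algebra.
From mathcomp Require Import all_classical all_reals all_analysis.
From mathcomp Require Import measurable_realfun.
From mathcomp Require Import ring lra zify.
Set Implicit Arguments.
Unset Strict Implicit.
Unset Printing Implicit Defensive.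
Import Order.TTheory GRing.Theory Num.Def Num.Theory.
Import numFieldNormedType.Exports.
Local Open Scope classical_set_scope.
Local Open Scope ring_scope.

(** * Independent random bits *)

(** One measure must serve polynomials of every degree, which is why the smallness condition
    involves [expR]: a polynomial is Lipschitz up to a factor exp((|x| + |y|) / 8), and the single
    integrable majorant [envelope] of exp |V| then dominates the squares and products that occur.
    The bits stay uncentred: an influence only sees the difference of two values, and a small [p]
    makes it small. Independence is used in the form that redrawing one bit leaves [P] unchanged
    ([resample]), so conditional expectations are explicit two-term averages. Inequalities are
    proved for functions of finitely many bits, where integrability is automatic, with bounds that
    do not depend on how many bits are kept; dominated convergence carries them to V. In the central
    limit theorem the obstacle is that a finite-bit approximation must stay good after division by
    sqrt n, for all n at once: this rests on the variance bound [Var_sum_shift], linear in the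
    number of summands. The limit variance is not computed: each approximation yields its own, and a
    cluster point of these is taken. *)

Definition bits := g_sigma_algebraType (range (fun i : nat => [set w : nat -> bool | w i])).

Section probability_of_measure.
Context d (T : measurableType d) (R : realType).
Variables (m : {measure set T -> \bar R}) (m1 : m setT = 1%E).

Definition probability_of of m setT = 1%E : set T -> \bar R := m.

HB.instance Definition _ := Measure.copy (probability_of m1) m.

HB.instance Definition _ :=
  @Measure_isProbability.Build _ _ R (probability_of m1) m1.

End probability_of_measure.

Section bernoulli_bits.
Variables (R : realType) (p : nat -> R).
Hypothesis p01 : forall i, 0 < p i < 1.

Definition bit_weight (b : bool) i : R := if b then p i else 1 - p i.

Lemma bit_weight_gt0 b i : 0 < bit_weight b i.
Proof. by have /andP[p0 p1] := p01 i; case: b; rewrite /bit_weight// subr_gt0. Qed.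

(* [split_state n x] is the pair (left end, length) of the interval of
   generation [n] that contains [x]; bit [n] of [x] says in which part of it [x] lies. *)
Fixpoint split_state (n : nat) (x : R) : R * R :=
  if n is m.+1 then
    let st := split_state m x in
    if x < st.1 + p m * st.2 then (st.1, p m * st.2)
    else (st.1 + p m * st.2, (1 - p m) * st.2)
  else (0, 1).

Definition split_bits (x : R) : bits :=
  fun n => x < (split_state n x).1 + p n * (split_state n x).2.

(** The interval reached when the choices are imposed by [s] rather than read off a point. *)
Fixpoint cyl_state (n : nat) (s : nat -> bool) : R * R :=
  if n is m.+1 then
    let st := cyl_state m s in
    if s m then (st.1, p m * st.2) else (st.1 + p m * st.2, (1 - p m) * st.2)
  else (0, 1).

Lemma cyl_state_length n s : (cyl_state n s).2 = \prod_(j < n) bit_weight (s j) j.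
Proof.
elim: n => [|n ih]; first by rewrite big_ord0.
by rewrite big_ord_recr/= -ih /bit_weight; case: (s n) => /=; rewrite mulrC.
Qed.

Lemma cyl_state_bits n s (x : R) :
  (0 <= x < 1 /\ forall j, (j < n)%N -> split_bits x j = s j) <->
  (cyl_state n s).1 <= x < (cyl_state n s).1 + (cyl_state n s).2.
Proof.
(* The induction carries [split_state m x = cyl_state m s], because bit [m] of [x] is read inside
   the interval that [x] has reached. The other implication calls [key] for the same reason. *)
have key m : (cyl_state m s).1 <= x < (cyl_state m s).1 + (cyl_state m s).2 ->
    (forall j, (j < m)%N -> split_bits x j = s j) /\ 0 <= x < 1 /\
    split_state m x = cyl_state m s.
  elim: m => [|m ih] /=; first by rewrite add0r.
  have l0 : 0 < (cyl_state m s).2.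
    by rewrite cyl_state_length; apply: prodr_gt0 => i _; exact: bit_weight_gt0.
  have /andP[p0 p1] := p01 m.
  have q1 : p m * (cyl_state m s).2 < (cyl_state m s).2 by rewrite gtr_pMl.
  have q0 : 0 < p m * (cyl_state m s).2 by rewrite mulr_gt0.
  case sm : (s m) => /= /andP[h1 h2].
    have [|h [h' e]] := ih.
      by rewrite h1/= (lt_trans h2)// ltrD2l.
    rewrite e h2; split; last by [].
    move=> j; rewrite ltnS leq_eqVlt => /predU1P[->|/h//].
    by rewrite /split_bits e h2 sm.
  have [|h [h' e]] := ih.
    apply/andP; split; first by rewrite (le_trans _ h1)// lerDl ltW.
    by move: h2; rewrite mulrBl mul1r addrAC addrA addrNK addrC.
  rewrite e [X in if X then _ else _](_ : _ = false); last by rewrite ltNge h1.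
  split; last by [].
  move=> j; rewrite ltnS leq_eqVlt => /predU1P[->|/h//].
  by rewrite /split_bits e ltNge h1 sm.
split; last by move=> /key[h [h' _]].
elim: n => [[]|n ih [x01 h]] /=; first by rewrite add0r.
have hx : (cyl_state n s).1 <= x < (cyl_state n s).1 + (cyl_state n s).2.
  by apply: ih; split=> // j jn; apply: h; rewrite ltnS ltnW.
have [_ [_ e]] := key _ hx.
have := h n (ltnSn n); rewrite /split_bits e => <-.
case: ltP => /= xl; first by have /andP[-> _] := hx.
rewrite xl/= mulrBl mul1r addrAC addrA addrNK addrC.
by rewrite [ltRHS]addrC; have /andP[] := hx.
Qed.

Lemma measurable_split_state n :
  measurable_fun setT (fun x => (split_state n x).1) /\
  measurable_fun setT (fun x => (split_state n x).2).
Proof.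
elim: n => [|n [ih1 ih2]] /=; first by split; exact: measurable_cst.
have mp : measurable_fun setT (fun x => (split_state n x).1 + p n * (split_state n x).2).
  by apply: measurable_funD => //; apply: measurable_funM.
have ml : measurable_fun setT (fun x : R => x < (split_state n x).1 + p n * (split_state n x).2).
  exact: measurable_fun_ltr.
split.
- under eq_fun do rewrite (fun_if fst)/=.
  exact: measurable_fun_ifT.
- under eq_fun do rewrite (fun_if snd)/=.
  by apply: measurable_fun_ifT => //; apply: measurable_funM.
Qed.

Lemma measurable_split_bits : measurable_fun [set: R] split_bits.
Proof.
have mE : @measurable _ bits = <<s range (fun i : nat => [set w : bits | w i]) >> by [].
apply: (measurability _ mE) => _ [_ [i _ <-] <-].
have [m1 m2] := measurable_split_state i.
have mp : measurable_fun setT (fun x => (split_state i x).1 + p i * (split_state i x).2).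
  by apply: measurable_funD => //; apply: measurable_funM.
have ml : measurable_fun setT (fun x : R => x < (split_state i x).1 + p i * (split_state i x).2).
  exact: measurable_fun_ltr.
move: ml => /(_ measurableT [set true]); rewrite !setTI => /(_ _).
by apply.
Qed.

(** The law of [split_bits] under Lebesgue measure on [0, 1): a cylinder pulls back to an interval
    whose length is the product of the weights. *)
Lemma bernoulli_prob_cylinder : exists P : probability bits R,
  forall n (s : nat -> bool), P [set w | forall j, (j < n)%N -> w j = s j] =
    (\prod_(j < n) bit_weight (s j) j)%:E.
Proof.
have mb : measurable_fun [set: measurableTypeR R] split_bits.
  by move=> mT Y mY; exact: measurable_split_bits.
pose mf : {mfun measurableTypeR R >-> bits} := @mfun_Sub _ _ (measurableTypeR R) bits split_bits (mem_set mb).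
pose m := mrestr lebesgue_measure (measurable_itv `[(0 : R), 1[).
have m1 : m setT = 1%E.
  by rewrite /m /= /mrestr setTI lebesgue_measure_itv/= lte_fin ltr01 oppr0 adde0.
exists (distribution (probability_of m1) mf) => n s.
rewrite /distribution /pushforward /probability_of /= /m /mrestr -cyl_state_length.
set I := `[(cyl_state n s).1, (cyl_state n s).1 + (cyl_state n s).2[.
transitivity (lebesgue_measure [set` I]).
  congr (lebesgue_measure _); apply/seteqP; split => x /=; rewrite !in_itv/=.
    by move=> [h x01]; apply/cyl_state_bits.
  by move=> /cyl_state_bits[].
rewrite lebesgue_measure_itv/= lte_fin ltrDl.
have -> : 0 < (cyl_state n s).2.
  by rewrite cyl_state_length; apply: prodr_gt0 => i _; exact: bit_weight_gt0.
by rewrite -EFinD addrAC subrr add0r.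
Qed.

End bernoulli_bits.

Section cylinders.

Definition upd (w : bits) (i : nat) (b : bool) : bits := fun j => if j == i then b else w j.

Definition depends_below (n : nat) (U : Type) (F : bits -> U) :=
  forall w w' : bits, (forall j, (j < n)%N -> w j = w' j) -> F w = F w'.

Definition cylinder n (s : nat -> bool) : set bits := [set w | forall j, (j < n)%N -> w j = s j].

(** With [set0] added, the family is closed under intersection, so that measures and limits need
    only be compared on cylinders. *)
Definition cylinder_sets : set (set bits) :=
  [set A | A = set0 \/ exists n s, A = cylinder n s].

Lemma measurable_bit i b : measurable [set w : bits | w i = b].
Proof.
have h : measurable [set w : bits | w i].
  by apply: sub_sigma_algebra; exists i.
case: b => //.
rewrite (_ : [set _ | _] = ~` [set w : bits | w i]); first exact: measurableC.
by apply/seteqP; split => w /=; case: (w i).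
Qed.

Lemma measurable_cylinder n s : measurable (cylinder n s).
Proof.
rewrite (_ : cylinder n s = \big[setI/setT]_(j < n) [set w : bits | w j = s j]).
  by apply: bigsetI_measurable => i _; exact: measurable_bit.
rewrite -(bigcap_mkord n (fun j => [set w : bits | w j = s j])); apply/seteqP; split => w h j /= jn; exact: h.
Qed.

(** Two cylinders are nested or disjoint, according to whether their prescriptions agree on the
    shorter length. *)
Lemma cylinder_sets_setI : setI_closed cylinder_sets.
Proof.
have key n m s t : (n <= m)%N -> cylinder_sets (cylinder n s `&` cylinder m t).
  move=> nm; have [h|h] := pselect (forall j, (j < n)%N -> s j = t j).
    right; exists m, t; apply/seteqP; split => [w []//|w wt]; split=> // j jn.
    by rewrite wt ?h// (leq_trans jn).
  left; apply/seteqP; split => // w [ws wt]; apply: h => j jn.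
  by rewrite -ws// wt// (leq_trans jn).
move=> _ _ [->|[n [s ->]]] [->|[m [t ->]]]; rewrite ?setI0 ?set0I; try by left.
have [nm|/ltnW mn] := leqP n m; first exact: key.
by rewrite setIC; exact: key.
Qed.

(** A set that depends on [n] bits is the finite union of the cylinders of the [n]-tuples it
    contains. Applied to the coordinate events, this identifies the two sigma-algebras. *)
Lemma cylinder_sets_dep n (A : set bits) : depends_below n A -> <<s cylinder_sets >> A.
Proof.
move=> hA; pose ext (t : n.-tuple bool) : bits := fun j => nth false t j.
rewrite (_ : A = \bigcup_(t in [set t | A (ext t)]) cylinder n (ext t)).
  have fs : finite_set [set t | A (ext t)] by exact: finite_finset.
  apply: (@fin_bigcup_measurable _ (g_sigma_algebraType cylinder_sets)) => // t _.
  by apply: sub_sigma_algebra; right; exists n, (ext t).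
apply/seteqP; split=> [w Aw|w [t At wt]].
  have wt : cylinder n (ext [tuple of mkseq w n]) w.
    by move=> j jn; rewrite /ext/= nth_mkseq.
  by exists [tuple of mkseq w n] => //=; rewrite -(hA w).
by rewrite (hA w (ext t)).
Qed.

Lemma measurable_cylinder_setsE : @measurable _ bits = <<s cylinder_sets >>.
Proof.
apply/seteqP; split.
  apply: smallest_sub; first exact: smallest_sigma_algebra.
  move=> _ [i _ <-]; apply: (@cylinder_sets_dep i.+1) => w w' /= h.
  by rewrite /= h.
apply: smallest_sub; first exact: sigma_algebra_measurable.
by move=> _ [->|[n [s ->]]]//; exact: measurable_cylinder.
Qed.

Lemma measurable_dep n (A : set bits) : depends_below n A -> measurable A.
Proof. by rewrite measurable_cylinder_setsE; exact: cylinder_sets_dep. Qed.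

Lemma measurable_preimage_dep n (U : Type) (F : bits -> U) (A : set U) :
  depends_below n F -> measurable (F @^-1` A).
Proof. by move=> hF; apply: (@measurable_dep n) => w w' h; rewrite /preimage/= (hF _ _ h). Qed.

Lemma measurable_fun_dep n d (U : measurableType d) (F : bits -> U) :
  depends_below n F -> measurable_fun setT F.
Proof. by move=> hF _ Y _; rewrite setTI; exact: measurable_preimage_dep hF. Qed.

Lemma measurable_to_bits d (U : measurableType d) (f : U -> bits) :
  (forall i, measurable [set x | f x i]) -> measurable_fun setT f.
Proof.
move=> h.
have mE : @measurable _ bits = <<s range (fun i : nat => [set w : bits | w i]) >> by [].
by apply: (measurability _ mE) => _ [_ [i _ <-] <-]; rewrite setTI; exact: h.
Qed.

Lemma measurable_upd i b : measurable_fun setT (fun w => upd w i b).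
Proof.
apply: measurable_to_bits => j; rewrite /upd; case: (j == i); last exact: (measurable_bit j true).
by case: b => //=; rewrite ?set_true ?set_false.
Qed.

Lemma upd_comm i j b b' w : i != j -> upd (upd w i b) j b' = upd (upd w j b') i b.
Proof.
move=> ij; apply/funext => k; rewrite /upd; case: eqP => // ->.
by rewrite eq_sym (negbTE ij).
Qed.

Lemma upd_id i w : upd w i (w i) = w.
Proof. by apply/funext => j; rewrite /upd; case: eqP => [->|]. Qed.

End cylinders.

Section bernoulli_expectation.
Variables (R : realType) (p : nat -> R).
Hypothesis p01 : forall i, 0 < p i < 1.
Variable P : probability bits R.
Hypothesis PE : forall n s, P (cylinder n s) = (\prod_(j < n) bit_weight p (s j) j)%:E.

Let upd_mfun i b : {mfun bits >-> bits} := mfun_Sub (mem_set (measurable_upd i b)).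

Lemma p_ge0 i : 0 <= p i. Proof. by have /andP[/ltW] := p01 i. Qed.
Lemma onem_p_ge0 i : 0 <= 1 - p i. Proof. by have /andP[_ /ltW] := p01 i; rewrite subr_ge0. Qed.

(** If the cylinder constrains bit [i], setting that bit to the prescribed value lifts the
    constraint ([good]), and setting it to the other value leaves the empty set ([bad]). *)
Lemma resample_cylinder i n s : P (cylinder n s) =
  ((p i)%:E * P ((fun w => upd w i true) @^-1` cylinder n s) +
   (1 - p i)%:E * P ((fun w => upd w i false) @^-1` cylinder n s))%E.
Proof.
have [ni|ni] := leqP n i.
  have e b : (fun w => upd w i b) @^-1` cylinder n s = cylinder n s.
    apply/seteqP; split => w h j jn; move: (h j jn); rewrite /upd;
      by rewrite (ltn_eqF (leq_trans jn ni)).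
  by rewrite !e PE -!EFinM -EFinD; congr EFin; ring.
pose rest := \prod_(j < n | j != Ordinal ni) bit_weight p (s j) j.
have PU b : P (cylinder n (upd s i b)) = (bit_weight p b i * rest)%:E.
  rewrite PE (bigD1 (Ordinal ni))//= /upd eqxx; congr (_ * _)%:E.
  by apply: eq_bigr => j /negP ji; case: eqP => // /esym e; case: ji; apply/eqP/val_inj.
have Ps : P (cylinder n s) = (bit_weight p (s i) i * rest)%:E.
  by rewrite -PU upd_id.
have good b : s i = b -> P ((fun w => upd w i b) @^-1` cylinder n s) = rest%:E.
  move=> sb; rewrite (_ : _ @^-1` _ = cylinder n (upd s i true) `|` cylinder n (upd s i false)).
    rewrite measureU; try exact: measurable_cylinder.
      by rewrite /= !PU -EFinD; congr EFin; rewrite /bit_weight; ring.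
    apply/seteqP; split => // w [/(_ i ni) h1 /(_ i ni)].
    by rewrite h1 /upd eqxx.
  apply/seteqP; split=> [w h|w].
    case wi : (w i); [left|right] => j jn; move: (h j jn); rewrite /upd;
      by case: eqP => // ->.
  case=> h j jn; move: (h j jn); rewrite /upd; case: eqP => // -> _; by rewrite sb.
have bad b : s i = ~~ b -> P ((fun w => upd w i b) @^-1` cylinder n s) = 0%E.
  move=> sb; rewrite (_ : _ @^-1` _ = set0) ?measure0//.
  apply/seteqP; split => // w /(_ i ni); rewrite /upd eqxx sb.
  by case: (b).
rewrite Ps; case si : (s i).
- by rewrite (good true)// (bad false)// mule0 adde0.
- by rewrite (good false)// (bad true)// mule0 add0e.
Qed.

Definition resampled i : {measure set bits -> \bar R} :=
  measure_add (mscale (NngNum (p_ge0 i)) (distribution P (upd_mfun i true)))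
              (mscale (NngNum (onem_p_ge0 i)) (distribution P (upd_mfun i false))).

Lemma resampledE i (A : set bits) : resampled i A =
  ((p i)%:E * P ((fun w => upd w i true) @^-1` A) +
   (1 - p i)%:E * P ((fun w => upd w i false) @^-1` A))%E.
Proof. exact: measure_addE. Qed.

(** Redrawing bit [i] independently does not change [P]; this extends from cylinders by uniqueness
    of measures. *)
Lemma resample i (A : set bits) : measurable A -> P A = resampled i A.
Proof.
move=> mA; apply: (measure_unique cylinder_sets (fun=> cylinder 0 (fun=> true))) => //.
- exact: measurable_cylinder_setsE.
- exact: cylinder_sets_setI.
- by move=> _; right; exists 0%N, (fun=> true).
- by apply/seteqP; split => // w _; exists 0%N.
- move=> _ [->|[n [s ->]]]; first by rewrite !measure0.
  by rewrite resampledE; exact: resample_cylinder.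
- by move=> _; rewrite (le_lt_trans (probability_le1 _ _)) ?ltry//; exact: measurable_cylinder.
Qed.

Lemma resampleE i (A : set bits) : measurable A -> P A =
  ((p i)%:E * P ((fun w => upd w i true) @^-1` A) +
   (1 - p i)%:E * P ((fun w => upd w i false) @^-1` A))%E.
Proof. by move=> mA; rewrite (resample i mA) resampledE. Qed.

End bernoulli_expectation.

(** Such functions take finitely many values, hence are measurable into any space and, if real,
    bounded. The class is closed under pointwise operations, so no integrability condition has to be
    carried along. *)
Definition cyl_fun (U : Type) (F : bits -> U) := exists n, depends_below n F.

Lemma depends_below_le n m (U : Type) (F : bits -> U) :
  (n <= m)%N -> depends_below n F -> depends_below m F.
Proof. by move=> nm h w w' e; apply: h => j jn; apply: e; exact: leq_trans nm. Qed.

Lemma cyl_cst (U : Type) (c : U) : cyl_fun (fun=> c).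
Proof. by exists 0%N. Qed.

Lemma cyl_comp (U V : Type) (H : U -> V) (F : bits -> U) :
  cyl_fun F -> cyl_fun (fun w => H (F w)).
Proof. by move=> [n h]; exists n => w w' /h ->. Qed.

Lemma cyl_comp2 (U V W : Type) (H : U -> V -> W) (F : bits -> U) (G : bits -> V) :
  cyl_fun F -> cyl_fun G -> cyl_fun (fun w => H (F w) (G w)).
Proof.
move=> [n hF] [m hG]; exists (maxn n m) => w w' e.
have eF := depends_below_le (leq_maxl n m) hF e.
by have eG := depends_below_le (leq_maxr n m) hG e; rewrite eF eG.
Qed.

Lemma cyl_upd (U : Type) (F : bits -> U) i b : cyl_fun F -> cyl_fun (fun w => F (upd w i b)).
Proof.
by move=> [n h]; exists n => w w' e; apply: h => j jn; rewrite /upd; case: eqP => // _; exact: e.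
Qed.

Lemma cyl_sum (V : nmodType) (I : Type) (s : seq I) (F : I -> bits -> V) :
  (forall i, cyl_fun (F i)) -> cyl_fun (fun w => \sum_(i <- s) F i w).
Proof.
move=> h; elim: s => [|i s ih].
  by under eq_fun do rewrite big_nil; exact: cyl_cst.
by under eq_fun do rewrite big_cons; exact: (cyl_comp2 +%R).
Qed.

Lemma cyl_bit i : cyl_fun (fun w : bits => w i).
Proof. by exists i.+1 => w w' ->. Qed.

Section cylinder_expectation.
Context (R : realType).
Variable P : probability bits R.

Local Notation Ex F := (Rintegral P setT F).

Lemma cyl_bounded (F : bits -> R) : cyl_fun F -> exists M, forall w, `|F w| <= M.
Proof.
move=> [n]; elim: n F => [|n ih] F hF.
  by exists `|F (fun=> true)| => w; rewrite (hF w (fun=> true)).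
have h b : depends_below n (fun w => F (upd w n b)).
  move=> w w' e; apply: hF => j; rewrite ltnS leq_eqVlt /upd.
  by case: eqP => //= _; exact: e.
have [M1 h1] := ih _ (h true); have [M0 h0] := ih _ (h false).
exists (`|M1| + `|M0|) => w; rewrite -(upd_id n w); case: (w n).
  by rewrite (le_trans (h1 w))// (le_trans (ler_norm _))// lerDl.
by rewrite (le_trans (h0 w))// (le_trans (ler_norm _))// lerDr.
Qed.

Lemma cyl_measurable d (U : measurableType d) (F : bits -> U) :
  cyl_fun F -> measurable_fun setT F.
Proof. by move=> [n]; exact: measurable_fun_dep. Qed.

Lemma bounded_integrable (F : bits -> R) M : measurable_fun setT F ->
  (forall w, `|F w| <= M) -> P.-integrable setT (EFin \o F).
Proof.
move=> mF hM; apply: measurable_bounded_integrable => //.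
  by rewrite (le_lt_trans (probability_le1 _ _)) ?ltry.
by exists M; split; [exact: num_real|move=> x Mx y _; apply: (le_trans (hM y)); exact: ltW].
Qed.

Lemma cyl_integrable (F : bits -> R) : cyl_fun F -> P.-integrable setT (EFin \o F).
Proof.
by move=> cF; have [M] := cyl_bounded cF; apply: bounded_integrable; exact: cyl_measurable.
Qed.

Lemma eq_Ex (F G : bits -> R) : F =1 G -> Ex F = Ex G.
Proof. by move=> /funext ->. Qed.

Lemma Ex_cst c : Ex (fun=> c) = c.
Proof. by rewrite Rintegral_cst// [X in fine X]probability_setT mulr1. Qed.

Lemma ExD (F G : bits -> R) : cyl_fun F -> cyl_fun G -> Ex (fun w => F w + G w) = Ex F + Ex G.
Proof. by move=> cF cG; rewrite RintegralD//; exact: cyl_integrable. Qed.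

Lemma ExB (F G : bits -> R) : cyl_fun F -> cyl_fun G -> Ex (fun w => F w - G w) = Ex F - Ex G.
Proof. by move=> cF cG; rewrite RintegralB//; exact: cyl_integrable. Qed.

Lemma ExZ a (F : bits -> R) : cyl_fun F -> Ex (fun w => a * F w) = a * Ex F.
Proof. by move=> cF; rewrite RintegralZl//; exact: cyl_integrable. Qed.

Lemma le_Ex (F G : bits -> R) : cyl_fun F -> cyl_fun G -> (forall w, F w <= G w) -> Ex F <= Ex G.
Proof. by move=> cF cG h; apply: le_Rintegral => //; exact: cyl_integrable. Qed.

Lemma Ex_ge0 (F : bits -> R) : (forall w, 0 <= F w) -> 0 <= Ex F.
Proof. by move=> h; apply: Rintegral_ge0. Qed.

Lemma Ex_norm (F : bits -> R) : cyl_fun F -> `|Ex F| <= Ex (fun w => `|F w|).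
Proof. by move=> cF; apply: le_normr_Rintegral => //; exact: cyl_integrable. Qed.

Lemma Ex_sum (I : Type) (s : seq I) (F : I -> bits -> R) :
  (forall i, cyl_fun (F i)) -> Ex (fun w => \sum_(i <- s) F i w) = \sum_(i <- s) Ex (F i).
Proof.
move=> h; elim: s => [|i s ih].
  by rewrite big_nil -[RHS](Ex_cst 0); apply: eq_Ex => w; rewrite big_nil.
by rewrite big_cons -ih -ExD//; [apply: eq_Ex => w; rewrite big_cons|exact: cyl_sum].
Qed.

Lemma Ex_CauchySchwarz (F G : bits -> R) : cyl_fun F -> cyl_fun G ->
  `|Ex (fun w => F w * G w)| <= Num.sqrt (Ex (fun w => F w ^+ 2)) * Num.sqrt (Ex (fun w => G w ^+ 2)).
Proof.
move=> cF cG; set a := Ex (fun w => F w ^+ 2); set b := Ex (fun w => G w ^+ 2).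
set c := Ex _.
have a0 : 0 <= a by apply: Ex_ge0 => w; exact: sqr_ge0.
have q s t : 0 <= s ^+ 2 * a + 2 * (s * t) * c + t ^+ 2 * b.
  have cFF := cyl_comp (fun x => x ^+ 2) cF; have cGG := cyl_comp (fun x => x ^+ 2) cG.
  have cFG := cyl_comp2 *%R cF cG.
  rewrite -!ExZ// -ExD; [|exact: cyl_comp|exact: cyl_comp].
  rewrite -ExD; [| |exact: cyl_comp].
    by apply: Ex_ge0 => w; have := sqr_ge0 (s * F w + t * G w); nra.
  exact: (cyl_comp2 (fun x y => s ^+ 2 * x + 2 * (s * t) * y)).
have cab : c ^+ 2 <= a * b.
  have [a_gt0|] := ltP 0 a.
    have := q c (- a); rewrite (_ : _ + _ = a * (a * b - c ^+ 2)); last by ring.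
    by rewrite pmulr_rge0// subr_ge0.
  move=> a_le0; have az : a = 0 by apply/eqP; rewrite eq_le a_le0.
  rewrite az mul0r; have [->|c0] := eqVneq c 0; first by rewrite expr0n.
  (* With [a = 0] the quadratic form is 2 s t c + t^2 b; this choice makes it -1, so [c] must
     vanish. *)
  have := q (- (b + 1) / (2 * c)) 1.
  rewrite az (_ : _ + _ = - 1); last by field.
  by rewrite oppr_ge0 ler10.
by rewrite -sqrtrM// -sqrtr_sqr ler_wsqrtr.
Qed.

Lemma Ex_sqr_le (F : bits -> R) : cyl_fun F -> `|Ex F| <= Num.sqrt (Ex (fun w => F w ^+ 2)).
Proof.
move=> cF; have := Ex_CauchySchwarz cF (cyl_cst 1).
rewrite (@eq_Ex _ F); last by move=> w; rewrite mulr1.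
by rewrite expr1n Ex_cst sqrtr1 mulr1.
Qed.

End cylinder_expectation.

(** * Efron-Stein inequality and independence *)

Section efron_stein.
Variables (R : realType) (p : nat -> R).
Hypothesis p01 : forall i, 0 < p i < 1.
Variable P : probability bits R.
Hypothesis PE : forall n s, P (cylinder n s) = (\prod_(j < n) bit_weight p (s j) j)%:E.

Local Notation Ex F := (Rintegral P setT F).

(** The conditional expectation given all the other bits, as an explicit function that is defined
    everywhere and again depends on finitely many bits when [F] does. *)
Definition avg i (F : bits -> R) : bits -> R :=
  fun w => p i * F (upd w i true) + (1 - p i) * F (upd w i false).

Lemma cyl_avg i F : cyl_fun F -> cyl_fun (avg i F).
Proof.
by move=> cF; apply: (cyl_comp2 (fun x y => p i * x + (1 - p i) * y)); exact: cyl_upd.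
Qed.

Lemma integral_resample i (F : bits -> \bar R) : measurable_fun setT F ->
  (forall w, 0 <= F w)%E ->
  (\int[P]_w F w = (p i)%:E * \int[P]_w F (upd w i true) +
                   (1 - p i)%:E * \int[P]_w F (upd w i false))%E.
Proof.
move=> mF F0; rewrite (eq_measure_integral (resampled p01 P i)); last first.
  by move=> A mA _; exact: (resample p01 PE).
rewrite ge0_integral_measure_add//.
by rewrite !ge0_integral_mscale//= !ge0_integral_distribution.
Qed.

Lemma Ex_avg i F : cyl_fun F -> Ex (avg i F) = Ex F.
Proof.
have ge0 G : cyl_fun G -> (forall w, 0 <= G w) -> Ex (avg i G) = Ex G.
  move=> cG G0; have mG := cyl_measurable cG.
  have -> : Ex G = fine ((p i)%:E * \int[P]_w (G (upd w i true))%:E +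
                   (1 - p i)%:E * \int[P]_w (G (upd w i false))%:E)%E.
    congr fine; apply: (integral_resample i (F := EFin \o G)) => //.
    exact/measurable_EFinP.
  have cu b := cyl_upd i b cG.
  have fin b : (\int[P]_w (G (upd w i b))%:E)%E = (Ex (fun w => G (upd w i b)))%:E.
    by rewrite fineK//; apply: integrable_fin_num => //; exact: cyl_integrable.
  rewrite !fin -!EFinM -EFinD /= -!ExZ// -ExD//; exact: (cyl_comp _ (cu _)).
(* A bounded function becomes nonnegative after adding [M], and constants pass through both
   sides. *)
move=> cF; have [M hM] := cyl_bounded cF.
have cFM : cyl_fun (fun w => F w + M) by exact: (cyl_comp (fun x => x + M)).
have eM K : cyl_fun K -> Ex (fun w => K w + M) = Ex K + M.
  by move=> cK; rewrite (ExD P cK (cyl_cst M)) Ex_cst.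
apply: (@addIr _ M); rewrite -!eM//; last exact: cyl_avg.
rewrite -[RHS]ge0//; last by move=> w; have := hM w; rewrite ler_norml => /andP[h1 h2]; rewrite -lerBlDr sub0r.
by apply: eq_Ex => w; rewrite /avg; ring.
Qed.

Definition bit_diff i (F : bits -> R) : bits -> R := fun w => F (upd w i true) - F (upd w i false).

(** The L2 norm of [F - avg i F], that is, the root mean square fluctuation of [F] due to bit [i]
    alone. *)
Definition bit_infl i F : R := Num.sqrt (p i * (1 - p i) * Ex (fun w => bit_diff i F w ^+ 2)).

Lemma cyl_bit_diff i F : cyl_fun F -> cyl_fun (bit_diff i F).
Proof. by move=> cF; apply: (cyl_comp2 (fun x y => x - y)); exact: cyl_upd. Qed.

Lemma pq_ge0 i : 0 <= p i * (1 - p i).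
Proof. by rewrite mulr_ge0 ?(p_ge0 p01)// (onem_p_ge0 p01). Qed.

(** The difference is the mean of the conditional covariance given the other bits. For functions of
    one bit this covariance is p (1 - p) times the product of the two differences, and
    Cauchy-Schwarz separates them. *)
Lemma avg_cov i F G : cyl_fun F -> cyl_fun G ->
  `|Ex (fun w => F w * G w) - Ex (fun w => avg i F w * avg i G w)| <= bit_infl i F * bit_infl i G.
Proof.
move=> cF cG; have cFG := cyl_comp2 *%R cF cG.
rewrite -(Ex_avg i cFG) -ExB; [|exact: cyl_avg|exact: (cyl_comp2 *%R (cyl_avg _ cF) (cyl_avg _ cG))].
rewrite (@eq_Ex _ _ _ (fun w => p i * (1 - p i) * (bit_diff i F w * bit_diff i G w))); last first.
  by move=> w; rewrite /avg /bit_diff; ring.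
rewrite ExZ; last exact: (cyl_comp2 *%R (cyl_bit_diff _ cF) (cyl_bit_diff _ cG)).
rewrite /bit_infl; move: (pq_ge0 i); move: (p i * _) => q q0.
rewrite normrM ger0_norm// !(sqrtrM _ q0) mulrACA -expr2 sqr_sqrtr//.
by rewrite ler_wpM2l// Ex_CauchySchwarz//; exact: cyl_bit_diff.
Qed.

(** Averaging over bit [j] commutes with the difference in bit [i], and by convexity of the square
    it does not increase the second moment. *)
Lemma bit_infl_avg i j F : cyl_fun F -> i != j -> bit_infl i (avg j F) <= bit_infl i F.
Proof.
move=> cF ij; rewrite ler_wsqrtr// ler_wpM2l ?pq_ge0//.
have cd := cyl_bit_diff i cF.
rewrite -(Ex_avg j (cyl_comp (fun x => x ^+ 2) cd)); apply: le_Ex.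
- exact: (cyl_comp (fun x => x ^+ 2) (cyl_bit_diff _ (cyl_avg _ cF))).
- exact: cyl_avg (cyl_comp (fun x => x ^+ 2) cd).
move=> w; rewrite /bit_diff /avg -!(upd_comm _ _ _ ij).
set a := F _; set b := F _; set c := F _; set d := F _.
have := pq_ge0 j; set q := p j.
have := sqr_ge0 ((a - c) - (b - d)); set e := _ ^+ 2 => e0 q0.
rewrite -subr_ge0 [leRHS](_ : _ = q * (1 - q) * e); last by rewrite /e; ring.
exact: mulr_ge0.
Qed.

(** The bits [k], ..., [k + m - 1] are integrated out, bit [k] last: each stage averages one bit of
    a function whose later bits are already averaged, which is the telescoping order of
    [avg_range_cov]. *)
Fixpoint avg_range (m k : nat) F := if m is m'.+1 then avg k (avg_range m' k.+1 F) else F.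

Lemma cyl_avg_range m k F : cyl_fun F -> cyl_fun (avg_range m k F).
Proof. by move=> cF; elim: m k => //= m ih k; exact: cyl_avg. Qed.

Lemma Ex_avg_range m k F : cyl_fun F -> Ex (avg_range m k F) = Ex F.
Proof.
by move=> cF; elim: m k => //= m ih k; rewrite Ex_avg//; exact: cyl_avg_range.
Qed.

Lemma bit_infl_avg_range i m k F : cyl_fun F -> (i < k)%N ->
  bit_infl i (avg_range m k F) <= bit_infl i F.
Proof.
move=> cF; elim: m k => //= m ih k ik.
apply: le_trans (ih k.+1 (leqW ik)); apply: bit_infl_avg; first exact: cyl_avg_range.
by rewrite ltn_eqF.
Qed.

Lemma avg_range_cov m k F G : cyl_fun F -> cyl_fun G ->
  `|Ex (fun w => F w * G w) - Ex (fun w => avg_range m k F w * avg_range m k G w)| <=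
  \sum_(i < m) bit_infl (k + i) F * bit_infl (k + i) G.
Proof.
move=> cF cG; elim: m k => [|m ih] k /=; first by rewrite subrr normr0 big_ord0.
rewrite big_ord_recl/= addn0 [leRHS]addrC.
under eq_bigr do rewrite -addSnnS.
rewrite -[X in `|X - _|](subrK (Ex (fun w => avg_range m k.+1 F w * avg_range m k.+1 G w))) -addrA.
apply: le_trans (ler_normD _ _) (lerD (ih _) _).
apply: le_trans (avg_cov _ _ _) _; try exact: cyl_avg_range.
by apply: ler_pM; rewrite ?sqrtr_ge0//; exact: bit_infl_avg_range.
Qed.

(** Once all bits below [m] are averaged the function is constant, and averaging preserves the
    mean. *)
Lemma avg_range_cst m F : depends_below m F -> avg_range m 0 F = fun=> Ex F.
Proof.
move=> dF; have cF : cyl_fun F by exists m.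
have key k l (K : bits -> R) : (forall w w', (forall j, (j < k + l)%N -> w j = w' j) -> K w = K w') ->
    forall w w', (forall j, (j < k)%N -> w j = w' j) -> avg_range l k K w = avg_range l k K w'.
  elim: l k => [|l ih] k /=; first by rewrite addn0.
  move=> h w w' e; rewrite /avg; congr (_ * _ + _ * _); apply: ih; rewrite ?addSnnS// => j;
    by rewrite ltnS leq_eqVlt /upd; case: eqP => //= _; exact: e.
have h w w' : avg_range m 0 F w = avg_range m 0 F w' by apply: key.
have -> : avg_range m 0 F = fun=> avg_range m 0 F (fun=> true) by apply/funext => w; exact: h.
rewrite -[Ex F](Ex_avg_range m 0 cF); apply/funext => w.
by rewrite (@eq_Ex _ _ _ (fun=> avg_range m 0 F (fun=> true))) ?Ex_cst// => w'; exact: h.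
Qed.

Lemma efron_stein_cov n F G : depends_below n F -> depends_below n G ->
  `|Ex (fun w => F w * G w) - Ex F * Ex G| <= \sum_(i < n) bit_infl i F * bit_infl i G.
Proof.
move=> dF dG; have cF : cyl_fun F by exists n.
have cG : cyl_fun G by exists n.
have := avg_range_cov n 0 cF cG; rewrite (avg_range_cst dF) (avg_range_cst dG).
by rewrite Ex_cst.
Qed.

(** In bit [i] alone, the second moment exceeds the variance by the square of the mean. *)
Lemma bit_infl_le i F : cyl_fun F -> bit_infl i F <= Num.sqrt (Ex (fun w => F w ^+ 2)).
Proof.
move=> cF; have c2 := cyl_comp (fun x => x ^+ 2) cF.
rewrite ler_wsqrtr// -(Ex_avg i c2) -ExZ; last exact: (cyl_comp (fun x => x ^+ 2) (cyl_bit_diff _ cF)).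
apply: le_Ex; [exact: (cyl_comp (fun x => _ * x ^+ 2) (cyl_bit_diff _ cF))|exact: cyl_avg|].
move=> w; rewrite /avg /bit_diff; set a := F _; set b := F _; set q := p i.
have := sqr_ge0 (q * a + (1 - q) * b); set e := _ ^+ 2 => e0.
by rewrite -subr_ge0 [leRHS](_ : _ = e)// /e; ring.
Qed.

(* Integrating out the coordinates in [s], on which only [K] depends, freezes [G]. *)
Definition avg_seq (s : seq nat) F := foldr avg F s.

Lemma cyl_avg_seq s F : cyl_fun F -> cyl_fun (avg_seq s F).
Proof. by move=> cF; elim: s => //= i s ih; exact: cyl_avg. Qed.

Lemma Ex_avg_seq s F : cyl_fun F -> Ex (avg_seq s F) = Ex F.
Proof. by move=> cF; elim: s => //= i s ih; rewrite Ex_avg//; exact: cyl_avg_seq. Qed.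

Definition depends_on (s : seq nat) (U : Type) (F : bits -> U) :=
  forall w w' : bits, {in s, w =1 w'} -> F w = F w'.

(** Phrased with [upd], because averaging over the bits of [s] only evaluates a function at updated
    arguments. *)
Definition free_of (s : seq nat) (U : Type) (F : bits -> U) :=
  forall i b w, i \in s -> F (upd w i b) = F w.

Lemma avg_seq_cst s F : cyl_fun F -> depends_on s F -> avg_seq s F = fun=> Ex F.
Proof.
move=> cF dF.
have key r t K : depends_on (r ++ t) K -> depends_on t (avg_seq r K).
  elim: r t => //= i r ih t h w w' e; rewrite /avg.
  have {}h : depends_on (i :: t) (avg_seq r K).
    apply: ih => u u' eu; apply: h => j jr; apply: eu.
    by move: jr; rewrite /= !(inE, mem_cat) => /or3P[] ->; rewrite ?orbT.
  congr (_ * _ + _ * _); apply: h => j; rewrite inE /upd; case: eqP => //= _; exact: e.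
have h w w' : avg_seq s F w = avg_seq s F w' by apply: (key s [::]); rewrite ?cats0.
have -> : avg_seq s F = fun=> avg_seq s F (fun=> true) by apply/funext => w; exact: h.
rewrite -[Ex F](Ex_avg_seq s cF); apply/funext => w.
by rewrite (@eq_Ex _ _ _ (fun=> avg_seq s F (fun=> true))) ?Ex_cst// => w'; exact: h.
Qed.

Lemma Ex_indep s (U V : Type) (H : U -> V -> R) (K : bits -> U) (G : bits -> V) :
  cyl_fun K -> cyl_fun G -> depends_on s K -> free_of s G ->
  Ex (fun w => H (K w) (G w)) = Ex (fun w => Ex (fun w' => H (K w') (G w))).
Proof.
move=> cK cG dK fG; rewrite -(Ex_avg_seq s); last exact: cyl_comp2.
apply: eq_Ex => w.
have key r u v : {subset r <= s} -> G u = G v -> avg_seq r (fun w => H (K w) (G w)) u =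
    avg_seq r (fun w => H (K w) (G v)) u.
  elim: r u => [|i r ih] u rs uv /=; first by rewrite uv.
  have rs' : {subset r <= s} by move=> j jr; apply: rs; rewrite inE jr orbT.
  have is' : i \in s by apply: rs; rewrite mem_head.
  by rewrite /avg; congr (_ * _ + _ * _); apply: ih => //; rewrite fG.
rewrite (key _ _ w)// avg_seq_cst//; first exact: (cyl_comp (H ^~ (G w))).
by move=> u u' /dK ->.
Qed.

End efron_stein.

(** * The shift and its mixing *)

Section shift.
Variables (R : realType) (p : nat -> R).
Hypothesis p01 : forall i, 0 < p i < 1.
Variable P : probability bits R.
Hypothesis PE : forall n s, P (cylinder n s) = (\prod_(j < n) bit_weight p (s j) j)%:E.
Variables tau tau' : nat -> nat.
Hypotheses (tauK : cancel tau tau') (tau'K : cancel tau' tau).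
Hypothesis p_tau : forall i, p (tau i) = p i.

Definition shift (w : bits) : bits := fun i => w (tau' i).

(** Cylinders over arbitrary finite index sets; the shift moves initial segments to such sets. *)
Definition fixing (J : seq nat) (t : nat -> bool) : set bits := [set w | forall i, i \in J -> w i = t i].

Lemma fixing_iota n s : fixing (iota 0 n) s = cylinder n s.
Proof.
apply/seteqP; split => w h i; first by move=> hi; apply: h; rewrite mem_iota.
by rewrite mem_iota => hi; exact: h.
Qed.

Lemma measurable_fixing J t : measurable (fixing J t).
Proof.
apply: (@measurable_dep (\max_(i <- J) i).+1) => w w' h.
have {}h i : i \in J -> w i = w' i by move=> iJ; apply: h; rewrite ltnS; apply: (@leq_bigmax_seq nat J xpredT (fun i : nat => i) i iJ isT).
by apply/propext; split => H i iJ; rewrite -(H i iJ) h.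
Qed.

(** Induction by redrawing the first bit of [J]: its prescribed value lifts one constraint, the
    other value gives the empty set. *)
Lemma prob_fixing J t : uniq J -> P (fixing J t) = (\prod_(i <- J) bit_weight p (t i) i)%:E.
Proof.
elim: J => [_|i J ih /= /andP[iJ uJ]].
  rewrite big_nil (_ : fixing _ _ = setT) ?probability_setT//.
  by apply/seteqP; split.
have good : (fun w => upd w i (t i)) @^-1` fixing (i :: J) t = fixing J t.
  apply/seteqP; split => w h j jJ.
    have := h j; rewrite inE jJ orbT /upd => /(_ isT).
    by case: eqP jJ iJ => // -> ->.
  by rewrite /upd; case: eqP jJ => [->//|/eqP ji]; rewrite inE (negbTE ji); exact: h.
have bad : (fun w => upd w i (~~ t i)) @^-1` fixing (i :: J) t = set0.
  apply/seteqP; split => // w /(_ i (mem_head _ _)); rewrite /upd eqxx.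
  by case: (t i).
rewrite (resampleE p01 PE i (measurable_fixing _ _)) big_cons.
case ti : (t i) good bad => /= -> ->; rewrite measure0 mule0 ?adde0 ?add0e ih// -EFinM.
Qed.

Lemma iter_tauK n : cancel (iter n tau) (iter n tau').
Proof. by elim: n => // n ih i; rewrite iterSr iterS tauK ih. Qed.

Lemma iter_tau'K n : cancel (iter n tau') (iter n tau).
Proof. by elim: n => // n ih i; rewrite iterSr iterS tau'K ih. Qed.

Lemma p_iter_tau n i : p (iter n tau i) = p i.
Proof. by elim: n => //= n ih; rewrite p_tau. Qed.

Lemma p_iter_tau' n i : p (iter n tau' i) = p i.
Proof. by rewrite -[in RHS](iter_tau'K n i) p_iter_tau. Qed.

Lemma iter_shift n w : iter n shift w = fun i => w (iter n tau' i).
Proof. by elim: n => //= n ->; apply/funext => i; rewrite /shift -iterSr. Qed.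

Lemma iter_shift_cylinder n m s : iter n shift @^-1` cylinder m s =
  fixing (map (iter n tau') (iota 0 m)) (s \o iter n tau).
Proof.
apply/seteqP; split => w; rewrite /preimage/= iter_shift => h.
  by move=> i /mapP[j]; rewrite mem_iota => /= jm ->; rewrite /= iter_tau'K; exact: h.
move=> j jm; have := h (iter n tau' j) _; rewrite /= iter_tau'K; apply.
by apply: map_f; rewrite mem_iota.
Qed.

Lemma measurable_iter_shift n : measurable_fun setT (iter n shift).
Proof.
apply: measurable_to_bits => i; rewrite (_ : [set _ | _] = [set w | w (iter n tau' i) = true]).
  exact: measurable_bit.
by apply/seteqP; split => w; rewrite /= iter_shift.
Qed.

Let iter_shift_mfun n : {mfun bits >-> bits} := mfun_Sub (mem_set (measurable_iter_shift n)).

(** Cylinders keep their probability because [p] is constant along the orbits of [tau]. *)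
Lemma iter_shift_inv n (A : set bits) : measurable A -> P (iter n shift @^-1` A) = P A.
Proof.
move=> mA.
apply: (measure_unique cylinder_sets (fun=> cylinder 0 (fun=> true))
  _ _ _ _ (distribution P (iter_shift_mfun n)) P) => //.
- exact: measurable_cylinder_setsE.
- exact: cylinder_sets_setI.
- by move=> _; right; exists 0%N, (fun=> true).
- by apply/seteqP; split => // w _; exists 0%N.
- move=> _ [->|[m [s ->]]]; first by rewrite !measure0.
  transitivity (P (iter n shift @^-1` cylinder m s)); first by [].
  rewrite iter_shift_cylinder prob_fixing.
    transitivity (P (cylinder m s)) => //.
    rewrite PE big_map -(big_mkord predT (fun j => bit_weight p (s j) j)) /index_iota subn0.
    by congr EFin; apply: eq_bigr => i _; rewrite /= iter_tau'K /bit_weight p_iter_tau'.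
  by rewrite map_inj_uniq ?iota_uniq//; exact: can_inj (iter_tau'K n).
- by move=> _; rewrite (le_lt_trans (probability_le1 _ _)) ?ltry//; exact: measurable_cylinder.
Qed.

Lemma integral_iter_shift n (F : bits -> \bar R) : measurable_fun setT F -> (forall w, 0 <= F w)%E ->
  (\int[P]_w F (iter n shift w) = \int[P]_w F w)%E.
Proof.
move=> mF F0; rewrite -(ge0_integral_distribution (iter_shift_mfun n))//.
by apply: eq_measure_integral => A mA _; exact: iter_shift_inv.
Qed.

Lemma integrable_iter_shift n (F : bits -> \bar R) : P.-integrable setT F ->
  P.-integrable setT (F \o iter n shift).
Proof.
move=> /integrableP[mF iF]; apply/integrableP; split.
  by apply: measurableT_comp => //; exact: measurable_iter_shift.
by rewrite (integral_iter_shift n (F := fun w => `|F w|%E))//; exact: measurableT_comp.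
Qed.

Lemma integral_iter_shift_integrable n (F : bits -> \bar R) : P.-integrable setT F ->
  (\int[P]_w F (iter n shift w) = \int[P]_w F w)%E.
Proof.
move=> iF; have iFn := integrable_iter_shift n iF; case/integrableP : (iF) => mF _.
rewrite -(integral_distribution (X := iter_shift_mfun n))//.
by apply: eq_measure_integral => A mA _; exact: iter_shift_inv.
Qed.

Lemma Ex_iter_shift n (F : bits -> R) : P.-integrable setT (EFin \o F) ->
  Rintegral P setT (fun w => F (iter n shift w)) = Rintegral P setT F.
Proof. by move=> iF; congr fine; apply: (integral_iter_shift_integrable n iF). Qed.

Hypothesis tau_free : forall i n m, iter n tau i = iter m tau i -> n = m.

(** By freeness a given pair satisfies [iter n tau i = j] for at most one [n]. *)
Lemma tau_separated (I J : seq nat) : exists N0, forall n, (N0 <= n)%N ->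
  forall i j, i \in I -> j \in J -> iter n tau i != j.
Proof.
have one i j : exists N0, forall n, (N0 <= n)%N -> iter n tau i != j.
  have [[m mij]|h] := pselect (exists m, iter m tau i = j).
    exists m.+1 => n mn; apply/eqP; rewrite -mij => /tau_free nm.
    by rewrite nm ltnn in mn.
  by exists 0%N => n _; apply/eqP => nij; apply: h; exists n.
elim: I => [|i I [N ih]]; first by exists 0%N.
have [M hM] : exists M, forall n, (M <= n)%N -> forall j, j \in J -> iter n tau i != j.
  elim: J {ih} => [|j J [M ih]]; first by exists 0%N.
  have [M' h'] := one i j; exists (maxn M M') => n; rewrite geq_max => /andP[Mn M'n] k.
  by rewrite inE => /predU1P[->|kJ]; [exact: h'|exact: ih].
exists (maxn N M) => n; rewrite geq_max => /andP[Nn Mn] k j.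
by rewrite inE => /predU1P[->|kI] jJ; [exact: hM|exact: ih].
Qed.

(** For large [k] the two events constrain disjoint sets of bits, so independence is exact and not
    merely asymptotic. *)
Lemma mixing_cylinder n s m t : \forall k \near \oo,
  P (cylinder n s `&` iter k shift @^-1` cylinder m t) = (P (cylinder n s) * P (cylinder m t))%E.
Proof.
have [N0 hN] := tau_separated (iota 0 n) (iota 0 m).
exists N0 => // k /= Nk; rewrite -[X in (_ * P X)%E]fixing_iota.
rewrite iter_shift_cylinder -fixing_iota.
pose J := map (iter k tau') (iota 0 m).
pose u i := if (i < n)%N then s i else t (iter k tau i).
have disj i : i \in J -> (i < n)%N = false.
  move=> /mapP[j jm ->]; apply/negP => ji.
  have := hN k Nk (iter k tau' j) j; rewrite iter_tau'K eqxx mem_iota ji.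
  by move=> /(_ isT jm).
have uJ : uniq J by rewrite map_inj_uniq ?iota_uniq//; exact: can_inj (iter_tau'K k).
rewrite (_ : _ `&` _ = fixing (iota 0 n ++ J) u).
  rewrite !prob_fixing ?iota_uniq//; last first.
    rewrite cat_uniq iota_uniq uJ andbT/=; apply/hasPn => i /disj; rewrite mem_iota/= => h.
    by rewrite h.
  rewrite -EFinM big_cat/=; congr (_ * _)%:E.
    by apply: eq_big_seq => i; rewrite mem_iota add0n /u => /= ->.
  rewrite /J big_map; apply: eq_big_seq => j jm; rewrite /u disj; last exact: map_f.
  by rewrite iter_tau'K /bit_weight p_iter_tau'.
apply/seteqP; split => w.
  move=> [h1 h2] i; rewrite mem_cat => /orP[iI|iJ].
    by rewrite h1// /u; move: iI; rewrite mem_iota add0n => /= ->.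
  by rewrite h2// /u disj.
move=> h; split => i iI; rewrite h ?mem_cat ?iI ?orbT// /u.
  by move: iI; rewrite mem_iota add0n => /= ->.
by rewrite disj.
Qed.

Lemma fine_probU (A B : set bits) : measurable A -> measurable B -> A `&` B = set0 ->
  fine (P (A `|` B)) = fine (P A) + fine (P B).
Proof. by move=> mA mB AB; rewrite measureU// fineD// fin_num_measure. Qed.

(** The sets on which [Q N] converges to [c P] form a Dynkin class. Complements use the limit [c] on
    the whole space, which is the cylinder of length 0; countable unions use the domination of [Q N]
    by [P], which makes the tails small uniformly in [N]. *)
Lemma dynkin_cvg (Q : nat -> set bits -> R) (c : R) :
  (forall N A B, measurable A -> measurable B -> A `&` B = set0 -> Q N (A `|` B) = Q N A + Q N B) ->
  (forall N A, measurable A -> 0 <= Q N A <= fine (P A)) ->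
  (forall n s, Q N (cylinder n s) @[N --> \oo] --> c * fine (P (cylinder n s))) ->
  forall A, measurable A -> Q N A @[N --> \oo] --> c * fine (P A).
Proof.
move=> QU Q0 Qc.
have fP A : measurable A -> P A = (fine (P A))%:E.
  by move=> mA; rewrite fineK// fin_num_measure.
have c01 : 0 <= c <= 1.
  have := Qc 0%N (fun=> true); rewrite (_ : cylinder 0 _ = setT); last by apply/seteqP; split.
  rewrite [X in fine X]probability_setT mulr1 => h; apply/andP; split.
    apply: (cvgr_to_ge h); near=> N; by have /andP[] := Q0 N setT measurableT.
  apply: (cvgr_to_le h); near=> N; have /andP[_] := Q0 N setT measurableT.
  by rewrite [X in fine X]probability_setT.
have QT : Q N setT @[N --> \oo] --> c.
  have := Qc 0%N (fun=> true); rewrite (_ : cylinder 0 _ = setT); last by apply/seteqP; split.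
  by rewrite [X in fine X]probability_setT mulr1.
move=> A mA; apply: (@dynkin_induction _ bits cylinder_sets
  (fun A => Q N A @[N --> \oo] --> c * fine (P A))) => //; last by rewrite -measurable_cylinder_setsE.
- exact: measurable_cylinder_setsE.
- exact: cylinder_sets_setI.
- by rewrite [X in fine X]probability_setT mulr1.
- move=> _ [->|[n [s ->]]]//; rewrite measure0/= mulr0.
  rewrite (_ : (fun N => _) = fun=> 0); first exact: cvg_cst.
  by apply/funext => N; have := Q0 N set0 measurable0; rewrite measure0 /= -eq_le => /eqP.
- move=> B mB hB; rewrite probability_setC// fP//= mulrBr mulr1.
  rewrite (_ : (fun N => _) = fun N => Q N setT - Q N B); first exact: cvgB.
  apply/funext => N; rewrite -(setUv B) QU ?setICr//; last exact: measurableC.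
  by rewrite addrAC subrr add0r.
move=> F mF tF hF; pose U K := \big[setU/set0]_(k < K) F k.
have mU K : measurable (U K) by exact: bigsetU_measurable.
have mFU : measurable (\bigcup_k F k) by exact: bigcupT_measurable.
have US K : U K `<=` \bigcup_k F k.
  by rewrite /U -bigcup_mkord => w [k _ Fk]; exists k.
have hU K : Q N (U K) @[N --> \oo] --> c * fine (P (U K)).
  elim: K => [|K ih].
    rewrite /U big_ord0 measure0/= mulr0.
    rewrite (_ : (fun N => _) = fun=> 0); first exact: cvg_cst.
    by apply/funext => N; have := Q0 N set0 measurable0; rewrite measure0 /= -eq_le => /eqP.
  have UF : U K `&` F K = set0.
    apply/seteqP; split => // w []; rewrite /U -bigcup_mkord => -[k kK Fk] FK.
    move/trivIsetP : tF => /(_ k K Logic.I Logic.I); rewrite ltn_eqF// => /(_ isT).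
    by move=> /seteqP[+ _] => /(_ w); apply.
  have -> : U K.+1 = U K `|` F K by rewrite /U big_ord_recr.
  rewrite fine_probU// mulrDr.
  rewrite (_ : (fun N => _) = fun N => Q N (U K) + Q N (F K)); first exact: cvgD.
  by apply/funext => N; rewrite QU.
have PU : fine (P (U K)) @[K --> \oo] --> fine (P (\bigcup_k F k)).
  apply: fine_cvg; rewrite -fP//.
  rewrite (_ : \bigcup_k F k = \bigcup_k U k).
    apply: nondecreasing_cvg_mu => //; first exact: bigcupT_measurable.
    by move=> a b ab; apply/subsetPset; exact: subset_bigsetU.
  apply/seteqP; split => w [k _ h]; last exact: (US k).
  by exists k.+1 => //; rewrite /U -bigcup_mkord; exists k => //=.
apply/cvgrPdist_le => e e0; have e3 : 0 < e / 3 by rewrite divr_gt0.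
have /cvgrPdist_le/(_ _ e3)[K _ /(_ K (leqnn K)) hK] := PU.
have /cvgrPdist_le/(_ _ e3) hQ := hU K.
near=> N; have hQN : `|c * fine (P (U K)) - Q N (U K)| <= e / 3 by near: N; exact: hQ.
pose V := (\bigcup_k F k) `\` U K; have mV : measurable V by exact: measurableD.
have UV : U K `|` V = \bigcup_k F k by rewrite /V setDUK.
have UV0 : U K `&` V = set0 by rewrite /V setDIK.
have Q1 : Q N (\bigcup_k F k) = Q N (U K) + Q N V by rewrite -QU// UV.
have P1 : fine (P (\bigcup_k F k)) = fine (P (U K)) + fine (P V).
  by rewrite -fine_probU// UV.
have /andP[V0 V1] := Q0 N V mV.
have /andP[c0 c1] := c01.
have P0 : 0 <= fine (P V) by rewrite fine_ge0.
have PVe : fine (P V) <= e / 3.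
  by move: hK; rewrite P1 addrAC subrr add0r ger0_norm.
have cV : 0 <= c * fine (P V) <= e / 3.
  by rewrite mulr_ge0//= (le_trans _ PVe)// ler_piMl.
rewrite Q1 P1; move: hQN; rewrite !ler_norml => /andP[h1 h2]; case/andP : cV => g1 g2.
by apply/andP; split; lra.
Unshelve. all: by end_near. Qed.

(** Two applications of [dynkin_cvg]: with a cylinder fixed on the left the class runs over the
    right-hand set, then with an arbitrary set fixed on the right it runs over the left-hand one.
    The first uses the invariance of [P] to bound the intersection by the measure of the right-hand
    set. *)
Lemma shift_mixing (A B : set bits) : measurable A -> measurable B ->
  (fun k => P (A `&` iter k shift @^-1` B)) @ \oo --> (P A * P B)%E.
Proof.
have fP C : measurable C -> P C = (fine (P C))%:E.
  by move=> mC; rewrite fineK// fin_num_measure.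
have mS k C : measurable C -> measurable (iter k shift @^-1` C).
  by move=> mC; rewrite -[X in measurable X]setTI; exact: measurable_iter_shift.
pose Q k A B := fine (P (A `&` iter k shift @^-1` B)).
have bnd k C D : measurable C -> measurable D -> 0 <= Q k C D <= fine (P C) /\ Q k C D <= fine (P D).
  move=> mC mD; have mCD := measurableI _ _ mC (mS k _ mD).
  split; first (apply/andP; split; first exact: fine_ge0).
    rewrite fine_le// ?fin_num_measure//; apply: le_measure; rewrite ?inE//.
  rewrite -[in leRHS](iter_shift_inv k mD) fine_le// ?fin_num_measure//; try exact: mS.
  by apply: le_measure; rewrite ?inE//; exact: mS.
have step1 n s D : measurable D -> Q k (cylinder n s) D @[k --> \oo] --> fine (P (cylinder n s)) * fine (P D).
  apply: (dynkin_cvg (Q := fun k => Q k (cylinder n s))).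
  - move=> k C E mC mE CE; rewrite /Q preimage_setU setIUr fine_probU//.
    + by apply: measurableI; [exact: measurable_cylinder|exact: mS].
    + by apply: measurableI; [exact: measurable_cylinder|exact: mS].
    + by rewrite setIACA -preimage_setI CE preimage_set0 setI0.
  - move=> k C mC; have [/andP[-> _] ->//] := bnd k _ _ (measurable_cylinder n s) mC.
  - move=> m t; apply: cvg_near_cst; near=> k.
    rewrite /Q; have -> : P (cylinder n s `&` iter k shift @^-1` cylinder m t) =
      (P (cylinder n s) * P (cylinder m t))%E by near: k; exact: mixing_cylinder.
    by rewrite fineM// fin_num_measure//; exact: measurable_cylinder.
move=> mA mB.
have : Q k A B @[k --> \oo] --> fine (P B) * fine (P A).
  apply: (dynkin_cvg (Q := fun k A => Q k A B)) mA.
  - move=> k C E mC mE CE; rewrite /Q setIUl fine_probU//.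
    + by apply: measurableI => //; exact: mS.
    + by apply: measurableI => //; exact: mS.
    + by rewrite setIACA CE set0I.
  - by move=> k C mC; have [] := bnd k _ _ mC mB.
  - by move=> n s; rewrite mulrC; exact: step1.
move=> h; rewrite [P A]fP// [P B]fP// -EFinM mulrC.
rewrite (_ : (fun k => _) = fun k => (Q k A B)%:E); first by apply: cvg_EFin => //; near=> k.
by apply/funext => k; rewrite /Q -fP//; apply: measurableI => //; exact: mS.
Unshelve. all: by end_near. Qed.

End shift.

(** * Unconditional convergence *)

Section unconditional.
Variables (R : realType) (X : normedModType R).

(* If finite sums over sets of large indices do not become small, listing such
   sets one after the other (and the skipped indices in between) gives a
   rearrangement whose partial sums are not Cauchy. *)
Section rearrangement.
Variable g : nat -> seq nat.
Hypothesis g_uniq : forall N, uniq (g N).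
Hypothesis g_neq0 : forall N, g N != [::].
Hypothesis g_ge : forall N i, i \in g N -> (N <= i)%N.

Let top N := (\max_(i <- g N) i).+1.

Let g_top N i : i \in g N -> (i < top N)%N.
Proof. by move=> iN; rewrite ltnS; exact: (@leq_bigmax_seq nat (g N) xpredT (fun i : nat => i)). Qed.

(** After [k] rounds, a bound and a list that enumerates exactly the indices below it ([L_perm]);
    the block chosen at that bound consists of indices not yet listed. *)
Fixpoint rearr_blocks k : nat * seq nat :=
  if k is k'.+1 then
    let: (N, L) := rearr_blocks k' in
    (top N, L ++ g N ++ [seq i <- iota N (top N - N) | i \notin g N])
  else (0%N, [::]).

Let N k := (rearr_blocks k).1.
Let L k := (rearr_blocks k).2.

Let NS k : N k.+1 = top (N k).
Proof. by rewrite /N /=; case: (rearr_blocks k). Qed.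

Let LS k : L k.+1 = L k ++ g (N k) ++ [seq i <- iota (N k) (top (N k) - N k) | i \notin g (N k)].
Proof. by rewrite /L /N /=; case: (rearr_blocks k). Qed.

Let N_lt k : (N k < N k.+1)%N.
Proof.
rewrite NS; case E : (g (N k)) (g_neq0 (N k)) => [//|i s] _.
have iN : i \in g (N k) by rewrite E mem_head.
by rewrite (leq_ltn_trans (g_ge iN))// g_top.
Qed.

Let N_ge k : (k <= N k)%N.
Proof. by elim: k => // k ih; rewrite (leq_ltn_trans ih). Qed.

Let L_perm k : perm_eq (L k) (iota 0 (N k)).
Proof.
elim: k => // k ih; rewrite LS.
have NT := ltnW (N_lt k); rewrite NS in NT.
rewrite NS -(subnKC NT) iotaD add0n subnKC//; apply: perm_cat => //.
rewrite -(permPr (permEl (perm_filterC (mem (g (N k))) (iota (N k) _)))); apply: perm_cat => //.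
apply: uniq_perm => //; first by rewrite filter_uniq// iota_uniq.
move=> i; rewrite mem_filter; rewrite inE; have [ig|//] := boolP (i \in g (N k)).
by rewrite mem_iota subnKC// (g_ge ig) (g_top ig).
Qed.

Let L_size k : size (L k) = N k.
Proof. by rewrite (perm_size (L_perm k)) size_iota. Qed.

Let L_nth k l i : (k <= l)%N -> (i < N k)%N -> nth 0%N (L l) i = nth 0%N (L k) i.
Proof.
move=> /subnK <-; elim: (l - k)%N => // m ih ik.
rewrite addSn LS nth_cat L_size ih//.
suff -> : (i < N (m + k))%N by [].
rewrite (leq_trans ik)//; elim: m {ih} => // m ih; rewrite addSn (leq_trans ih)// ltnW//.
Qed.

(** Later rounds only append to the list, and after [i.+1] rounds it is longer than [i], so position
    [i] is settled. *)
Definition rearr i := nth 0%N (L i.+1) i.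

Let rearrE k i : (i < N k)%N -> rearr i = nth 0%N (L k) i.
Proof.
move=> ik; rewrite /rearr; have [h|/ltnW h] := leqP k i.+1; first exact: L_nth.
by rewrite (L_nth h)//; exact: N_ge.
Qed.

Lemma rearr_bij : bijective rearr.
Proof.
have inj : injective rearr.
  move=> i j; pose K := (maxn i j).+1.
  have iK : (i < N K)%N by rewrite (leq_trans _ (N_ge K))// ltnS leq_maxl.
  have jK : (j < N K)%N by rewrite (leq_trans _ (N_ge K))// ltnS leq_maxr.
  rewrite (rearrE iK) (rearrE jK) => /eqP; rewrite nth_uniq ?L_size//; first by move/eqP.
  by rewrite (perm_uniq (L_perm K)) iota_uniq.
have K v : rearr (index v (L v.+1)) = v.
  have vL : v \in L v.+1 by rewrite (perm_mem (L_perm _)) mem_iota/= add0n; exact: N_ge.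
  by rewrite (@rearrE v.+1) ?nth_index// -L_size index_mem.
by exists (fun v => index v (L v.+1)) => // i; apply: inj; exact: K.
Qed.

Lemma rearr_block (u : nat -> X) k :
  exists n m, [/\ (k <= n)%N, (n <= m)%N &
    series (u \o rearr) m - series (u \o rearr) n = \sum_(i <- g (N k)) u i].
Proof.
exists (N k), (N k + size (g (N k)))%N; split; [exact: N_ge|exact: leq_addr|].
rewrite sub_series_geq ?leq_addr// -{1}[N k]add0n big_addn addKn.
rewrite [RHS](big_nth 0%N) !big_mkord; apply: eq_bigr => i _ /=; congr u.
have iN : (i + N k < N k.+1)%N.
  rewrite -[N k.+1]L_size LS !size_cat L_size addnC ltn_add2l.
  by rewrite (leq_trans (ltn_ord i))// leq_addr.
by rewrite (rearrE iN) LS nth_cat L_size ltnNge leq_addl/= addnK nth_cat ltn_ord.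
Qed.

End rearrangement.

Lemma uncond_summable_cauchy (u : nat -> X) : uncond_summable u ->
  forall e, 0 < e -> exists N, forall s, uniq s -> (forall i, i \in s -> (N <= i)%N) ->
    `|\sum_(i <- s) u i| <= e.
Proof.
move=> hu e e0; apply: contrapT => /forallNP h.
have {h}/choice[g hg] : forall N, exists s : seq nat,
    [/\ uniq s, (forall i, i \in s -> (N <= i)%N) & e < `|\sum_(i <- s) u i|].
  move=> N; apply: contrapT => /forallNP hN; apply: (h N) => s us sN.
  by rewrite leNgt; apply/negP => es; exact: (hN s).
have gu N : uniq (g N) by case: (hg N).
have g0 N : g N != [::].
  by case: (hg N) => _ _; case: (g N) => //; rewrite big_nil normr0 ltNge ltW.
have gge N i : i \in g N -> (N <= i)%N by case: (hg N) => _ + _; apply.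
have /cvg_ex[l /cvgrPdist_le hl] := hu _ (rearr_bij gu g0 gge).
have [|k _ hk] := hl (e / 2); first by rewrite divr_gt0.
have [n [m [kn nm enm]]] := rearr_block gu g0 gge u k.
have [_ _] := hg ((rearr_blocks g k).1); rewrite -enm ltNge => /negP; apply.
rewrite (_ : _ - _ = (l - series (u \o rearr g) n) - (l - series (u \o rearr g) m)); last first.
  by rewrite opprB [RHS]addrC addrA subrK.
rewrite (le_trans (ler_normB _ _))// [leRHS]splitr lerD//; apply: hk => //=.
exact: leq_trans nm.
Qed.

Lemma two_sided_cauchy (u v : nat -> X) (z : int -> X) :
  uncond_summable u -> uncond_summable v ->
  (forall n : nat, z n%:Z = u n) -> (forall n : nat, z (- n.+1%:Z) = v n.+1) ->
  forall e, 0 < e -> exists J : seq int, forall s, uniq s -> (forall j, j \in s -> j \notin J) ->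
    `|\sum_(j <- s) z j| <= e.
Proof.
move=> hu hv zu zv e e0.
have e2 : 0 < e / 2 by rewrite divr_gt0.
have [N1 h1] := uncond_summable_cauchy hu e2.
have [N2 h2] := uncond_summable_cauchy hv e2.
(* [Negz m] is -(m + 1) and carries [v m.+1], so excluding [Negz m] for m < N2 leaves only indices
   of [v] above [N2]. *)
exists (map Posz (iota 0 N1) ++ map Negz (iota 0 N2)) => s us sJ.
rewrite (bigID (fun j => 0 <= j))/= (le_trans (ler_normD _ _))// [leRHS]splitr lerD//.
  rewrite -big_filter (_ : [seq _ <- _ | _] = map Posz (map absz [seq j <- s | 0 <= j])).
    rewrite big_map; under eq_bigr do rewrite zu; apply: h1.
      rewrite map_inj_in_uniq ?filter_uniq// => i j; rewrite !mem_filter => /andP[i0 _] /andP[j0 _].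
      by lia.
    move=> n /mapP[j]; rewrite mem_filter => /andP[j0 js] ->; rewrite leqNgt; apply/negP => nN.
    have := sJ j js; rewrite mem_cat negb_or => /andP[/negP + _]; apply; apply/mapP.
    by exists `|j|%N; [rewrite mem_iota|rewrite gez0_abs].
  rewrite -map_comp -[LHS]map_id; apply/eq_in_map => j; rewrite mem_filter => /andP[j0 _] /=.
  by rewrite gez0_abs.
rewrite -big_filter (_ : [seq _ <- _ | _] =
  map (fun n => - (n%:Z)) (map absz [seq j <- s | ~~ (0 <= j)])).
  rewrite big_map big_seq (eq_bigr v) -?big_seq; last first.
    move=> n /mapP[j]; rewrite mem_filter => /andP[j0 _] ->.
    by case: j j0 => // m _; rewrite -zv.
  apply: h2.
    rewrite map_inj_in_uniq ?filter_uniq// => i j; rewrite !mem_filter => /andP[i0 _] /andP[j0 _].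
    by lia.
  move=> n /mapP[j]; rewrite mem_filter => /andP[j0 js] ->; rewrite leqNgt; apply/negP => nN.
  have := sJ j js; rewrite mem_cat negb_or => /andP[_ /negP]; apply; apply/mapP.
  case: j j0 nN {js} => // m _ nN; exists m => //; rewrite mem_iota add0n/=; lia.
rewrite -map_comp -[LHS]map_id; apply/eq_in_map => j; rewrite mem_filter => /andP[j0 _] /=; lia.
Qed.

End unconditional.

(** * The random series *)

(* [rs_kk i] is the orbit (the slice) of the index [i] under [rs_tau].  In slice
   [k], the finite sums of the [rs_y i] are bounded by [rs_M k], and by
   [2^-(k+1)] as soon as they avoid the finite set [rs_B k]. *)
Record random_series (R : realType) (X : completeNormedModType R) := RandomSeries {
  rs_p : nat -> R;
  rs_p01 : forall i, 0 < rs_p i < 1;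
  rs_P : probability bits R;
  rs_PE : forall n s, rs_P (cylinder n s) = (\prod_(j < n) bit_weight rs_p (s j) j)%:E;
  rs_tau : nat -> nat;
  rs_tau' : nat -> nat;
  rs_tauK : cancel rs_tau rs_tau';
  rs_tau'K : cancel rs_tau' rs_tau;
  rs_p_tau : forall i, rs_p (rs_tau i) = rs_p i;
  rs_tau_free : forall i n m, iter n rs_tau i = iter m rs_tau i -> n = m;
  rs_y : nat -> X;
  rs_T : {linear X -> X};
  rs_T_cont : continuous rs_T;
  rs_Ty : forall i, rs_T (rs_y i) = rs_y (rs_tau i);
  rs_kk : nat -> nat;
  rs_B : nat -> seq nat;
  rs_M : nat -> R;
  rs_M_ge0 : forall k, 0 <= rs_M k;
  rs_slice_bound : forall k s, uniq s -> (forall i, i \in s -> rs_kk i = k) ->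
    `|\sum_(i <- s) rs_y i| <= rs_M k;
  rs_slice_small : forall k s, uniq s -> (forall i, i \in s -> rs_kk i = k /\ i \notin rs_B k) ->
    `|\sum_(i <- s) rs_y i| <= 2^-1 ^+ k.+1;
  rs_slice_cauchy : forall k e, 0 < e -> exists J : seq nat, forall s, uniq s ->
    (forall i, i \in s -> rs_kk i = k /\ i \notin J) -> `|\sum_(i <- s) rs_y i| <= e;
  rs_bad_prob : forall k, (\sum_(i <- rs_B k) rs_p i) * expR (\sum_(l < k.+1) rs_M l) <= 2^-1 ^+ k.+1 }.

Lemma sum_half_pow (R : realType) K : \sum_(k < K) 2^-1 ^+ k.+1 = 1 - 2^-1 ^+ K :> R.
Proof.
elim: K => [|K ih]; first by rewrite big_ord0 expr0 subrr.
by rewrite big_ord_recr/= ih exprS; lra.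
Qed.

Lemma half_pow_ge0 (R : realType) k : 0 <= 2^-1 ^+ k :> R.
Proof. by rewrite exprn_ge0. Qed.

Section random_series_theory.
Context (R : realType) (X : completeNormedModType R) (D : random_series X).

Notation p := (rs_p D).
Notation P := (rs_P D).
Notation y := (rs_y D).
Notation tau := (rs_tau D).
Notation tau' := (rs_tau' D).
Notation M := (rs_M D).
Notation kk := (rs_kk D).

Local Notation Ex F := (Rintegral P setT F).

Definition psum (A : seq nat) (w : bits) : X := \sum_(i <- A | w i) y i.

Definition bad k (w : bits) : bool := has (fun i => w i) (rs_B D k).

Lemma psum_cyl A : cyl_fun (psum A).
Proof.
rewrite /psum; under eq_fun do rewrite big_mkcond/=.
by apply: cyl_sum => i; exact: (cyl_comp (fun b : bool => if b then y i else 0) (cyl_bit i)).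
Qed.

Lemma bad_cyl k : cyl_fun (bad k).
Proof.
rewrite /bad; elim: (rs_B D k) => [|i s ih] /=; first exact: cyl_cst.
exact: (cyl_comp2 orb (cyl_bit i) ih).
Qed.

Lemma psum_slices A w K : (forall i, i \in A -> (kk i < K)%N) ->
  psum A w = \sum_(k < K) \sum_(i <- [seq i <- A | w i & kk i == k]) y i.
Proof.
move=> hK; under [RHS]eq_bigr do rewrite big_filter.
rewrite /psum big_seq_cond (eq_bigr (fun i => \sum_(k < K | kk i == k) y i)); last first.
  by move=> i /andP[iA _]; rewrite (big_pred1 (Ordinal (hK i iA)))// => k; rewrite -val_eqE eq_sym.
rewrite (exchange_big_dep predT)//=; apply: eq_bigr => k _.
by rewrite [RHS]big_seq_cond; apply: eq_bigl => i; rewrite andbA.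
Qed.

Lemma norm_slice A w k : uniq A ->
  `|\sum_(i <- [seq i <- A | w i & kk i == k]) y i| <= 2^-1 ^+ k.+1 + (bad k w)%:R * M k.
Proof.
move=> uA; have uf : uniq [seq i <- A | w i & kk i == k] by rewrite filter_uniq.
case: (boolP (bad k w)) => [_|/hasPn nb].
  rewrite mul1r (@le_trans _ _ (M k)) ?lerDr ?half_pow_ge0//; apply: rs_slice_bound => // i.
  by rewrite mem_filter => /andP[/andP[_ /eqP]].
rewrite mul0r addr0; apply: (rs_slice_small uf) => i; rewrite mem_filter => /andP[/andP[wi /eqP ki] _].
by split=> //; apply/negP => /nb; rewrite wi.
Qed.

Lemma norm_psum A w K : uniq A -> (forall i, i \in A -> (kk i < K)%N) ->
  `|psum A w| <= 1 + \sum_(k < K) (bad k w)%:R * M k.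
Proof.
move=> uA hK; rewrite (psum_slices w hK) (le_trans (ler_norm_sum _ _ _))//.
apply: (@le_trans _ _ (\sum_(k < K) (2^-1 ^+ k.+1 + (bad k w)%:R * M k))).
  by apply: ler_sum => k _; exact: norm_slice.
by rewrite big_split/= lerD2r sum_half_pow gerBl half_pow_ge0.
Qed.

Definition Mtot k := \sum_(l < k.+1) M l.

Lemma Mtot_ge0 k : 0 <= Mtot k.
Proof. by apply: sumr_ge0 => l _; exact: rs_M_ge0. Qed.

(* If [k] is the last bad slice, the sum on the left is at most [Mtot k]. *)
Lemma expR_bad_sum w K : expR (\sum_(k < K) (bad k w)%:R * M k) <=
  1 + \sum_(k < K) (bad k w)%:R * expR (Mtot k).
Proof.
elim: K => [|K ih]; first by rewrite !big_ord0 expR0 addr0.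
rewrite !big_ord_recr/=; case: (bad K w); last by rewrite !mul0r !addr0.
rewrite !mul1r; apply: (@le_trans _ _ (expR (Mtot K))).
  rewrite ler_expR /Mtot big_ord_recr/= lerD2r ler_sum// => k _.
  by case: (bad k w); rewrite ?mul1r ?mul0r// rs_M_ge0.
by rewrite addrA lerDr addr_ge0// sumr_ge0// => k _; rewrite mulr_ge0// expR_ge0.
Qed.

Lemma kk_bounded (A : seq nat) : exists K, forall i, i \in A -> (kk i < K)%N.
Proof.
exists (\max_(i <- A) kk i).+1 => i iA; rewrite ltnS.
exact: (@leq_bigmax_seq nat A xpredT kk i iA isT).
Qed.

Lemma expR_norm_psum A w : uniq A -> exists K, forall L, (K <= L)%N ->
  expR `|psum A w| <= expR 1 * (1 + \sum_(k < L) (bad k w)%:R * expR (Mtot k)).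
Proof.
move=> uA; have [K hK] := kk_bounded A; exists K => L KL.
have hL i : i \in A -> (kk i < L)%N by move=> /hK h; exact: leq_trans KL.
apply: (@le_trans _ _ (expR (1 + \sum_(k < L) (bad k w)%:R * M k))).
  by rewrite ler_expR norm_psum.
by rewrite expRD ler_wpM2l ?expR_ge0// expR_bad_sum.
Qed.

Lemma Ex_bit i : Ex (fun w => (w i)%:R) = p i.
Proof.
have cb : cyl_fun (fun w : bits => (w i)%:R : R) by exact: (cyl_comp (fun b : bool => b%:R) (cyl_bit i)).
rewrite -(Ex_avg (rs_p01 D) (@rs_PE _ _ D) i cb) -[RHS](Ex_cst P); apply: eq_Ex => w.
by rewrite /avg /upd eqxx mulr1 mulr0 addr0.
Qed.

Lemma bad_cylR k : cyl_fun (fun w => (bad k w)%:R : R).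
Proof. exact: (cyl_comp (fun b : bool => b%:R) (bad_cyl k)). Qed.

(** Union bound over the bits of [rs_B D k], then [rs_bad_prob]. *)
Lemma Ex_bad k : Ex (fun w => (bad k w)%:R * expR (Mtot k)) <= 2^-1 ^+ k.+1.
Proof.
apply: le_trans (rs_bad_prob D k); rewrite mulrC.
rewrite (@eq_Ex _ _ _ (fun w => expR (Mtot k) * (bad k w)%:R)); last by move=> w; rewrite mulrC.
rewrite ExZ; last exact: bad_cylR.
rewrite ler_wpM2l ?expR_ge0//; under eq_bigr do rewrite -Ex_bit.
have cb i : cyl_fun (fun w : bits => (w i)%:R : R) by exact: (cyl_comp (fun b : bool => b%:R) (cyl_bit i)).
rewrite -Ex_sum//; apply: le_Ex; [exact: bad_cylR|exact: cyl_sum|] => w.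
rewrite /bad; elim: (rs_B D k) => [|i s ih] /=; first by rewrite big_nil.
rewrite big_cons; case: (w i) => /=; last by rewrite add0r.
by rewrite lerDl sumr_ge0.
Qed.

(** A majorant that no longer refers to the finite set being summed, with integral at most the sum
    of the 2^-(k+1). It is extended-valued, and finite almost surely. *)
Definition bad_series (w : bits) : \bar R := (\sum_(0 <= k <oo) ((bad k w)%:R * expR (Mtot k))%:E)%E.

Let term_ge0 k w : (0 <= ((bad k w)%:R * expR (Mtot k))%:E)%E.
Proof. by rewrite lee_fin mulr_ge0// expR_ge0. Qed.

Let measurable_term k : measurable_fun setT (fun w => ((bad k w)%:R * expR (Mtot k))%:E).
Proof.
by apply/measurable_EFinP; apply: cyl_measurable; exact: (cyl_comp ( *%R^~ (expR (Mtot k))) (bad_cylR k)).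
Qed.

Lemma bad_series_ge0 w : (0 <= bad_series w)%E.
Proof. exact: nneseries_ge0. Qed.

Lemma measurable_bad_series : measurable_fun setT bad_series.
Proof. by apply: ge0_emeasurable_sum. Qed.

Lemma integral_bad_series : (\int[P]_w bad_series w <= 1)%E.
Proof.
rewrite integral_nneseries//; apply: lime_le.
  by apply: is_cvg_nneseries => k _ _; exact: integral_ge0.
near=> K; rewrite big_mkord.
apply: (@le_trans _ _ (\sum_(k < K) (2^-1 ^+ k.+1)%:E)%E).
  apply: lee_sum => k _.
  have /integrable_fin_num : P.-integrable setT (EFin \o (fun w => (bad k w)%:R * expR (Mtot k))).
    by apply: cyl_integrable; exact: (cyl_comp ( *%R^~ (expR (Mtot k))) (bad_cylR k)).
  by move=> /(_ measurableT)/fineK <-; rewrite lee_fin; exact: Ex_bad.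
by rewrite sumEFin sum_half_pow lee_fin gerBl half_pow_ge0.
Unshelve. all: by end_near. Qed.

(** The factor [expR 1] accounts for the terms 2^-(k+1) in the bounds of the slices, which add at
    most 1 to the norm. *)
Definition envelope (w : bits) : \bar R := ((expR 1)%:E * (1 + bad_series w))%E.

Lemma integrable_bad_series : P.-integrable setT bad_series.
Proof.
apply/integrableP; split; first exact: measurable_bad_series.
under eq_integral do rewrite gee0_abs ?bad_series_ge0//.
by rewrite (le_lt_trans integral_bad_series)// ltry.
Qed.

Lemma integrable_envelope : P.-integrable setT envelope.
Proof.
apply: integrableZl => //; apply: integrableD => //; last exact: integrable_bad_series.
by apply: (@bounded_integrable _ P (fun=> 1) 1) => // w; rewrite normr1.
Qed.

Lemma expR_norm_psum_envelope A w : uniq A -> ((expR `|psum A w|)%:E <= envelope w)%E.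
Proof.
move=> uA; have [K /(_ K (leqnn K)) hK] := expR_norm_psum w uA.
apply: (@le_trans _ _ (expR 1 * (1 + \sum_(k < K) (bad k w)%:R * expR (Mtot k)))%:E).
  by rewrite lee_fin.
rewrite EFinM EFinD; apply: lee_wpmul2l; first by rewrite lee_fin expR_ge0.
rewrite leeD2l// -sumEFin -(big_mkord xpredT (fun k => ((bad k w)%:R * expR (Mtot k))%:E)).
by apply: nneseries_lim_ge => k _ _.
Qed.

Lemma Ex_expR_norm_psum A : uniq A -> Ex (fun w => expR `|psum A w|) <= expR 1 * 2.
Proof.
move=> uA; have c1 : cyl_fun (fun w => expR `|psum A w|).
  exact: (cyl_comp (fun x : X => expR `|x|) (psum_cyl A)).
rewrite -lee_fin /Rintegral fineK; last by apply: integrable_fin_num => //; exact: cyl_integrable.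
apply: (@le_trans _ _ (\int[P]_w envelope w)%E).
  apply: ge0_le_integral => //.
  - by apply/measurable_EFinP; exact: cyl_measurable.
  - by case/integrableP : integrable_envelope.
  - by move=> w _; exact: expR_norm_psum_envelope.
rewrite /envelope integralZl//; last first.
  apply: integrableD => //; last exact: integrable_bad_series.
  by apply: (@bounded_integrable _ P (fun=> 1) 1) => // w; rewrite normr1.
rewrite EFinM; apply: lee_wpmul2l; first by rewrite lee_fin expR_ge0.
rewrite ge0_integralD//; last 2 first.
  - by move=> w _; exact: bad_series_ge0.
  - exact: measurable_bad_series.
rewrite integral_cst// [X in (_ * X)%E]probability_setT mule1.
by rewrite (natrD _ 1 1) EFinD; apply: leeD2l => //; exact: integral_bad_series.
Qed.

End random_series_theory.

Section random_vector.
Context (R : realType) (X : completeNormedModType R) (D : random_series X).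

Notation p := (rs_p D).
Notation P := (rs_P D).
Notation y := (rs_y D).
Notation tau := (rs_tau D).
Notation tau' := (rs_tau' D).
Notation kk := (rs_kk D).
Notation T := (rs_T D).
Local Notation psum := (psum D).

(** Smallness is required over all finite sets of late indices and not only over intervals, because
    the shift permutes the terms of the series. *)
Definition tail_small N (e : R) (w : bits) :=
  forall s, uniq s -> (forall i, i \in s -> (N <= i)%N) -> `|psum s w| <= e.

Definition summable_at (w : bits) := forall e : R, 0 < e -> exists N, tail_small N e w.

Lemma measurable_tail_small N e : measurable [set w | tail_small N e w].
Proof.
(* Finite sequences are countable through [pickle], so the condition is a countable intersection of
   events in finitely many bits. *)
pose F n := [set w | if unpickle n is Some s then
    if uniq s && all (fun i => N <= i)%N s then `|psum s w| <= e else true else true].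
rewrite (_ : [set w | _] = \bigcap_n F n).
  apply: bigcapT_measurable => n; rewrite /F; case: (unpickle n : option (seq nat)) => [s|]; last first.
    by rewrite (_ : [set _ | _] = setT)//; apply/seteqP; split.
  case: (uniq s && _); last by rewrite (_ : [set _ | _] = setT)//; apply/seteqP; split.
  have [m hm] := psum_cyl D s.
  by apply: (@measurable_dep m) => w w' /hm /= ->.
apply/seteqP; split => w h.
  move=> n _; rewrite /F /mkset; case: (unpickle n : option (seq nat)) => // s.
  by case: ifP => // /andP[us /allP sN]; exact: h.
move=> s us sN; have := h (pickle s) Logic.I; rewrite /F /mkset pickleK us.
by have -> : all (fun i => N <= i)%N s by exact/allP.
Qed.

Lemma tail_small_le N N' e w : (N <= N')%N -> tail_small N e w -> tail_small N' e w.
Proof. by move=> NN h s us sN; apply: h => // i /sN; exact: leq_trans. Qed.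

Lemma summable_atP w : summable_at w <-> forall m : nat, exists N, tail_small N m.+1%:R^-1 w.
Proof.
split=> [h m|h e e0]; first exact: h.
have [N hN] := h (Num.truncn e^-1); exists N => s us sN.
apply: le_trans (hN s us sN) _; rewrite -[leRHS]invrK lef_pV2 ?posrE ?invr_gt0//.
by rewrite ltW// truncnS_gt.
Qed.

Lemma measurable_summable_at : measurable [set w | summable_at w].
Proof.
rewrite (_ : [set w | _] = \bigcap_m \bigcup_N [set w | tail_small N m.+1%:R^-1 w]).
  by apply: bigcapT_measurable => m; apply: bigcupT_measurable => N; exact: measurable_tail_small.
apply/seteqP; split => w.
  by move=> /summable_atP h m _; have [N hN] := h m; exists N.
by move=> h; apply/summable_atP => m; have [N _ hN] := h m Logic.I; exists N.
Qed.

Lemma summable_at_avoid w : (forall e : R, 0 < e -> exists J : seq nat, forall s, uniq s ->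
    (forall i, i \in s -> i \notin J) -> `|psum s w| <= e) -> summable_at w.
Proof.
move=> h e e0; have [J hJ] := h e e0; exists (\max_(i <- J) i).+1 => s us sN.
apply: hJ => // i /sN; apply: contraTN => iJ; rewrite -leqNgt.
exact: (@leq_bigmax_seq nat J xpredT (fun i => i) i iJ isT).
Qed.

(** A bad slice contributes at least 1 to the series, so only finitely many slices are bad. The good
    slices from [K0] on add up to a geometric tail, and the first [K0] are handled by
    [rs_slice_cauchy]. *)
Lemma bad_series_summable w : (bad_series D w < +oo)%E -> summable_at w.
Proof.
move=> fin; apply: summable_at_avoid => e e0.
have t0 k : true -> (0 <= ((bad D k w)%:R * expR (Mtot D k))%:E)%E.
  by move=> _; rewrite lee_fin mulr_ge0// expR_ge0.
have := nneseries_tail_cvg fin t0.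
have [K1 hK1] : exists K1, forall k, (K1 <= k)%N -> bad D k w = false.
  have /fine_cvgP[/= [K2 _ fK2] /cvgr0Pnorm_lt/(_ 1 ltr01)[K3 _ hK3]] := nneseries_tail_cvg fin t0.
  exists (maxn K2 K3) => k; rewrite geq_max => /andP[K2k K3k]; apply/negP => bk.
  have := hK3 _ K3k; rewrite /= ger0_norm; last by rewrite fine_ge0// nneseries_ge0// => *; exact: t0.
  rewrite -lte_fin fineK; last exact: fK2.
  apply/negP; rewrite -leNgt; apply: (@le_trans _ _ (\sum_(k <= i < k.+1) ((bad D i w)%:R * expR (Mtot D i))%:E)%E).
    rewrite big_nat1 bk mul1r lee_fin -expR0 ler_expR; exact: Mtot_ge0.
  by apply: nneseries_lim_ge => i _ _; exact: t0.
move=> _.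
have [K2 hK2] : exists K2, 2^-1 ^+ K2 <= e / 2.
  have : (2^-1 : R) ^+ n @[n --> \oo] --> 0 by apply: cvg_expr; rewrite ger0_norm// invf_lt1// ltr1n.
  move=> /cvgr0Pnorm_le/(_ (e / 2)) []; first by rewrite divr_gt0.
  by move=> N _ /(_ N (leqnn N)) /= h; exists N; rewrite -[leLHS]ger0_norm// half_pow_ge0.
pose K0 := maxn K1 K2; pose e' := e / 2 / K0.+1%:R.
have e'0 : 0 < e' by rewrite !divr_gt0.
have /choice[J hJ] := fun k => @rs_slice_cauchy _ _ D k e' e'0.
exists (flatten [seq J k | k <- iota 0 K0]) => s us sJ.
have [L hL] := kk_bounded D s; pose K := maxn L K0.
have hK i : i \in s -> (kk i < K)%N by move=> /hL h; rewrite leq_max h.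
rewrite (psum_slices w hK) (le_trans (ler_norm_sum _ _ _))//.
apply: (@le_trans _ _ (\sum_(k < K) (if (k < K0)%N then e' else 2^-1 ^+ k.+1))).
  apply: ler_sum => k _; case: ltnP => kK0.
    apply: (hJ (k : nat)); first by rewrite filter_uniq.
    move=> i; rewrite mem_filter => /andP[/andP[_ /eqP ki] /sJ iJ]; split=> //.
    apply: contra iJ => iJk; apply/flattenP; exists (J k) => //.
    by apply: map_f; rewrite mem_iota.
  have := norm_slice D w k us; rewrite hK1 ?mul0r ?addr0//.
  by rewrite (leq_trans _ kK0)// leq_maxl.
have e2 : \sum_(0 <= k < K0) e' <= e / 2.
  rewrite sumr_const_nat subn0 -[e' *+ K0]mulr_natr /e' mulrAC ler_pdivrMr//.
  by rewrite ler_wpM2l ?divr_ge0 ?(ltW e0)// ler_nat.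
rewrite -(big_mkord xpredT (fun k => if (k < K0)%N then e' else 2^-1 ^+ k.+1)).
rewrite (big_cat_nat (n := K0))//=; last exact: leq_maxr.
rewrite [leRHS]splitr; apply: lerD.
  by rewrite (le_trans _ e2)//; apply: ler_sum_nat => k /andP[_ ->].
apply: le_trans hK2; rewrite (@eq_big_nat _ _ _ _ _ _ (fun k => 2^-1 ^+ k.+1)); last first.
  by move=> k /andP[K0k _]; rewrite ltnNge K0k.
have -> : \sum_(K0 <= k < K) 2^-1 ^+ k.+1 = 2^-1 ^+ K0 - 2^-1 ^+ K :> R.
  have := sum_half_pow R K; rewrite -(big_mkord xpredT (fun k => 2^-1 ^+ k.+1 : R)).
  rewrite (big_cat_nat (n := K0))//=; last exact: leq_maxr.
  by rewrite big_mkord sum_half_pow; lra.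
rewrite (@le_trans _ _ (2^-1 ^+ K0))// ?gerBl ?half_pow_ge0//.
by rewrite ler_wiXn2l ?leq_maxr// invf_le1// ler1n.
Qed.

Lemma prob_summable_at : P [set w | summable_at w] = 1%E.
Proof.
have : P (~` [set w | summable_at w]) = 0%E.
  apply: measure_negligible; first by apply: measurableC; exact: measurable_summable_at.
  have [A [mA A0 hA]] := integrable_ae measurableT (integrable_bad_series D).
  exists A; split=> // w nw; apply: hA => /= h; apply: nw; apply: bad_series_summable.
  by have := h Logic.I; rewrite fin_numE ltey => /andP[].
rewrite probability_setC; last exact: measurable_summable_at.
move=> /eqP; rewrite sube_eq ?fin_num_measure ?add0e//; by move=> /eqP.
Qed.

Notation theta := (shift tau').
Notation theta' := (shift tau).

Lemma psum_shift A w : psum A (theta w) = T (psum (map tau' A) w).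
Proof.
rewrite /psum /shift big_map raddf_sum/=; apply: eq_bigr => i _.
by rewrite rs_Ty rs_tau'K.
Qed.

Lemma T_small e : 0 < e -> exists2 d, 0 < d & forall x : X, `|x| <= d -> `|T x| <= e.
Proof.
move=> e0; have : T x @[x --> (0 : X)] --> T 0 by exact: (@rs_T_cont _ _ D).
rewrite raddf0 => /cvgr0Pnorm_le/(_ e e0).
move=> /nbhs_norm0P[d /= d0 h]; exists (d / 2); first by rewrite divr_gt0.
move=> x xd; apply: h => /=; rewrite (le_lt_trans xd)// ltr_pdivrMr//; lra.
Qed.

Lemma summable_at_shift w : summable_at w -> summable_at (theta w).
Proof.
move=> h; apply: summable_at_avoid => e e0.
have [d d0 hd] := T_small e0; have [N hN] := h d d0.
exists (map tau (iota 0 N)) => s us sJ; rewrite psum_shift; apply: hd; apply: hN.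
  by rewrite map_inj_uniq//; exact: can_inj (@rs_tau'K _ _ D).
move=> i /mapP[j js ->]; rewrite leqNgt; apply/negP => jN.
have /negP := sJ j js; apply; apply/mapP; exists (tau' j); last by rewrite rs_tau'K.
by rewrite mem_iota.
Qed.

(* Summability passes from [w] to [theta w] but not back; requiring it along
   the whole backward orbit gives an exactly shift-invariant set. *)
Definition good_at (w : bits) := forall n, summable_at (iter n theta' w).

Lemma thetaK : cancel theta theta'.
Proof. by move=> w; apply/funext => i; rewrite /shift rs_tauK. Qed.

Lemma good_at_shift w : good_at (theta w) <-> good_at w.
Proof.
split=> h n; first by have := h n.+1; rewrite iterSr thetaK.
case: n => [|n]; first exact: (summable_at_shift (h 0%N)).
by rewrite iterSr thetaK; exact: h.
Qed.

Lemma measurable_good_at : measurable [set w | good_at w].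
Proof.
rewrite (_ : [set w | _] = \bigcap_n (iter n theta' @^-1` [set w | summable_at w])).
  apply: bigcapT_measurable => n; rewrite -[X in measurable X]setTI.
  by apply: measurable_iter_shift => //; exact: measurable_summable_at.
by apply/seteqP; split => w h n //=; exact: (h n Logic.I).
Qed.

Lemma rs_p_tau'E i : p (tau' i) = p i.
Proof. by rewrite -(@rs_p_tau _ _ D (tau' i)) rs_tau'K. Qed.

Lemma good_at_ae : P.-negligible (~` [set w | good_at w]).
Proof.
rewrite (_ : ~` _ = \bigcup_n (~` (iter n theta' @^-1` [set w | summable_at w]))).
  apply: negligible_bigcup => n; rewrite preimage_setC.
  have mS := measurableC measurable_summable_at.
  apply/negligibleP.
    rewrite -[X in measurable X]setTI.
    by apply: measurable_iter_shift.
  have : P (iter n theta' @^-1` (~` [set w | summable_at w])) = 0%E; last by [].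
  rewrite (iter_shift_inv (rs_p01 D) (@rs_PE _ _ D) (@rs_tauK _ _ D) rs_p_tau'E)//.
  rewrite probability_setC; last exact: measurable_summable_at.
  by rewrite prob_summable_at subee.
apply/seteqP; split => w; last by move=> [n _ h] g; apply: h; exact: g.
by move=> h; apply: contrapT => h'; apply: h => n; apply: contrapT => h''; apply: h'; exists n.
Qed.

(** The value 0 off the good set keeps [rvec_shift] true everywhere, since [T] fixes 0. *)
Definition rvec (w : bits) : X :=
  if `[< good_at w >] then limn (fun n => psum (iota 0 n) w) else 0.

Lemma psum_iota_cvg w : summable_at w -> cvgn (fun n => psum (iota 0 n) w).
Proof.
move=> h.
have e n : psum (iota 0 n) w = series (fun i => if w i then y i else 0) n.
  by rewrite /psum /series/= big_mkcond/= -{1}[n]subn0.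
rewrite (funext e); apply: cauchy_cvg; apply/cauchy_seriesP => e1 e0.
have [|N hN] := h (e1 / 2); first by rewrite divr_gt0.
exists ([set n | (N <= n)%N], [set n | (N <= n)%N]); first by split; exists N.
move=> [n m] /= [Nn Nm]; rewrite -big_mkcond/=.
rewrite (@le_lt_trans _ _ (e1 / 2))//; last by rewrite ltr_pdivrMr//; lra.
apply: (hN (index_iota n m)); first exact: iota_uniq.
by move=> i; rewrite mem_index_iota => /andP[+ _]; exact: leq_trans.
Qed.

Lemma rvec_cvg w : good_at w -> psum (iota 0 n) w @[n --> \oo] --> rvec w.
Proof.
by move=> g; rewrite /rvec; case: asboolP => // _; exact: psum_iota_cvg (g 0%N).
Qed.

Lemma rvec_near w N e : good_at w -> tail_small N e w -> `|rvec w - psum (iota 0 N) w| <= e.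
Proof.
move=> g hN.
have h : `|psum (iota 0 n) w - psum (iota 0 N) w| @[n --> \oo] --> `|rvec w - psum (iota 0 N) w|.
  by apply: cvg_norm; apply: cvgB; [exact: rvec_cvg|exact: cvg_cst].
apply: (cvgr_to_le h); exists N => // n /= Nn.
rewrite -(subnKC Nn) iotaD /psum big_cat/= addrAC subrr add0r add0n; apply: hN; first exact: iota_uniq.
by move=> i; rewrite mem_iota => /andP[].
Qed.

(** Unconditional summability makes the limit independent of the order of summation; [rvec_shift]
    applies this to shifted index lists. *)
Lemma psum_cvg w (A : nat -> seq nat) : good_at w -> (forall n, uniq (A n)) ->
  (forall i, \forall n \near \oo, i \in A n) -> psum (A n) w @[n --> \oo] --> rvec w.
Proof.
move=> g uA hA; apply/cvgrPdist_le => e e0.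
have [|N hN] := g 0%N (e / 2); first by rewrite divr_gt0.
have : \forall n \near \oo, {subset iota 0 N <= A n}.
  elim: N {hN} => [|N ih]; first by exists 0%N.
  near=> n; move=> i; rewrite -addn1 iotaD mem_cat inE add0n => /orP[|/eqP ->].
    by move: i; near: n; exact: ih.
  by near: n; exact: hA.
apply: filterS => n sub.
have -> : psum (A n) w = psum (iota 0 N) w + psum [seq i <- A n | (N <= i)%N] w.
  rewrite /psum (bigID (fun i => i < N)%N)/=; congr (_ + _).
    rewrite -big_filter -[RHS]big_filter; apply: perm_big; apply: uniq_perm; rewrite ?filter_uniq ?iota_uniq//.
    move=> i; rewrite !mem_filter mem_iota add0n/=; case: (w i) => //=; case: ltnP => //= iN.
    by rewrite sub// mem_iota.
  by rewrite [RHS]big_filter_cond; apply: eq_bigl => i; rewrite -leqNgt andbC.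
rewrite opprD addrA (le_trans (ler_normB _ _))// [leRHS]splitr lerD//; first exact: rvec_near.
apply: hN; first by rewrite filter_uniq.
by move=> i; rewrite mem_filter => /andP[].
Unshelve. all: by end_near. Qed.

Lemma rvec_shift w : rvec (theta w) = T (rvec w).
Proof.
have [g|ng] := pselect (good_at w); last first.
  rewrite /rvec; case: asboolP => [/good_at_shift//|_].
  by case: asboolP => // _; rewrite raddf0.
have h1 : psum (iota 0 n) (theta w) @[n --> \oo] --> rvec (theta w).
  by apply: rvec_cvg; exact/good_at_shift.
have h2 : T (psum (map tau' (iota 0 n)) w) @[n --> \oo] --> T (rvec w).
  apply: (cvg_comp _ T); last exact: (@rs_T_cont _ _ D).
  apply: psum_cvg => // [n|i].
    by rewrite map_inj_uniq ?iota_uniq//; exact: can_inj (@rs_tau'K _ _ D).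
  exists (tau i).+1 => // n /= h; apply/mapP; exists (tau i); last by rewrite rs_tauK.
  by rewrite mem_iota.
rewrite (_ : (fun n => T _) = fun n => psum (iota 0 n) (theta w)) in h2.
  exact: (cvg_unique _ h1 h2).
by apply/funext => n; rewrite psum_shift.
Qed.

Lemma rvec_iter_shift n w : rvec (iter n theta w) = iter n T (rvec w).
Proof. by elim: n => //= n <-; rewrite rvec_shift. Qed.

Lemma measurable_rvec : measurable_fun setT (rvec : bits -> borel X).
Proof.
have mE : @measurable _ (borel X) = <<s @open X >> by [].
apply: (measurability _ mE) => _ [U oU <-]; rewrite setTI.
pose V n w := if `[< good_at w >] then psum (iota 0 n) w else 0.
have hV w : V n w @[n --> \oo] --> rvec w.
  rewrite /V; case: (asboolP (good_at w)) => g; first exact: rvec_cvg.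
  by rewrite /rvec asboolF//; exact: cvg_cst.
(* Every preimage under [V n] is measurable: on the good set [V n] depends on finitely many bits,
   elsewhere it is constant. So [Um m] below may be an arbitrary set. *)
have mV n (A : set X) : measurable (V n @^-1` A).
  have -> : V n @^-1` A = ([set w | good_at w] `&` psum (iota 0 n) @^-1` A) `|`
      (~` [set w | good_at w] `&` (fun=> 0) @^-1` A).
    apply/seteqP; split => w; rewrite /V /preimage/=.
      by case: asboolP => g Aw; [left|right].
    by case=> -[g Aw]; case: asboolP.
  have [m hm] := psum_cyl D (iota 0 n).
  apply: measurableU; apply: measurableI; rewrite ?measurable_good_at//.
  - exact: measurable_good_at.
  - exact: measurable_preimage_dep hm.
  - by apply: measurableC; exact: measurable_good_at.
  - by apply: (@measurable_preimage_dep 0).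
pose Um m := [set x : X | ball x (m.+1%:R^-1 : R) `<=` U].
(* The limit lies in the open set [U] exactly when, for some m, the balls of radius 1 / (m + 1)
   around all late approximations stay inside [U]. *)
rewrite (_ : _ @^-1` U = \bigcup_m \bigcup_N \bigcap_n (V (n + N)%N @^-1` Um m)).
  apply: bigcupT_measurable => m; apply: bigcupT_measurable => N.
  by apply: bigcapT_measurable => n; exact: mV.
apply/seteqP; split => w.
  move=> Uw; have /nbhs_ballP[e /= e0 eU] : nbhs (rvec w) U by exact: open_nbhs_nbhs.
  have e2 : 0 < e / 2 by rewrite divr_gt0.
  have /cvg_ballP/(_ _ e2)[N _ hN] := hV w.
  exists (Num.truncn (e / 2)^-1) => //; exists N => // n _ x xb; apply: eU.
  have := hN (n + N)%N (leq_addl _ _) => /= h.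
  rewrite [e]splitr; apply: ball_triangle h _; apply: le_ball xb.
  rewrite -[leRHS]invrK lef_pV2 ?posrE ?invr_gt0//.
  by rewrite ltW// truncnS_gt.
move=> [m _ [N _ h]].
have m0 : 0 < (m.+1%:R^-1 : R) by rewrite invr_gt0.
have /cvg_ballP/(_ _ m0)[N' _ hN] := hV w.
apply: (h N' Logic.I); apply: ball_sym; apply: hN => /=; exact: leq_addr.
Qed.

(* Prescribing the first [N] bits has positive probability and does not affect
   the smallness of the tail. *)
Lemma rvec_support (i : nat) (e : R) : 0 < e -> (0 < P [set w | (`|rvec w - y i| < e)%R])%E.
Proof.
move=> e0.
pose E N := [set w | tail_small N (e / 2) w].
have [N iN EN0] : exists2 N, (i < N)%N & (0 < P (E N))%E.
  apply: contrapT => h.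
  have : P.-negligible (\bigcup_N E (N + i.+1)%N).
    apply: negligible_bigcup => N; apply/negligibleP; first exact: measurable_tail_small.
    apply/eqP; rewrite eq_le measure_ge0 andbT leNgt; apply/negP => h'; apply: h.
    by exists (N + i.+1)%N => //; rewrite leq_addl.
  have sub : [set w | summable_at w] `<=` \bigcup_N E (N + i.+1)%N.
    move=> w /(_ (e / 2)) []; first by rewrite divr_gt0.
    by move=> N hN; exists N => //; apply: tail_small_le hN; rewrite leq_addr.
  move=> neg; have : P [set w | summable_at w] = 0%E.
    by apply: (measure_negligible measurable_summable_at); exact: negligibleS neg.
  by rewrite prob_summable_at => -[] /eqP; rewrite oner_eq0.
(* The prescribed word has its only one at [i], so the first [N] terms sum to [y i]. *)
pose t j := j == i.
have key k : (k <= N)%N -> (0 < P (E N `&` cylinder k t))%E.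
  elim: k => [|k ih] kN.
    by rewrite (_ : cylinder 0 t = setT) ?setIT//; apply/seteqP; split.
  rewrite (resampleE (rs_p01 D) (@rs_PE _ _ D) k); last first.
    by apply: measurableI; [exact: measurable_tail_small|exact: measurable_cylinder].
  have pre : (fun w => upd w k (t k)) @^-1` (E N `&` cylinder k.+1 t) = E N `&` cylinder k t.
    have pE w s b : (forall j, j \in s -> (N <= j)%N) -> psum s (upd w k b) = psum s w.
      move=> sN; rewrite /psum big_seq_cond [RHS]big_seq_cond; apply: eq_bigl => j.
      case js : (j \in s) => //=; rewrite /upd; case: eqP => // jk.
      by have := sN j js; rewrite jk leqNgt kN.
    apply/seteqP; split => w [h1 h2]; split.
    - by move=> s us sN; rewrite -(pE w s (t k))//; exact: h1.
    - move=> j jk; have := h2 j (leqW jk); rewrite /upd; case: eqP => // ejk.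
      by rewrite ejk ltnn in jk.
    - by move=> s us sN; rewrite pE//; exact: h1.
    - move=> j; rewrite ltnS leq_eqVlt /upd; case: eqP => [-> //|_ /= jk]; exact: h2.
  have p0 : (0 < (p k)%:E)%E by rewrite lte_fin; have /andP[] := rs_p01 D k.
  have q0 : (0 < (1 - p k)%:E)%E by rewrite lte_fin subr_gt0; have /andP[] := rs_p01 D k.
  have mg b : (0 <= P ((fun w => upd w k b) @^-1` (E N `&` cylinder k.+1 t)))%E by exact: measure_ge0.
  case tk : (t k) pre => pre; rewrite pre.
    apply: (lt_le_trans (mule_gt0 p0 (ih (ltnW kN)))).
    by apply: leeDl; exact: mule_ge0 (ltW q0) (mg _).
  apply: (lt_le_trans (mule_gt0 q0 (ih (ltnW kN)))).
  by apply: leeDr; exact: mule_ge0 (ltW p0) (mg _).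
have mA : measurable (E N `&` cylinder N t).
  by apply: measurableI; [exact: measurable_tail_small|exact: measurable_cylinder].
have -> : [set w | `|rvec w - y i| < e] = rvec @^-1` (ball (y i) e).
  by apply/seteqP; split => w; rewrite /preimage/= -ball_normE/= distrC.
have mB : measurable (rvec @^-1` (ball (y i) e)).
  rewrite -[X in measurable X]setTI; apply: measurable_rvec => //.
  by apply: sub_sigma_algebra; exact: ball_open.
rewrite (lt_le_trans (key N (leqnn N)))//.
(* [rvec] is the limit of the partial sums on the good set, whose complement is negligible. *)
have -> : P (E N `&` cylinder N t) = P ((E N `&` cylinder N t) `&` [set w | good_at w]).
  apply/eqP; rewrite eq_le; apply/andP; split; last first.
    apply: le_measure; rewrite ?inE//; apply: measurableI => //; exact: measurable_good_at.
  rewrite -[X in (P X <= _)%E]setIT -(setUv [set w | good_at w]) setIUr.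
  apply: le_trans (measureU2 _ _ _) _.
  - by apply: measurableI => //; exact: measurable_good_at.
  - by apply: measurableI => //; apply: measurableC; exact: measurable_good_at.
  rewrite [X in (_ + X)%E](_ : _ = 0%E) ?adde0//.
  apply: measure_negligible; first by apply: measurableI => //; apply: measurableC; exact: measurable_good_at.
  by apply: negligibleS good_at_ae; exact: subIsetr.
apply: le_measure; rewrite ?inE//.
  by apply: measurableI => //; exact: measurable_good_at.
move=> w [[EN cN] g]; rewrite /preimage/= -ball_normE/= distrC.
have := rvec_near g EN.
have -> : psum (iota 0 N) w = y i.
  rewrite /psum -big_filter (_ : [seq _ <- _ | _] = [:: i]) ?big_seq1//.
  apply: perm_small_eq => //; apply: uniq_perm; rewrite ?filter_uniq ?iota_uniq//.
  move=> j; rewrite mem_filter mem_iota add0n inE /=; case: ltnP => jN; first by rewrite cN// andbT.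
  by rewrite andbF; apply/esym/negbTE; apply: contraTN jN => /eqP ->; rewrite -ltnNge.
by move=> h; rewrite (le_lt_trans h)// ltr_pdivrMr//; lra.
Qed.

End random_vector.

(** * Influences of polynomials *)

Section exponential_lipschitz.
Variables (R : realType) (X : normedModType R).

(** The 1/8 leaves room: it gives growth at most exp(|x| / 4), so that squares, products of two such
    functions and squared differences stay below exponentials of the norm, which are known to be
    integrable. *)
Definition lip_exp (f : X -> R) (C : R) :=
  0 <= C /\ forall x y, `|f x - f y| <= C * `|x - y| * expR ((`|x| + `|y|) / 8).

(** Raise t / (8 (n + 1)) <= exp(t / (8 (n + 1))) to the power [n]; [n.+1] keeps the denominator
    positive at [n = 0]. *)
Lemma pow_le_expR n : exists2 K : R, 0 <= K & forall t : R, 0 <= t -> t ^+ n <= K * expR (t / 8).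
Proof.
exists ((8 * n.+1%:R) ^+ n); first by rewrite exprn_ge0// mulr_ge0.
move=> t t0; have c0 : 0 < 8 * n.+1%:R :> R by rewrite mulr_gt0.
rewrite -{1}(divfK (lt0r_neq0 c0) t) mulrC exprMn ler_wpM2l ?exprn_ge0 ?(ltW c0)//.
apply: (@le_trans _ _ (expR (t / (8 * n.+1%:R)) ^+ n)).
  rewrite lerXn2r ?nnegrE ?expR_ge0 ?divr_ge0 ?(ltW c0)//.
  by have := expR_ge1Dx (t / (8 * n.+1%:R)); apply: le_trans; rewrite lerDr.
rewrite -expRM_natl ler_expR.
have -> : n%:R * (t / (8 * n.+1%:R)) = t / 8 * (n%:R / n.+1%:R) by rewrite invfM; ring.
by rewrite ler_piMr ?divr_ge0// ler_pdivrMr// mul1r ler_nat.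
Qed.

Lemma lip_exp_add f g C C' : lip_exp f C -> lip_exp g C' -> lip_exp (fun x => f x + g x) (C + C').
Proof.
move=> [C0 h] [C'0 h']; split; first exact: addr_ge0.
move=> x y; rewrite opprD addrACA (le_trans (ler_normD _ _))//.
by rewrite mulrDl mulrDl lerD.
Qed.

Lemma lip_exp_cst c : lip_exp (fun=> c) 0.
Proof. by split=> // x y; rewrite subrr normr0 !mul0r. Qed.

Lemma homogeneous_lip_exp d f : homogeneous_poly d f -> exists C, lip_exp f C.
Proof.
move=> [Q [linQ _ [C bQ] ->]].
have [K K0 hK] := pow_le_expR d.-1.
exists (d%:R * (`|C| * K)); split; first by rewrite !mulr_ge0.
(* [v m] has [x] in its first [m] slots and [y] in the others; passing from [v d] to [v 0] changes
   one slot at a time. *)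
move=> x y; pose v m : 'I_d -> X := fun j => if (j < m)%N then x else y.
have step (m : 'I_d) : `|Q (v m.+1) - Q (v m)| <= `|C| * (`|x - y| * (`|x| + `|y|) ^+ d.-1).
  have eQ z : Q (fun j => if j == m then z else v m j) =
      Q (fun j => if j == m then z - y else v m j) + Q (v m).
    have := linQ m (v m) 1 (z - y) y; rewrite scale1r subrK mul1r => ->.
    congr (_ + Q _); apply/funext => j; rewrite /v; case: eqP => // ->.
    by rewrite ltnn.
  have -> : v m.+1 = fun j => if j == m then x else v m j.
    by apply/funext => j; rewrite /v ltnS leq_eqVlt -val_eqE; case: eqP.
  rewrite eQ addrK (le_trans (bQ _))//.
  apply: (@le_trans _ _ (`|C| * \prod_(i < d) `|if i == m then x - y else v m i|)).
    by rewrite ler_wpM2r ?ler_norm// prodr_ge0.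
  rewrite ler_wpM2l// (bigD1 m)//= eqxx ler_wpM2l//.
  rewrite (@le_trans _ _ (\prod_(i < d | i != m) (`|x| + `|y|)))//.
    apply: ler_prod => i /negbTE -> /=; rewrite normr_ge0/= /v.
    by case: ifP => _; rewrite ?lerDl ?lerDr.
  by rewrite prodr_const cardC1 card_ord.
have tel m : (m <= d)%N -> `|Q (v m) - Q (fun=> y)| <= m%:R * (`|C| * (`|x - y| * (`|x| + `|y|) ^+ d.-1)).
  elim: m => [_|m ih md]; first by rewrite mul0r subrr normr0.
  rewrite -(subrK (Q (v m)) (Q (v m.+1))) -addrA (le_trans (ler_normD _ _))//.
  by rewrite -natr1 mulrDl mul1r [leRHS]addrC lerD ?ih ?(ltnW md)//; exact: (step (Ordinal md)).
have := tel d (leqnn d); rewrite (_ : v d = fun=> x); last by apply/funext => j; rewrite /v ltn_ord.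
move=> /le_trans; apply; rewrite -!mulrA ler_wpM2l// ler_wpM2l//.
rewrite mulrCA ler_wpM2l//; exact/hK/addr_ge0.
Qed.

Lemma poly_lip_exp f : is_poly f -> exists C, lip_exp f C.
Proof.
move=> [N [Ps [hP ->]]]; elim: N hP => [|N ih] hP.
  exists 0; rewrite (_ : (fun x => _) = fun=> 0); first exact: lip_exp_cst.
  by apply/funext => x; rewrite big_ord0.
have [C hC] := ih (fun k kN => hP k (leqW kN)).
have [d /homogeneous_lip_exp[C' hC']] := hP N (ltnSn N).
exists (C + C'); rewrite (_ : (fun x => _) = fun x => \sum_(k < N) Ps k x + Ps N x).
  exact: lip_exp_add.
by apply/funext => x; rewrite big_ord_recr.
Qed.

Lemma lip_exp_continuous f C : lip_exp f C -> continuous f.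
Proof.
move=> [C0 h] x; apply/cvgrPdist_le => e e0.
pose K := C * expR ((`|x| + (`|x| + 1)) / 8) + 1.
have K0 : 0 < K by rewrite ltr_wpDl// mulr_ge0// expR_ge0.
near=> y; rewrite (le_trans (h x y))//.
have xy1 : `|x - y| <= 1 by near: y; exact: cvgr_dist_le.
have xye : `|x - y| <= e / K by near: y; apply: cvgr_dist_le => //; rewrite divr_gt0.
have yx : `|y| <= `|x| + 1.
  by rewrite -(subKr x y) (le_trans (ler_normB _ _))// lerD2l.
apply: (@le_trans _ _ (K * (e / K))); last by rewrite mulrC divfK// gt_eqF.
apply: (@le_trans _ _ (K * `|x - y|)); last by rewrite ler_wpM2l// ltW.
rewrite mulrAC ler_wpM2r// /K (@le_trans _ _ (C * expR ((`|x| + (`|x| + 1)) / 8)))//.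
  by rewrite ler_wpM2l// ler_expR ler_wpM2r// lerD2l.
by rewrite lerDl.
Unshelve. all: by end_near. Qed.

Lemma lip_exp_growth f C : lip_exp f C ->
  exists2 K, 0 <= K & forall x, `|f x| <= K * expR (`|x| / 4).
Proof.
move=> [C0 h]; exists (`|f 0| + C * 8); first by rewrite addr_ge0// mulr_ge0.
move=> x; have := h x 0; rewrite subr0 normr0 addr0 => hx.
have -> : f x = f 0 + (f x - f 0) by rewrite addrC subrK.
rewrite (le_trans (ler_normD _ _))// mulrDl lerD//.
  by rewrite ler_peMr// -expR0 ler_expR divr_ge0.
rewrite (le_trans hx)// -!mulrA ler_wpM2l//.
have -> : expR (`|x| / 4) = expR (`|x| / 8) * expR (`|x| / 8) by rewrite -expRD; congr expR; lra.
rewrite mulrA ler_wpM2r ?expR_ge0//.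
by have := expR_ge1Dx (`|x| / 8); lra.
Qed.

End exponential_lipschitz.

Section influences.
Context (R : realType) (X : completeNormedModType R) (D : random_series X).

Notation p := (rs_p D).
Notation P := (rs_P D).
Notation y := (rs_y D).
Notation tau := (rs_tau D).
Notation tau' := (rs_tau' D).
Notation theta := (shift tau').
Local Notation psum := (psum D).
Local Notation Ex F := (Rintegral P setT F).
Local Notation infl := (bit_infl p P).

(** Bound for the influence of bit [i] on a [lip_exp] function of a partial sum, up to the constant
    of that function. The first factor is the square root of the exponential moment bound
    [Ex_expR_norm_psum]. *)
Definition wgt i := Num.sqrt (expR 1 * 2) * (Num.sqrt (p i) * `|y i| * expR (`|y i| / 8)).

Lemma wgt_ge0 i : 0 <= wgt i.
Proof. by rewrite !mulr_ge0 ?sqrtr_ge0 ?expR_ge0. Qed.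

(** Switching bit [i] moves the sum by at most [y i], while the remaining sum has a bounded
    exponential moment. The bound does not depend on [A], so it survives the passage to the whole
    series. *)
Lemma infl_psum (f : X -> R) C A i : lip_exp f C -> uniq A ->
  infl i (fun w => f (psum A w)) <= C * wgt i.
Proof.
move=> [C0 h] uA; pose A' := rem i A.
have uA' : uniq A' by exact: rem_uniq.
have cA' := psum_cyl D A'.
have pu b w : psum A' (upd w i b) = psum A' w.
  rewrite /psum big_seq_cond [RHS]big_seq_cond; apply: eq_bigl => j.
  rewrite mem_rem_uniq// inE; case: (eqVneq j i) => //= ji.
  by rewrite /upd (negbTE ji).
pose G w := C * (`|y i| * expR (`|y i| / 8)) * expR (`|psum A' w| / 4).
have diff w : `|bit_diff i (fun w => f (psum A w)) w| <= G w.
  have G0 : 0 <= G w by rewrite !mulr_ge0 ?expR_ge0.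
  rewrite /bit_diff; case: (boolP (i \in A)) => iA; last first.
    rewrite (_ : psum A (upd w i true) = psum A (upd w i false)) ?subrr ?normr0//.
    rewrite /psum big_seq_cond [RHS]big_seq_cond; apply: eq_bigl => j.
    case: (eqVneq j i) => [->|ji]; first by rewrite (negbTE iA).
    by rewrite /upd (negbTE ji).
  have pA b : psum A (upd w i b) = (if b then y i else 0) + psum A' w.
    rewrite -(pu b w) /psum big_mkcond (perm_big _ (perm_to_rem iA))/= big_cons -big_mkcond/=.
    by rewrite /upd eqxx.
  rewrite !pA add0r (le_trans (h _ _))// addrK /G -!mulrA ler_wpM2l// ler_wpM2l//.
  rewrite -expRD ler_expR.
  by have := ler_normD (y i) (psum A' w); lra.
have cF : cyl_fun (fun w => f (psum A w)) by exact: (cyl_comp f (psum_cyl D A)).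
have cG : cyl_fun G by exact: (cyl_comp (fun x => C * _ * expR (`|x| / 4)) cA').
have cd := cyl_bit_diff i cF.
pose K := C * (`|y i| * expR (`|y i| / 8)).
have K0 : 0 <= K by rewrite !mulr_ge0// expR_ge0.
have EG : Ex (fun w => bit_diff i (fun w => f (psum A w)) w ^+ 2) <= K ^+ 2 * (expR 1 * 2).
  apply: (@le_trans _ _ (Ex (fun w => K ^+ 2 * expR `|psum A' w|))).
    apply: le_Ex.
    - exact: (cyl_comp (fun x => x ^+ 2) cd).
    - exact: (cyl_comp (fun x => K ^+ 2 * expR `|x|) cA').
    move=> w; rewrite -real_normK ?num_real//.
    apply: (@le_trans _ _ (G w ^+ 2)).
      by rewrite lerXn2r ?nnegrE//; exact: le_trans (diff w).
    rewrite /G exprMn ler_wpM2l ?sqr_ge0// -expRM_natl ler_expR.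
    by have := normr_ge0 (psum A' w); lra.
  rewrite ExZ; last exact: (cyl_comp (fun x => expR `|x|) cA').
  by rewrite ler_wpM2l ?sqr_ge0// Ex_expR_norm_psum.
have /andP[p0 p1] := rs_p01 D i.
rewrite (@le_trans _ _ (Num.sqrt (p i * (K ^+ 2 * (expR 1 * 2)))))//.
  rewrite ler_wsqrtr//; apply: ler_pM => //.
  - by rewrite mulr_ge0// ?subr_ge0 ltW.
  - by apply: Ex_ge0 => w; exact: sqr_ge0.
  - by rewrite ler_piMr ?(ltW p0)//; lra.
rewrite sqrtrM ?(ltW p0)// sqrtrM ?sqr_ge0// sqrtr_sqr ger0_norm// /wgt /K.
by rewrite le_eqVlt; apply/orP; left; apply/eqP; ring.
Qed.

Lemma shift_upd n w i b : iter n theta (upd w i b) = upd (iter n theta w) (iter n tau i) b.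
Proof.
apply/funext => j; rewrite !iter_shift /upd.
by rewrite (can2_eq (iter_tau'K (@rs_tau'K _ _ D) n) (iter_tauK (@rs_tauK _ _ D) n)).
Qed.

Lemma cyl_shift (U : Type) n (F : bits -> U) : cyl_fun F -> cyl_fun (fun w => F (iter n theta w)).
Proof.
move=> [m hF]; exists (\max_(j < m) iter n tau' j).+1 => w w' e; apply: hF => j jm.
rewrite !iter_shift; apply: e; rewrite ltnS.
exact: (leq_bigmax (Ordinal jm)).
Qed.

Lemma Ex_shift n (F : bits -> R) : cyl_fun F -> Ex (fun w => F (iter n theta w)) = Ex F.
Proof.
move=> cF; apply: (Ex_iter_shift (rs_p01 D) (@rs_PE _ _ D) (@rs_tau'K _ _ D) (@rs_p_tau _ _ D)).
exact: cyl_integrable.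
Qed.

(** Changing bit [i] before the shift changes bit [iter n tau i] after it, and the shift preserves
    expectations. *)
Lemma infl_shift n i (F : bits -> R) : cyl_fun F ->
  infl i (fun w => F (iter n theta w)) = infl (iter n tau i) F.
Proof.
move=> cF; rewrite /bit_infl (p_iter_tau (@rs_p_tau _ _ D)); congr (Num.sqrt (_ * _)).
rewrite -[RHS](Ex_shift n); last exact: (cyl_comp (fun x => x ^+ 2) (cyl_bit_diff _ cF)).
by apply: eq_Ex => w; rewrite /bit_diff !shift_upd.
Qed.

Lemma Minkowski (F G : bits -> R) : cyl_fun F -> cyl_fun G ->
  Num.sqrt (Ex (fun w => (F w + G w) ^+ 2)) <=
  Num.sqrt (Ex (fun w => F w ^+ 2)) + Num.sqrt (Ex (fun w => G w ^+ 2)).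
Proof.
move=> cF cG; have cFG := cyl_comp2 *%R cF cG.
have cFF := cyl_comp (fun x => x ^+ 2) cF; have cGG := cyl_comp (fun x => x ^+ 2) cG.
set a := Ex (fun w => F w ^+ 2); set b := Ex (fun w => G w ^+ 2).
have a0 : 0 <= a by apply: Ex_ge0 => w; exact: sqr_ge0.
have b0 : 0 <= b by apply: Ex_ge0 => w; exact: sqr_ge0.
have s0 : 0 <= Num.sqrt a + Num.sqrt b by rewrite addr_ge0 ?sqrtr_ge0.
rewrite -[leRHS]ger0_norm// -sqrtr_sqr ler_wsqrtr//.
rewrite (@eq_Ex _ _ _ (fun w => F w ^+ 2 + G w ^+ 2 + 2 * (F w * G w))); last by move=> w; ring.
rewrite ExD; [|exact: (cyl_comp2 (fun x y => x + y) cFF cGG)|exact: (cyl_comp _ cFG)].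
rewrite ExD// ExZ// -/a -/b sqrrD !sqr_sqrtr//.
have := Ex_CauchySchwarz P cF cG; rewrite -/a -/b => /(le_trans (ler_norm _)).
by rewrite mulr2n; lra.
Qed.

Lemma infl_add i (F G : bits -> R) : cyl_fun F -> cyl_fun G ->
  infl i (fun w => F w + G w) <= infl i F + infl i G.
Proof.
move=> cF cG; have pq := pq_ge0 (rs_p01 D) i.
rewrite /bit_infl !(sqrtrM _ pq) -mulrDr ler_wpM2l ?sqrtr_ge0//.
apply: le_trans (Minkowski (cyl_bit_diff i cF) (cyl_bit_diff i cG)).
rewrite le_eqVlt; apply/orP; left; apply/eqP; congr Num.sqrt.
by apply: eq_Ex => w; rewrite /bit_diff; congr (_ ^+ 2); ring.
Qed.

Lemma infl_cst i c : infl i (fun=> c) = 0.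
Proof.
rewrite /bit_infl (@eq_Ex _ _ _ (fun=> 0)); last by move=> w; rewrite /bit_diff subrr expr0n.
by rewrite Ex_cst mulr0 sqrtr0.
Qed.

Lemma infl_opp i (F : bits -> R) : infl i (fun w => - F w) = infl i F.
Proof.
congr (Num.sqrt (_ * _)); apply: eq_Ex => w; rewrite /bit_diff.
by rewrite -opprD sqrrN.
Qed.

Lemma infl_sum_shift (L : seq nat) i (F : bits -> R) : cyl_fun F ->
  infl i (fun w => \sum_(l <- L) F (iter l theta w)) <= \sum_(l <- L) infl (iter l tau i) F.
Proof.
move=> cF; elim: L => [|l L ih].
  rewrite (_ : (fun w => _) = fun=> 0) ?infl_cst ?big_nil//.
  by apply/funext => w; rewrite big_nil.
rewrite (_ : (fun w => _) = fun w => F (iter l theta w) + \sum_(l <- L) F (iter l theta w)); last first.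
  by apply/funext => w; rewrite big_cons.
rewrite big_cons (le_trans (infl_add _ _ _))//.
- exact: cyl_shift.
- by apply: cyl_sum => k; exact: cyl_shift.
by rewrite infl_shift// lerD2l.
Qed.

Definition Var (F : bits -> R) := Ex (fun w => (F w - Ex F) ^+ 2).

(** In Efron-Stein, one factor of each squared influence is bounded by [A], since for fixed [i] the
    indices [iter l tau i] are distinct by freeness. The other factor is summed over [i] first,
    since for fixed [l] these indices are distinct by injectivity. *)
Lemma Var_sum_shift (L : seq nat) (F : bits -> R) (a : nat -> R) (A : R) : cyl_fun F -> uniq L ->
  (forall i, infl i F <= a i) -> (forall s, uniq s -> \sum_(i <- s) a i <= A) ->
  Var (fun w => \sum_(l <- L) F (iter l theta w)) <= (size L)%:R * A ^+ 2.
Proof.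
move=> cF uL aF sa; set G := fun w => \sum_(l <- L) _.
have a0 i : 0 <= a i by apply: le_trans (aF i); exact: sqrtr_ge0.
have A0 : 0 <= A by rewrite -(big_nil 0 +%R xpredT a); exact: sa.
have cG : cyl_fun G by apply: cyl_sum => l; exact: cyl_shift.
have -> : Var G = Ex (fun w => G w * G w) - Ex G * Ex G.
  rewrite /Var (@eq_Ex _ _ _ (fun w => G w * G w + (- 2 * Ex G * G w + Ex G * Ex G))); last by move=> w; ring.
  have cGG := cyl_comp2 *%R cG cG.
  rewrite ExD//; last exact: (cyl_comp (fun x => - 2 * Ex G * x + Ex G * Ex G) cG).
  rewrite ExD; [|exact: (cyl_comp (fun x => - 2 * Ex G * x) cG)|exact: cyl_cst].
  by rewrite ExZ// Ex_cst; ring.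
have [n dG] := cG.
apply: le_trans (ler_norm _) (le_trans (efron_stein_cov (rs_p01 D) (@rs_PE _ _ D) dG dG) _).
have sumL i : \sum_(l <- L) a (iter l tau i) <= A.
  rewrite -(big_map (fun l => iter l tau i) xpredT a); apply: sa.
  by rewrite map_inj_in_uniq// => l m _ _ /(@rs_tau_free _ _ D).
apply: (@le_trans _ _ (\sum_(i < n) A * \sum_(l <- L) a (iter l tau i))).
  apply: ler_sum => i _.
  have h : infl i G <= \sum_(l <- L) a (iter l tau i).
    by apply: le_trans (infl_sum_shift _ _ cF) _; apply: ler_sum => l _; exact: aF.
  by apply: ler_pM; rewrite ?sqrtr_ge0//; exact: le_trans (sumL i).
rewrite -mulr_sumr exchange_big/= expr2 mulrCA ler_wpM2l//.
have -> : (size L)%:R * A = \sum_(l <- L) A.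
  by rewrite big_const_seq count_predT iter_addr_0 mulr_natl.
apply: ler_sum => l _.
rewrite -(big_mkord xpredT (fun i => a (iter l tau i))) -(big_map (iter l tau) xpredT a); apply: sa.
by rewrite map_inj_uniq ?iota_uniq//; exact: can_inj (iter_tauK (@rs_tauK _ _ D) l).
Qed.

End influences.

Lemma measurable_borel_continuous (R : realType) (X : normedModType R) (f : X -> R) :
  continuous f -> measurable_fun [set: borel X] (f : borel X -> R).
Proof.
move=> /continuousP cf; apply: (measurability _ (RGenOInfty.measurableE R)) => _ [_ [x ->] <-].
rewrite setTI; apply: sub_sigma_algebra; apply: cf; exact: interval_open.
Qed.

(** * Passage from partial sums to the random vector *)

Section limits.
Context (R : realType) (X : completeNormedModType R) (D : random_series X).

Notation p := (rs_p D).
Notation P := (rs_P D).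
Notation y := (rs_y D).
Notation tau := (rs_tau D).
Notation tau' := (rs_tau' D).
Notation theta := (shift tau').
Notation T := (rs_T D).
Notation env := (envelope D).
Notation V := (rvec D).
Local Notation psum := (psum D).
Local Notation Ex F := (Rintegral P setT F).
Local Notation infl := (bit_infl p P).

Definition psumn n := psum (iota 0 n).

Lemma expR_psumn_env n w : ((expR `|psumn n w|)%:E <= env w)%E.
Proof. by apply: expR_norm_psum_envelope; exact: iota_uniq. Qed.

Lemma env_ge1 w : (1 <= env w)%E.
Proof.
apply: le_trans (expR_psumn_env 0 w).
by rewrite /psumn /psum big_nil normr0 expR0.
Qed.

Lemma expR_rvec_env w : ((expR `|V w|)%:E <= env w)%E.
Proof.
have [g|ng] := pselect (good_at D w); last first.
  by rewrite /rvec asboolF// normr0 expR0; exact: env_ge1.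
case E : (env w) (fun n => expR_psumn_env n w) (env_ge1 w) => [e| |] h h1 //; last by rewrite leey.
rewrite lee_fin.
have cv : expR `|psumn n w| @[n --> \oo] --> expR `|V w|.
  by apply: (cvg_comp _ expR); [exact: cvg_norm (rvec_cvg g)|exact: continuous_expR].
by apply: (cvgr_to_le cv); exists 0%N => // n _; have := h n; rewrite lee_fin.
Qed.

Lemma integrable_env_shift n : P.-integrable setT (fun w => env (iter n theta w)).
Proof.
exact: (integrable_iter_shift (rs_p01 D) (@rs_PE _ _ D) (@rs_tau'K _ _ D) (@rs_p_tau _ _ D) n
  (integrable_envelope D)).
Qed.

Definition env_sum n w : \bar R := (\sum_(l < n) env (iter l theta w))%E.

Lemma integrable_env_sum n : P.-integrable setT (env_sum n).
Proof.
elim: n => [|n ih].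
  rewrite (_ : env_sum 0 = cst 0%E); first exact: integrable0.
  by apply/funext => w; rewrite /env_sum big_ord0.
rewrite (_ : env_sum n.+1 = fun w => (env_sum n w + env (iter n theta w))%E).
  by apply: integrableD => //; exact: integrable_env_shift.
by apply/funext => w; rewrite /env_sum big_ord_recr.
Qed.

(** [env w] may be infinite, where the inequality is trivial; elsewhere it compares real numbers. *)
Lemma env_dominates (r C : R) w : 0 < C -> (forall e, env w = e%:E -> r <= C * e) ->
  (r%:E <= C%:E * env w)%E.
Proof.
move=> C0 h; case E : (env w) h (env_ge1 w) => [e| |] h h1 //.
  by rewrite -EFinM lee_fin h.
by rewrite gt0_muley ?lte_fin// leey.
Qed.

Lemma env_sum_dominates n (r : nat -> R) C w : 0 < C ->
  (forall l, (l < n)%N -> forall e, env (iter l theta w) = e%:E -> r l <= C * e) ->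
  ((\sum_(l < n) r l)%:E <= C%:E * env_sum n w)%E.
Proof.
move=> C0 h; rewrite /env_sum ge0_sume_distrr; last first.
  by move=> l _; apply: le_trans (env_ge1 _); rewrite lee_fin.
rewrite -sumEFin; apply: lee_sum => l _; apply: env_dominates => // e; exact: h.
Qed.

Lemma dct (G : nat -> bits -> R) (Gl : bits -> R) (g : bits -> \bar R) :
  (forall n, measurable_fun setT (G n)) -> measurable_fun setT Gl ->
  P.-integrable setT g -> (forall n w, (`|G n w|%:E <= g w)%E) ->
  (forall w, good_at D w -> G n w @[n --> \oo] --> Gl w) ->
  P.-integrable setT (EFin \o Gl) /\ Ex (G n) @[n --> \oo] --> Ex Gl.
Proof.
move=> mG mGl ig hg hG.
have [|||||iGl _ cv] := @dominated_convergence _ _ _ P _ measurableT (fun n => EFin \o G n) (EFin \o Gl) g.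
- by move=> n; exact/measurable_EFinP.
- exact/measurable_EFinP.
- have [A [mA A0 sA]] := good_at_ae D; exists A; split=> // w nw; apply: sA => gw; apply: nw => _.
  by apply: cvg_EFin; [exact: nearW|exact: hG].
- exact: ig.
- by apply: aeW => w n _; exact: hg.
split=> //; apply: fine_cvg; rewrite fineK//; exact: integrable_fin_num.
Qed.

Lemma good_at_iter_shift n w : good_at D (iter n theta w) <-> good_at D w.
Proof. by elim: n => //= n <-; exact: good_at_shift. Qed.

Section one_function.
Variables (f : X -> R) (C : R).
Hypothesis fC : lip_exp f C.

Local Notation F := (fun w => f (V w)).
Local Notation Fn n := (fun w => f (psumn n w)).

Lemma cyl_Fn n : cyl_fun (Fn n).
Proof. exact: (cyl_comp f (psum_cyl D _)). Qed.

Lemma measurable_F : measurable_fun setT F.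
Proof.
apply: (measurableT_comp (measurable_borel_continuous (lip_exp_continuous fC))).
exact: measurable_rvec.
Qed.

Lemma measurable_shift n (U : bits -> R) : measurable_fun setT U ->
  measurable_fun setT (fun w => U (iter n theta w)).
Proof. by move=> mU; apply: (measurableT_comp mU); exact: measurable_iter_shift. Qed.

Lemma Fn_cvg w : good_at D w -> Fn n w @[n --> \oo] --> F w.
Proof.
move=> g; apply: (cvg_comp _ f); first exact: rvec_cvg.
exact: (lip_exp_continuous fC).
Qed.

Lemma growth : exists2 K, 0 < K & forall x, `|f x| <= K * expR (`|x| / 4).
Proof.
have [K K0 hK] := lip_exp_growth fC; exists (K + 1); first by rewrite ltr_wpDl.
by move=> x; rewrite (le_trans (hK x))// ler_wpM2r ?expR_ge0// lerDl.
Qed.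

Lemma expR_quarter (x : X) c : 0 <= c <= 1 -> expR (`|x| * c) <= expR `|x|.
Proof. by move=> /andP[c0 c1]; rewrite ler_expR ler_piMr. Qed.

Lemma sqr_integrable : P.-integrable setT (fun w => (F w ^+ 2)%:E) /\
  Ex (fun w => Fn n w ^+ 2) @[n --> \oo] --> Ex (fun w => F w ^+ 2).
Proof.
have [K K0 hK] := growth.
have sq x : `|f x ^+ 2| <= K ^+ 2 * expR `|x|.
  rewrite normrX (@le_trans _ _ ((K * expR (`|x| / 4)) ^+ 2))//.
    by rewrite lerXn2r ?nnegrE ?mulr_ge0 ?expR_ge0 ?(ltW K0).
  rewrite exprMn ler_wpM2l ?sqr_ge0// -expRM_natl ler_expR.
  by have := normr_ge0 x; lra.
apply: (@dct (fun n w => Fn n w ^+ 2) _ (fun w => ((K ^+ 2)%:E * env w)%E)).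
- by move=> n; apply: cyl_measurable; exact: (cyl_comp (fun x => x ^+ 2) (cyl_Fn n)).
- exact: (measurable_funX 2 measurable_F).
- by apply: integrableZl => //; exact: integrable_envelope.
- move=> n w; apply: env_dominates; first by rewrite exprn_gt0.
  move=> e we; apply: (le_trans (sq _)); rewrite ler_wpM2l ?sqr_ge0//.
  by have := expR_psumn_env n w; rewrite we lee_fin.
- by move=> w gw; exact: (cvgM (Fn_cvg gw) (Fn_cvg gw)).
Qed.

Lemma F_integrable : P.-integrable setT (EFin \o F) /\ Ex (Fn n) @[n --> \oo] --> Ex F.
Proof.
have [K K0 hK] := growth.
apply: (@dct (fun n => Fn n) _ (fun w => (K%:E * env w)%E)).
- by move=> n; apply: cyl_measurable; exact: cyl_Fn.
- exact: measurable_F.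
- by apply: integrableZl => //; exact: integrable_envelope.
- move=> n w; apply: env_dominates => // e we; apply: (le_trans (hK _)); rewrite ler_wpM2l ?(ltW K0)//.
  apply: le_trans (expR_quarter _ _) _; first by rewrite invr_ge0 invf_le1// ler1n !ler0n.
  by have := expR_psumn_env n w; rewrite we lee_fin.
- by move=> w gw; exact: (Fn_cvg gw).
Qed.

End one_function.

(** Efron-Stein for the truncations, with the influence of the shifted function read at
    [iter n tau i]. The bound is the same for all truncations, and dominated convergence passes to
    the limit. *)
Lemma cov_bound (f g : X -> R) C C' n B : lip_exp f C -> lip_exp g C' ->
  (forall K, \sum_(i < K) wgt D (iter n tau i) * wgt D i <= B) ->
  `|Ex (fun w => f (iter n T (V w)) * g (V w)) -
    Ex (fun w => f (iter n T (V w))) * Ex (fun w => g (V w))| <= C * C' * B.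
Proof.
move=> hf hg hB.
have [K K0 hK] := growth hf; have [K' K'0 hK'] := growth hg.
have [C0 _] := hf; have [C'0 _] := hg.
have eT w : iter n T (V w) = V (iter n theta w) by rewrite rvec_iter_shift.
have [iF cF] := F_integrable hf; have [iG cG] := F_integrable hg.
rewrite [X in _ - X * _](_ : _ = Ex (fun w => f (V w))); last first.
  under eq_Rintegral do rewrite eT.
  exact: (Ex_iter_shift (rs_p01 D) (@rs_PE _ _ D) (@rs_tau'K _ _ D) (@rs_p_tau _ _ D) n iF).
under eq_Rintegral do rewrite eT.
have [_ cFG] : P.-integrable setT (EFin \o (fun w => f (V (iter n theta w)) * g (V w))) /\
   Ex (fun w => f (psumn m (iter n theta w)) * g (psumn m w)) @[m --> \oo] -->
   Ex (fun w => f (V (iter n theta w)) * g (V w)).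
  apply: (@dct (fun m w => f (psumn m (iter n theta w)) * g (psumn m w)) _
     (fun w => (K * K')%:E * env (iter n theta w) + (K * K')%:E * env w)%E).
  - move=> m; apply: cyl_measurable.
    exact: (cyl_comp2 *%R (cyl_shift D n (cyl_Fn f m)) (cyl_Fn g m)).
  - by apply: measurable_funM; [apply: (measurable_shift n (U := fun w => f (V w))); exact: (measurable_F hf)|exact: (measurable_F hg)].
  - by apply: integrableD => //; apply: integrableZl => //; [exact: integrable_env_shift|exact: integrable_envelope].
  - move=> m w; set a := psumn m _; set b := psumn m w.
    apply: (@le_trans _ _ ((K * K') * expR `|a| + (K * K') * expR `|b|)%:E).
      rewrite lee_fin normrM; apply: (@le_trans _ _ (K * expR (`|a| / 4) * (K' * expR (`|b| / 4)))).
        by apply: ler_pM.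
      rewrite mulrACA -mulrDr ler_wpM2l ?mulr_ge0 ?(ltW K0) ?(ltW K'0)// -expRD.
      (* A product of two quarter exponentials is at most the exponential of the larger norm. *)
      have [ab|/ltW ba] := leP `|a| `|b|.
        apply: (@le_trans _ _ (expR `|b|)); last by rewrite lerDr expR_ge0.
        by rewrite ler_expR; have := normr_ge0 b; lra.
      apply: (@le_trans _ _ (expR `|a|)); last by rewrite lerDl expR_ge0.
      by rewrite ler_expR; have := normr_ge0 a; lra.
    rewrite EFinD; apply: leeD; rewrite EFinM; apply: lee_wpmul2l;
      rewrite ?lee_fin ?mulr_ge0 ?(ltW K0) ?(ltW K'0)//; exact: expR_psumn_env.
  - move=> w gw; apply: cvgM; last exact: (Fn_cvg hg).
    by apply: (Fn_cvg hf); exact/good_at_iter_shift.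
have lim : `|Ex (fun w => f (psumn m (iter n theta w)) * g (psumn m w)) -
    Ex (fun w => f (psumn m w)) * Ex (fun w => g (psumn m w))| @[m --> \oo] -->
  `|Ex (fun w => f (V (iter n theta w)) * g (V w)) - Ex (fun w => f (V w)) * Ex (fun w => g (V w))|.
  by apply: cvg_norm; apply: cvgB; [exact: cFG|exact: cvgM].
apply: (cvgr_to_le lim); near=> m.
have cFm := cyl_Fn f m; have cGm := cyl_Fn g m.
have cFs := cyl_shift D n cFm.
rewrite -(Ex_shift D n cFm).
have [[m1 d1] [m2 d2]] := (cFs, cGm).
have d1' := depends_below_le (leq_maxl m1 m2) d1.
have d2' := depends_below_le (leq_maxr m1 m2) d2.
apply: le_trans (efron_stein_cov (rs_p01 D) (@rs_PE _ _ D) d1' d2') _.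
apply: (@le_trans _ _ (C * C' * \sum_(i < maxn m1 m2) wgt D (iter n tau i) * wgt D i)); last first.
  by rewrite ler_wpM2l ?mulr_ge0.
rewrite mulr_sumr; apply: ler_sum => i _; rewrite mulrACA.
apply: ler_pM; rewrite ?sqrtr_ge0//.
  by rewrite (infl_shift D n i cFm); apply: infl_psum => //; exact: iota_uniq.
by apply: infl_psum => //; exact: iota_uniq.
Unshelve. all: by end_near. Qed.

End limits.

Lemma cvg_sum_ord (R : realType) n (a : nat -> nat -> R) (b : nat -> R) :
  (forall l, a M l @[M --> \oo] --> b l) -> \sum_(l < n) a M l @[M --> \oo] --> \sum_(l < n) b l.
Proof.
move=> h; elim: n => [|n ih].
  rewrite (_ : (fun M => _) = fun=> 0) ?big_ord0; first exact: cvg_cst.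
  by apply/funext => M; rewrite big_ord0.
rewrite (_ : (fun M => _) = fun M => \sum_(l < n) a M l + a M n) ?big_ord_recr/=; first exact: cvgD.
by apply/funext => M; rewrite big_ord_recr.
Qed.

(** * Approximation by functions of finitely many bits *)

Section cylinder_approximation.
Context (R : realType) (X : completeNormedModType R) (D : random_series X).

Notation p := (rs_p D).
Notation P := (rs_P D).
Notation tau := (rs_tau D).
Notation tau' := (rs_tau' D).
Notation theta := (shift tau').
Notation env := (envelope D).
Notation V := (rvec D).
Local Notation psumn := (psumn D).
Local Notation Ex F := (Rintegral P setT F).
Local Notation infl := (bit_infl p P).

Variables (f : X -> R) (C A : R).
Hypothesis fC : lip_exp f C.
Hypothesis wA : forall s, uniq s -> \sum_(i <- s) wgt D i <= A.

Local Notation F := (fun w => f (V w)).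
Local Notation Fn n := (fun w => f (psumn n w)).

(** A finite set whose weight is within [e] of the supremum leaves at most [e] to any disjoint
    finite set. *)
Lemma wgt_tail e : 0 < e -> exists K0, forall s, uniq s -> (forall i, i \in s -> (K0 <= i)%N) ->
  \sum_(i <- s) wgt D i <= e.
Proof.
move=> e0; pose S := [set x | exists2 s, uniq s & x = \sum_(i <- s) wgt D i].
have hS : has_sup S.
  split; first by exists 0; exists [::]; rewrite ?big_nil.
  by exists A => _ [s us ->]; exact: wA.
have [_ [s0 us0 ->] h] := sup_adherent e0 hS.
exists (\max_(i <- s0) i).+1 => s us sK.
have : \sum_(i <- s0 ++ s) wgt D i <= sup S.
  apply: ub_le_sup; first by case: hS.
  exists (s0 ++ s) => //; rewrite cat_uniq us0 us andbT; apply/hasPn => i /sK.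
  apply: contraTN => iS; rewrite -leqNgt.
  exact: (@leq_bigmax_seq nat s0 xpredT (fun i => i) i iS isT).
by rewrite big_cat/=; lra.
Qed.

Lemma L2_cauchy d : 0 < d -> exists m, forall M, (m <= M)%N ->
  Ex (fun w => (Fn M w - Fn m w) ^+ 2) <= d ^+ 2.
Proof.
move=> d0; have [K K0 hK] := growth fC.
have mF := measurable_F D fC.
have sq M w : (((Fn M w - F w) ^+ 2)%:E <= (4 * K ^+ 2)%:E * env w)%E.
  apply: env_dominates; first by rewrite mulr_gt0// exprn_gt0.
  move=> e we; have h1 := expR_psumn_env D M w; have h2 := expR_rvec_env D w.
  rewrite we lee_fin in h1; rewrite we lee_fin in h2.
  have b x : expR `|x| <= e -> f x ^+ 2 <= K ^+ 2 * e.
    move=> xe; rewrite -real_normK ?num_real// (@le_trans _ _ ((K * expR (`|x| / 4)) ^+ 2))//.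
      by rewrite lerXn2r ?nnegrE ?mulr_ge0 ?expR_ge0 ?(ltW K0).
    rewrite exprMn ler_wpM2l ?sqr_ge0// -expRM_natl (le_trans _ xe)// ler_expR.
    by have := normr_ge0 x; lra.
  by have := b _ h1; have := b _ h2; have := sqr_ge0 (Fn M w + F w); nra.
have ig : P.-integrable setT (fun w => (4 * K ^+ 2)%:E * env w)%E.
  by apply: integrableZl => //; exact: integrable_envelope.
have mM M : measurable_fun setT (fun w => (Fn M w - F w) ^+ 2).
  apply: measurable_funX; apply: measurable_funB => //.
  by apply: cyl_measurable; exact: cyl_Fn.
have iM M : P.-integrable setT (EFin \o (fun w => (Fn M w - F w) ^+ 2)).
  apply: le_integrable ig => //; first exact/measurable_EFinP.
  move=> w _ /=; rewrite ger0_norm ?sqr_ge0// (le_trans (sq M w))//.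
  by rewrite lee_abs.
have sqn M w : (`|(Fn M w - F w) ^+ 2|%:E <= (4 * K ^+ 2)%:E * env w)%E.
  by rewrite ger0_norm ?sqr_ge0//; exact: sq.
have lim0 w : good_at D w -> (Fn M w - F w) ^+ 2 @[M --> \oo] --> 0.
  move=> gw; have h : Fn M w - F w @[M --> \oo] --> 0.
    by rewrite -(subrr (F w)); apply: cvgB; [exact: (Fn_cvg fC)|exact: cvg_cst].
  by rewrite -(mulr0 0); exact: (cvgM h h).
have [_ cv] := dct (G := fun M w => (Fn M w - F w) ^+ 2) mM (measurable_cst _) ig sqn lim0.
(* The 1/4 pays for (a - b)^2 <= 2 a^2 + 2 b^2, both truncations being compared with the limit. *)
have d2 : 0 < d ^+ 2 / 4 by rewrite divr_gt0// exprn_gt0.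
rewrite Ex_cst in cv; have /cvgr0Pnorm_le/(_ _ d2)[m _ hm] := cv.
exists m => M mM'.
have eM := hm M mM'; have em := hm m (leqnn m).
rewrite /= ger0_norm in eM; last by apply: Ex_ge0 => w; exact: sqr_ge0.
rewrite /= ger0_norm in em; last by apply: Ex_ge0 => w; exact: sqr_ge0.
apply: (@le_trans _ _ (Ex (fun w => 2 * (Fn M w - F w) ^+ 2 + 2 * (Fn m w - F w) ^+ 2))).
  have c1 : cyl_fun (fun w => (Fn M w - Fn m w) ^+ 2).
    exact: (cyl_comp2 (fun x y => (x - y) ^+ 2) (cyl_Fn D f M) (cyl_Fn D f m)).
  apply: le_Rintegral => //; first exact: cyl_integrable.
    have i2 k : P.-integrable setT (EFin \o (fun w => 2 * (Fn k w - F w) ^+ 2)).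
      by apply: (eq_integrable measurableT _ _ _ (integrableZl measurableT 2 (iM k))) => w _ /=; rewrite EFinM.
    by apply: (eq_integrable measurableT _ _ _ (integrableD measurableT (i2 M) (i2 m))) => w _.
  by move=> w _; have := sqr_ge0 ((Fn M w - F w) + (Fn m w - F w)); nra.
have i2 k : P.-integrable setT (EFin \o (fun w => 2 * (Fn k w - F w) ^+ 2)).
  by apply: (eq_integrable measurableT _ _ _ (integrableZl measurableT 2 (iM k))) => w _ /=; rewrite EFinM.
rewrite RintegralD// !RintegralZl//; lra.
Qed.

(** The error must be small after division by sqrt n, uniformly in [n]. The influences of
    [Fn M - Fn m] are bounded both by the weights, whose tail is small, and by the L2 distance,
    which handles the finitely many remaining bits. *)
Lemma Var_approx e : 0 < e -> exists m, forall M n, (m <= M)%N ->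
  Var D (fun w => \sum_(l <- iota 0 n) (Fn M (iter l theta w) - Fn m (iter l theta w))) <= n%:R * e ^+ 2.
Proof.
move=> e0; have [C0 _] := fC.
(* Each group gets half of [e]: for the tail 2 C e / (4 C + 1) <= e / 2, and for the first [K0] bits
   K0 d <= e / 2. *)
have [|K0 hK0] := @wgt_tail (e / (4 * C + 1)); first by rewrite divr_gt0// ltr_wpDl// mulr_ge0.
pose d := e / 2 / K0.+1%:R; have d0 : 0 < d by rewrite !divr_gt0.
have [m hm] := L2_cauchy d0; exists m => M n mM.
have cG : cyl_fun (fun w => Fn M w - Fn m w).
  exact: (cyl_comp2 (fun x y => x - y) (cyl_Fn D f M) (cyl_Fn D f m)).
pose a i := Num.min (2 * C * wgt D i) d.
have := @Var_sum_shift _ _ D (iota 0 n) (fun w => Fn M w - Fn m w) a e cG (iota_uniq _ _).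
rewrite size_iota; apply.
  move=> i; rewrite le_min; apply/andP; split.
    have cm := cyl_Fn D f m; have cM := cyl_Fn D f M.
    rewrite (le_trans (infl_add D i cM (cyl_comp -%R cm)))// infl_opp.
    rewrite (_ : 2 * C * _ = C * wgt D i + C * wgt D i); last by ring.
    by apply: lerD; apply: infl_psum => //; exact: iota_uniq.
  apply: le_trans (bit_infl_le (rs_p01 D) (@rs_PE _ _ D) i cG) _.
  by rewrite -[leRHS]ger0_norm ?(ltW d0)// -sqrtr_sqr ler_wsqrtr// hm.
have cst (s : seq nat) : \sum_(i <- s) d = (size s)%:R * d.
  by rewrite big_const_seq count_predT iter_addr_0 mulr_natl.
move=> s us; rewrite (bigID (fun i => i < K0)%N)/= [leRHS]splitr lerD//.
  apply: (@le_trans _ _ (\sum_(i <- iota 0 K0) d)).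
    rewrite -big_filter; apply: (@le_trans _ _ (\sum_(i <- [seq i <- s | (i < K0)%N]) d)).
      by apply: ler_sum => i _; rewrite /a ge_min lexx orbT.
    rewrite !cst ler_wpM2r ?(ltW d0)// ler_nat.
    apply: uniq_leq_size; first by rewrite filter_uniq.
    by move=> i; rewrite mem_filter mem_iota => /andP[].
  rewrite cst size_iota /d mulrCA ler_piMr//.
    by rewrite divr_ge0 ?(ltW e0).
  by rewrite ler_pdivrMr// mul1r ler_nat.
rewrite -big_filter; apply: (@le_trans _ _ (\sum_(i <- [seq i <- s | ~~ (i < K0)%N]) 2 * C * wgt D i)).
  by apply: ler_sum => i _; rewrite /a ge_min lexx.
rewrite -mulr_sumr.
have h : \sum_(i <- [seq i <- s | ~~ (i < K0)%N]) wgt D i <= e / (4 * C + 1).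
  apply: hK0; first by rewrite filter_uniq.
  by move=> i; rewrite mem_filter -leqNgt => /andP[].
apply: (@le_trans _ _ (2 * C * (e / (4 * C + 1)))); first by rewrite ler_wpM2l// mulr_ge0.
rewrite mulrA ler_pdivrMr; last by rewrite ltr_wpDl// mulr_ge0.
nra.
Qed.

Lemma Var_sum_center (H : bits -> R) L : cyl_fun H ->
  Var D (fun w => \sum_(l <- L) H (iter l theta w)) =
  Ex (fun w => (\sum_(l <- L) (H (iter l theta w) - Ex H)) ^+ 2).
Proof.
move=> cH; apply: eq_Ex => w; congr (_ ^+ 2).
rewrite Ex_sum; last by move=> l; exact: cyl_shift.
by rewrite -sumrB; apply: eq_bigr => l _; rewrite Ex_shift.
Qed.

Lemma Ex_abs_Fn M K : (forall x, `|f x| <= K * expR (`|x| / 4)) -> 0 < K ->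
  `|Ex (Fn M)| <= K * (expR 1 * 2).
Proof.
move=> hK K0; have cM := cyl_Fn D f M.
apply: le_trans (Ex_norm P cM) _.
have c1 := psum_cyl D (iota 0 M).
apply: (@le_trans _ _ (Ex (fun w => K * expR `|psumn M w|))).
  apply: le_Ex; [exact: (cyl_comp _ cM)|exact: (cyl_comp (fun x => K * expR `|x|) c1)|].
  move=> w; apply: (le_trans (hK _)); rewrite ler_wpM2l ?(ltW K0)//.
  by apply: expR_quarter; rewrite invr_ge0 invf_le1// ler1n !ler0n.
rewrite ExZ; last exact: (cyl_comp (fun x => expR `|x|) c1).
by rewrite ler_wpM2l ?(ltW K0)// Ex_expR_norm_psum// iota_uniq.
Qed.

Hypothesis F0 : Ex F = 0.

Lemma cylinder_approx e : 0 < e -> exists G : bits -> R,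
  [/\ cyl_fun G, Ex G = 0,
     forall L, uniq L -> Ex (fun w => (\sum_(l <- L) G (iter l theta w)) ^+ 2) <= (size L)%:R * (C * A) ^+ 2,
     forall n, P.-integrable setT (EFin \o (fun w => \sum_(l < n) F (iter l theta w))) &
     forall n, Ex (fun w => `|\sum_(l < n) F (iter l theta w) - \sum_(l < n) G (iter l theta w)|) <=
       Num.sqrt n%:R * e].
Proof.
move=> e0; have [C0 _] := fC; have [K K0 hK] := growth fC.
have [m hm] := Var_approx e0.
have cm := cyl_Fn D f m.
pose c := Ex (Fn m); pose G w := Fn m w - c.
have cG : cyl_fun G by exact: (cyl_comp (fun x => x - c) cm).
have [iF cvF] := F_integrable D fC.
have mF := measurable_F D fC.
have mFl l : measurable_fun setT (fun w => F (iter l theta w)).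
  exact: (measurable_shift D l (U := fun w => f (V w))).
have iFl l : P.-integrable setT (EFin \o (fun w => F (iter l theta w))).
  exact: (integrable_iter_shift (rs_p01 D) (@rs_PE _ _ D) (@rs_tau'K _ _ D) (@rs_p_tau _ _ D) l iF).
exists G; split => //.
- by rewrite ExB//; [rewrite Ex_cst subrr|exact: cyl_cst].
- move=> L uL; rewrite -(Var_sum_center L cm).
  apply: (@Var_sum_shift _ _ D L (Fn m) (fun i => C * wgt D i)) => //.
    by move=> i; apply: infl_psum => //; exact: iota_uniq.
  by move=> s us; rewrite -mulr_sumr ler_wpM2l// wA.
- elim=> [|n ih].
    apply: (eq_integrable measurableT (cst 0%E)); last exact: integrable0.
    by move=> w _; rewrite /= big_ord0.
  apply: (eq_integrable measurableT _ _ _ (integrableD measurableT ih (iFl n))) => w _ /=.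
  by rewrite big_ord_recr.
move=> n; pose c' M := Ex (fun w => Fn M w - Fn m w).
have cMm M : cyl_fun (fun w => Fn M w - Fn m w).
  exact: (cyl_comp2 (fun x y => x - y) (cyl_Fn D f M) cm).
pose Z M w := \sum_(l < n) (Fn M (iter l theta w) - Fn m (iter l theta w) - c' M).
have cZ M : cyl_fun (Z M).
  by apply: cyl_sum => l; apply: (cyl_comp (fun x => x - c' M)); exact: (cyl_shift D l (cMm M)).
have c'E M : c' M = Ex (Fn M) - c by rewrite /c' ExB//; exact: cyl_Fn.
(* Two values of [f], each at most [K] times the envelope, and two means, each bounded by
   [Ex_abs_Fn]. *)
pose B := 2 * K + 2 * (K * (expR 1 * 2)).
have KB0 : 0 < K * (expR 1 * 2) by rewrite !mulr_gt0// expR_gt0.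
have B0 : 0 < B by rewrite /B; lra.
(* The vanishing mean of [F] enters here: the centring of [Fn M - Fn m] tends to minus the mean of
   [Fn m], so the limit of [Z M] involves exactly [F - G]. *)
have cvc : c' M @[M --> \oo] --> - c.
  rewrite (_ : c' = fun M => Ex (Fn M) - c); last by apply/funext => M; rewrite c'E.
  by rewrite -[X in _ --> X]add0r -F0; apply: cvgB; [exact: cvF|exact: cvg_cst].
have [|||||iZ cvZ] := @dct _ _ D (fun M w => `|Z M w|)
    (fun w => `|\sum_(l < n) F (iter l theta w) - \sum_(l < n) G (iter l theta w)|)
    (fun w => B%:E * env_sum D n w)%E.
- by move=> M; apply: cyl_measurable; exact: (cyl_comp (fun x => `|x|) (cZ M)).
- apply: measurableT_comp => //; apply: measurable_funB.
    by apply: measurable_sum => l; exact: mFl.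
  by apply: cyl_measurable; apply: cyl_sum => l; exact: (cyl_shift D l cG).
- by apply: integrableZl => //; exact: integrable_env_sum.
- move=> M w; rewrite normr_id.
  apply: (@le_trans _ _ (\sum_(l < n) `|Fn M (iter l theta w) - Fn m (iter l theta w) - c' M|)%:E).
    by rewrite lee_fin; exact: ler_norm_sum.
  apply: (env_sum_dominates (r := fun l => `|Fn M (iter l theta w) - Fn m (iter l theta w) - c' M|)) => //.
  move=> l _ r wr.
  have q k : `|f (psumn k (iter l theta w))| <= K * r.
    apply: (le_trans (hK _)); rewrite ler_wpM2l ?(ltW K0)//.
    apply: le_trans (expR_quarter _ _) _; first by rewrite invr_ge0 invf_le1// ler1n !ler0n.
    by have := expR_psumn_env D k (iter l theta w); rewrite wr lee_fin.
  have r1 : 1 <= r by have := env_ge1 D (iter l theta w); rewrite wr lee_fin.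
  have q1 := Ex_abs_Fn M hK K0; have q2 := Ex_abs_Fn m hK K0.
  rewrite c'E; have h1 := q M; have h2 := q m.
  rewrite (le_trans (ler_normB _ _))// (le_trans (lerD (ler_normB _ _) (ler_normB _ _)))//.
  move: q1 q2 h1 h2; rewrite -/c /B; set b := K * (expR 1 * 2) in KB0 *.
  move=> q1 q2 h1 h2; have : b <= b * r by rewrite ler_peMr// ltW.
  by lra.
- move=> w gw; rewrite -sumrB; apply: cvg_norm; rewrite /Z.
  have one l : f (psumn M (iter l theta w)) - f (psumn m (iter l theta w)) - c' M @[M --> \oo] -->
      f (V (iter l theta w)) - G (iter l theta w).
    rewrite /G.
    rewrite -[X in _ --> X](_ : f (V (iter l theta w)) - f (psumn m (iter l theta w)) - - c = _).
      apply: cvgB => //; apply: cvgB; last exact: cvg_cst.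
      by apply: (Fn_cvg fC); exact/good_at_iter_shift.
    by rewrite opprK; ring.
  exact: (cvg_sum_ord (a := fun M l => Fn M (iter l theta w) - Fn m (iter l theta w) - c' M) one).
apply: (cvgr_to_le cvZ); exists m => // M /= mM.
apply: le_trans (ler_norm _) (le_trans (Ex_sqr_le P (cyl_comp (fun x => `|x|) (cZ M))) _).
rewrite -[e in leRHS]ger0_norm ?(ltW e0)// -sqrtr_sqr -sqrtrM// ler_wsqrtr//.
apply: le_trans (hm M n mM); rewrite (Var_sum_center _ (cMm M)).
rewrite le_eqVlt; apply/orP; left; apply/eqP; apply: eq_Ex => w.
rewrite real_normK ?num_real//; congr (_ ^+ 2).
by rewrite /Z -(big_mkord xpredT (fun l => Fn M (iter l theta w) - Fn m (iter l theta w) - c' M)) /index_iota subn0.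
Qed.

End cylinder_approximation.

(** * Decay rates *)

Section rates.
Variable R : realType.
Implicit Types a g : R.

Lemma powR_expR (x a : R) : 0 < x -> x `^ a = expR (a * ln x).
Proof. by move=> x0; rewrite /powR gt_eqF. Qed.

(** The inequality ln(1 + x) <= x at x = - 1 / (m + 1). It replaces the comparison with integrals in
    the sums below. *)
Lemma ln_step m : (0 < m)%N -> ln m%:R <= ln m.+1%:R - m.+1%:R^-1 :> R.
Proof.
move=> m0; have m0' : (0 : R) < m%:R by rewrite ltr0n.
have m1' : (0 : R) < m.+1%:R by [].
rewrite -lerBlDl -ln_div ?posrE//.
have -> : m%:R / m.+1%:R = 1 + (- m.+1%:R^-1) :> R.
  by rewrite -[in LHS](addrK 1 (m%:R : R)) natr1 mulrBl divff ?mul1r// pnatr_eq0.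
apply: le_ln1Dx; rewrite ltrN2 invf_lt1// ltr1n.
by case: m m0 {m0' m1'}.
Qed.

(** Telescoping: g (m + 1)^-(1 + g) is at most m^-g - (m + 1)^-g, by [ln_step] and exp x >= 1 +
    x. *)
Lemma sum_tail_powR g n N : 0 < g -> (0 < n)%N -> (n <= N)%N ->
  \sum_(n <= m < N) m.+1%:R `^ (- (1 + g)) <= g^-1 * (n%:R `^ (- g) - N%:R `^ (- g)).
Proof.
move=> g0 n0 /subnK <-; elim: (N - n)%N => [|k ih].
  by rewrite add0n big_geq// subrr mulr0.
rewrite addSn big_nat_recr/= ?leq_addl//; set m := (k + n)%N in ih *.
have m0 : (0 < m)%N by rewrite addn_gt0 n0 orbT.
have m0' : (0 : R) < m%:R by rewrite ltr0n.
apply: (le_trans (lerD ih (lexx _))).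
suff : g * m.+1%:R `^ (- (1 + g)) <= m%:R `^ (- g) - m.+1%:R `^ (- g).
  by rewrite -ler_pdivlMl// => h; rewrite (le_trans (lerD (lexx _) h))// -mulrDr addrA subrK.
rewrite !powR_expR//; set L := ln m%:R; set L' := ln m.+1%:R.
have -> : expR (- (1 + g) * L') = expR (- g * L') / m.+1%:R.
  rewrite (_ : - (1 + g) * L' = - g * L' + - L'); last by ring.
  by rewrite expRD expRN lnK// posrE.
have h : expR (- g * L') * (1 + g / m.+1%:R) <= expR (- g * L).
  apply: (@le_trans _ _ (expR (- g * L') * expR (g / m.+1%:R))).
    by rewrite ler_wpM2l ?expR_ge0// expR_ge1Dx.
  have h := ln_step m0; rewrite -/L -/L' in h; rewrite -expRD ler_expR.
  move: h; set t := _^-1 => h.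
  by have := ler_wpM2l (ltW g0) h; lra.
by rewrite lerBrDr mulrCA [leLHS]addrC -[X in X + _]mulr1 -mulrDr.
Qed.

(** Telescoping again. The increment now needs an upper bound of exp(-u) for u in [0, 1], namely 1 /
    (1 + u) <= 1 - u / 2, whence the factor 2. *)
Lemma sum_head_powR a n : 0 < a -> a < 1 ->
  \sum_(0 <= m < n) m.+1%:R `^ (- a) <= 2 / (1 - a) * n%:R `^ (1 - a).
Proof.
move=> a0 a1; set g := 1 - a; have g0 : 0 < g by rewrite subr_gt0.
elim: n => [|m ih]; first by rewrite big_geq// powR0 ?mulr0// gt_eqF.
rewrite big_nat_recr//= (le_trans (lerD ih (lexx _)))//.
suff : g / 2 * m.+1%:R `^ (- a) <= m.+1%:R `^ g - m%:R `^ g.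
  move=> h; rewrite -lerBrDl -mulrBr.
  have -> : m.+1%:R `^ (- a) = 2 / g * (g / 2 * m.+1%:R `^ (- a)).
    by rewrite mulrA -(invf_div g) mulVf ?mul1r// mulf_neq0 ?gt_eqF// invr_gt0.
  by rewrite ler_wpM2l// divr_ge0// ltW.
case: m {ih} => [|m].
  by rewrite powR0 ?gt_eqF// subr0 !powR1 mulr1 /g; lra.
have x1 : (1 : R) <= m.+2%:R by rewrite ler1n.
rewrite !powR_expR//; set L := ln m.+1%:R; set L' := ln m.+2%:R.
pose t : R := m.+2%:R^-1; have t0 : 0 < t by rewrite invr_gt0.
have -> : expR (- a * L') = expR (g * L') * t.
  rewrite (_ : - a * L' = g * L' + - L'); last by rewrite /g; ring.
  by rewrite expRD expRN lnK// posrE.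
have h : expR (g * L) <= expR (g * L') * expR (- (g * t)).
  rewrite -expRD ler_expR; have := ln_step (ltn0Sn m); rewrite -/L -/L' -/t => h.
  by have := ler_wpM2l (ltW g0) h; lra.
rewrite lerBrDr (le_trans (lerD (lexx _) h))// -lerBrDr -[X in X - _]mulr1 -mulrBr.
rewrite mulrCA ler_wpM2l ?expR_ge0// lerBrDr -lerBrDl expRN.
have gt0 : 0 < g * t by rewrite mulr_gt0.
have gt1 : g * t <= 1.
  by rewrite mulr_ile1 ?(ltW g0) ?(ltW t0)//; [rewrite /g; lra|rewrite invf_le1].
apply: (@le_trans _ _ (1 + g * t)^-1).
  by rewrite lef_pV2 ?posrE ?expR_gt0 ?expR_ge1Dx//; lra.
rewrite -div1r ler_pdivrMr; last by lra.
by nra.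
Qed.

(** The base [m.+1] makes the weight 1 at [m = 0], the centre of the orbit. *)
Definition pw a m : R := m.+1%:R `^ (- a).

Definition rate a n : R :=
  if a < 1 then n%:R `^ (1 - 2 * a) else if a == 1 then ln (n%:R + 1) / n%:R else n%:R `^ (- a).

Lemma pw_ge0 a m : 0 <= pw a m. Proof. exact: powR_ge0. Qed.

Lemma pw_le1 a m : 0 < a -> pw a m <= 1.
Proof.
move=> a0; rewrite /pw powRN invf_le1 ?powR_gt0//.
apply: (@le_trans _ _ (1 `^ a)); first by rewrite powR1.
by apply: ge0_ler_powR; rewrite ?nnegrE ?(ltW a0) ?ler1n.
Qed.

(** Bounds the product of the weights of two positions at distance [n], [m] being the smaller
    absolute value: the other weight is at most [pw a m], and also at most (n / 2)^-a, since its
    position has absolute value at least n / 2. *)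
Definition pw_min a n m := pw a m * Num.min (pw a m) (2 `^ a * n%:R `^ (- a)).

Lemma pw_min_ge0 a n m : 0 <= pw_min a n m.
Proof. by rewrite mulr_ge0 ?le_min ?pw_ge0 ?mulr_ge0 ?powR_ge0. Qed.

Lemma sum_pw_bounded a : 1 < a -> exists A, forall N, \sum_(0 <= m < N) pw a m <= A.
Proof.
move=> a1; exists (1 + (a - 1)^-1) => N.
case: N => [|N]; first by rewrite big_geq// addr_ge0// invr_ge0; lra.
rewrite big_nat_recl//= {1}/pw powR1 lerD2l.
rewrite (_ : \sum_(0 <= i < N) pw a i.+1 = \sum_(1 <= i < N.+1) pw a i); last by rewrite big_add1.
have g0 : 0 < a - 1 by lra.
have := sum_tail_powR g0 (ltnSn 0) (ltn0Sn N).
have -> : 1 + (a - 1) = a by ring.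
move=> /le_trans; apply; by rewrite powR1 ler_piMr ?invr_ge0 ?(ltW g0)// gerBl powR_ge0.
Qed.

Lemma harmonic_ln n : (0 < n)%N -> \sum_(0 <= m < n) pw 1 m <= 1 + ln n%:R.
Proof.
case: n => // n _; elim: n => [|n ih]; first by rewrite big_nat1 /pw powR1 ln1 addr0.
rewrite big_nat_recr//= (le_trans (lerD ih (lexx _)))// -addrA lerD2l.
by rewrite /pw powR_inv1// -lerBrDr; exact: ln_step.
Qed.

Lemma sum_pw_min a : 1 / 2 < a -> exists C, forall n N, (0 < n)%N ->
  \sum_(0 <= m < N) pw_min a n m <= C * rate a n.
Proof.
move=> a2; have a0 : 0 < a by lra.
have g0 : 0 < 2 * a - 1 by lra.
(* The sum is cut at [m = n]: below, the second member of the minimum is used; above, the first. *)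
have split n N : (0 < n)%N ->
    \sum_(0 <= m < N) pw_min a n m <=
    2 `^ a * n%:R `^ (- a) * \sum_(0 <= m < n) pw a m + (2 * a - 1)^-1 * n%:R `^ (1 - 2 * a).
  move=> n0; pose v m := pw_min a n m; have v0 m : 0 <= v m by exact: pw_min_ge0.
  apply: (@le_trans _ _ (\sum_(0 <= m < n + N) v m)).
    by rewrite (big_cat_nat (n := N) (p := (n + N)%N))//= ?leq_addl// lerDl sumr_ge0.
  rewrite (big_cat_nat (n := n))//= ?leq_addr//; apply: lerD.
    rewrite mulr_sumr; apply: ler_sum => m _.
    by rewrite /v /pw_min mulrC ler_wpM2r ?pw_ge0// ge_min lexx orbT.
  apply: (@le_trans _ _ (\sum_(n <= m < n + N) m.+1%:R `^ (- (1 + (2 * a - 1))))).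
    apply: ler_sum => m _; rewrite /v /pw_min (@le_trans _ _ (pw a m * pw a m))//.
      by rewrite ler_wpM2l ?pw_ge0// ge_min lexx.
    by rewrite /pw !powR_expR// -expRD ler_expR le_eqVlt; apply/orP; left; apply/eqP; ring.
  apply: (le_trans (sum_tail_powR g0 n0 (leq_addr _ _))).
  rewrite ler_wpM2l ?invr_ge0 ?(ltW g0)//.
  have -> : 1 - 2 * a = - (2 * a - 1) by ring.
  by rewrite lerBlDr lerDl powR_ge0.
have mulpow n s t : (0 < n)%N -> n%:R `^ s * n%:R `^ t = n%:R `^ (s + t) :> R.
  by move=> n0; rewrite powRD// pnatr_eq0 -lt0n n0 implybT.
rewrite /rate; case: ltrgtP => a1.
- exists (2 `^ a * (2 / (1 - a)) + (2 * a - 1)^-1) => n N n0.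
  apply: (le_trans (split n N n0)); rewrite [leRHS]mulrDl lerD2r.
  apply: (@le_trans _ _ (2 `^ a * n%:R `^ (- a) * (2 / (1 - a) * n%:R `^ (1 - a)))).
    by rewrite ler_wpM2l ?mulr_ge0 ?powR_ge0// sum_head_powR.
  by rewrite mulrACA mulpow// le_eqVlt; apply/orP; left; apply/eqP; congr (_ * _ `^ _); ring.
- have [A hA] := sum_pw_bounded a1.
  exists (2 `^ a * A + (2 * a - 1)^-1) => n N n0.
  apply: (le_trans (split n N n0)); rewrite [leRHS]mulrDl; apply: lerD.
    by rewrite -[leRHS]mulrAC ler_wpM2l ?mulr_ge0 ?powR_ge0.
  rewrite ler_wpM2l ?invr_ge0 ?(ltW g0)//; apply: ler_powR; first by rewrite ler1n.
  by lra.
- subst a.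
  (* [ln 2] is the least value of ln(n + 1) for n >= 1; dividing by it absorbs the additive
     constants into the logarithm. *)
  have l2 : 0 < ln 2 :> R by rewrite ln_gt0// ltr1n.
  exists (2 `^ 1 * ((ln 2)^-1 + 1) + (ln 2)^-1) => n N n0.
  apply: (le_trans (split n N n0)).
  have n1 : (1 : R) <= n%:R by rewrite ler1n.
  have ln2n : ln 2 <= ln (n%:R + 1) :> R by rewrite ler_ln ?posrE//; lra.
  have lnn : ln n%:R <= ln (n%:R + 1) :> R by rewrite ler_ln ?posrE//; lra.
  have e1 : 1 <= (ln 2)^-1 * ln (n%:R + 1) :> R by rewrite mulrC ler_pdivlMr// mul1r.
  have -> : 1 - 2 * 1 = - 1 :> R by ring.
  have -> : (2 * 1 - 1)^-1 = 1 :> R by rewrite mulr1 -[2]/(1 + 1) addrK invr1.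
  rewrite powR_inv1 ?ler0n// mul1r [leRHS]mulrDl; apply: lerD.
    rewrite -mulrA [leRHS]mulrA -[leRHS]mulrA -[leRHS]mulrA ler_wpM2l ?powR_ge0//.
    rewrite mulrC [leRHS]mulrA ler_wpM2r ?invr_ge0 ?ler0n//.
    apply: (le_trans (harmonic_ln n0)); rewrite [leRHS]mulrDl; apply: lerD => //.
    by rewrite mul1r.
  by rewrite mulrA -[leLHS]mul1r ler_wpM2r ?invr_ge0 ?ler0n.
Qed.

End rates.

Section integer_sums.
Variable R : realType.

Lemma sum_uniq_nat_le (v : nat -> R) (S : R) (s : seq nat) : (forall m, 0 <= v m) ->
  (forall N, \sum_(0 <= m < N) v m <= S) -> uniq s -> \sum_(m <- s) v m <= S.
Proof.
move=> v0 hS us; apply: le_trans (hS (\max_(i <- s) i).+1).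
rewrite [leRHS](bigID (mem s))/= [X in _ <= X + _](_ : _ = \sum_(m <- s) v m).
  by rewrite lerDl sumr_ge0.
rewrite -big_filter; apply: perm_big; apply: uniq_perm => //.
  by rewrite filter_uniq// iota_uniq.
move=> i; rewrite mem_filter mem_index_iota/=; case: (boolP (i \in s)) => //= si.
by rewrite ltnS; apply: (@leq_bigmax_seq nat s xpredT (fun i => i) i si isT).
Qed.

Lemma sum_uniq_int_le (v : nat -> R) (S : R) (s : seq int) : (forall m, 0 <= v m) ->
  (forall N, \sum_(0 <= m < N) v m <= S) -> uniq s -> \sum_(j <- s) v `|j|%N <= 2 * S.
Proof.
move=> v0 hS us; rewrite (bigID (fun j => 0 <= j))/= mulr2n mulrDl !mul1r; apply: lerD.
  rewrite -big_filter -(big_map absz xpredT v); apply: sum_uniq_nat_le => //.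
  rewrite map_inj_in_uniq ?filter_uniq// => i j.
  by rewrite !mem_filter => /andP[i0 _] /andP[j0 _]; lia.
rewrite -big_filter -(big_map absz xpredT v); apply: sum_uniq_nat_le => //.
rewrite map_inj_in_uniq ?filter_uniq// => i j.
by rewrite !mem_filter => /andP[i0 _] /andP[j0 _]; lia.
Qed.

(** Each slice is indexed injectively by integers, among which every absolute value occurs at most
    twice; the factors 2^-(k+1) add up to at most 1. *)
Lemma sum_slices_le (jj : nat -> int) (kk : nat -> nat) (v : nat -> R) (S : R) (s : seq nat) :
  injective (fun i => (jj i, kk i)) -> (forall m, 0 <= v m) ->
  (forall N, \sum_(0 <= m < N) v m <= S) -> uniq s ->
  \sum_(i <- s) 2^-1 ^+ (kk i).+1 * v `|jj i|%N <= 2 * S.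
Proof.
move=> inj v0 hS us.
have S0 : 0 <= S by have := hS 0%N; rewrite big_geq.
have [K hK] : exists K, forall i, i \in s -> (kk i < K)%N.
  exists (\max_(i <- s) kk i).+1 => i iA; rewrite ltnS.
  exact: (@leq_bigmax_seq nat s xpredT kk i iA isT).
rewrite big_seq (eq_bigr (fun i => \sum_(k < K | kk i == k) 2^-1 ^+ k.+1 * v `|jj i|%N)); last first.
  by move=> i si; rewrite (big_pred1 (Ordinal (hK i si)))// => k; rewrite -val_eqE eq_sym.
rewrite (exchange_big_dep predT)//=.
apply: (@le_trans _ _ (\sum_(k < K) 2^-1 ^+ k.+1 * (2 * S))).
  apply: ler_sum => k _; rewrite -mulr_sumr ler_wpM2l ?half_pow_ge0//.
  rewrite -big_seq_cond -big_filter -(big_map jj xpredT (fun j => v `|j|%N)).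
  apply: sum_uniq_int_le => //; rewrite map_inj_in_uniq ?filter_uniq// => i j.
  rewrite !mem_filter => /andP[/eqP ki _] /andP[/eqP kj _] e; apply: inj.
  by rewrite e ki kj.
by rewrite -mulr_suml sum_half_pow ler_piMl ?mulr_ge0// gerBl half_pow_ge0.
Qed.

(* One of [j], [j + n] has absolute value at least [n / 2]. *)
Lemma pw_shift_mul (a : R) (n : nat) (j : int) : 0 < a -> (0 < n)%N ->
  pw a (absz (j + n%:Z)) * pw a (absz j) <= pw_min a n (absz (j + n%:Z)) + pw_min a n (absz j).
Proof.
move=> a0 n0; have p0 m : 0 <= pw_min a n m by exact: pw_min_ge0.
have small m : (n <= m.*2)%N -> pw a m <= 2 `^ a * n%:R `^ (- a).
  move=> nm; have n0' : (0 : R) < n%:R by rewrite ltr0n.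
  rewrite /pw !powRN -[leRHS]invrK lef_pV2 ?posrE ?invr_gt0 ?mulr_gt0 ?invr_gt0 ?powR_gt0//.
  rewrite invfM invrK ler_pdivrMl ?powR_gt0// -powRM//.
  apply: ge0_ler_powR; rewrite ?nnegrE ?(ltW a0) ?mulr_ge0 ?ler0n//.
  by rewrite -natrM ler_nat; lia.
have mono m m' : (m <= m')%N -> pw a m' <= pw a m.
  move=> mm; rewrite /pw !powRN lef_pV2 ?posrE ?powR_gt0//.
  by apply: ge0_ler_powR; rewrite ?nnegrE ?(ltW a0) ?ler0n// ler_nat.
case: (leqP `|j|%N (absz (j + n%:Z))) => h.
  rewrite (@le_trans _ _ (pw_min a n (absz j))) ?lerDr// mulrC ler_wpM2l ?pw_ge0// le_min.
  by rewrite mono//= small//; lia.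
rewrite (@le_trans _ _ (pw_min a n (absz (j + n%:Z)))) ?lerDl// ler_wpM2l ?pw_ge0// le_min.
by rewrite mono ?(ltnW h)//= small//; lia.
Qed.

End integer_sums.

(** * Gaussian smoothing *)

Section gaussian.
Variable R : realType.
Implicit Types (f g h : R -> R) (c M A : R).
Notation mu := (@lebesgue_measure R).

Definition gauss (z : R) : R := normal_pdf 0 1 z.

Lemma gauss_ge0 z : 0 <= gauss z. Proof. exact: normal_pdf_ge0. Qed.

Lemma measurable_gauss : measurable_fun setT gauss.
Proof. exact: measurable_normal_pdf. Qed.

Lemma continuous_gauss : continuous gauss.
Proof. by apply: continuous_normal_pdf; rewrite oner_neq0. Qed.

Lemma gaussE z : gauss z = normal_peak 1 * expR (- z ^+ 2 / 2).
Proof. by rewrite /gauss normal_pdfE ?oner_neq0// /normal_fun subr0 expr1n. Qed.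

(** A class of integrands closed under linear operations and containing the powers and, for small
    shifts, the density ratios [tilt]; on it [gmean] is linear. *)
Definition exp_growth (f : R -> R) :=
  measurable_fun setT f /\ exists2 A, 0 <= A & forall z, `|f z| <= A * expR `|z|.

Lemma gauss_expR (m z : R) : gauss z * expR (m * z) = expR (m ^+ 2 / 2) * normal_pdf m 1 z.
Proof.
rewrite gaussE normal_pdfE ?oner_neq0// /normal_fun expr1n -mulrA -expRD mulrCA -expRD.
by congr (_ * expR _); field.
Qed.

(** exp |z| <= exp z + exp(-z), and by [gauss_expR] each term gives a multiple of a shifted normal
    density. *)
Lemma integrable_gauss_expR : mu.-integrable setT (EFin \o (fun z => expR `|z| * gauss z)).
Proof.
have i m : mu.-integrable setT (EFin \o (fun z => expR (m ^+ 2 / 2) * normal_pdf m 1 z)).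
  apply: (eq_integrable measurableT _ _ _ (integrableZl measurableT (expR (m ^+ 2 / 2)) (integrable_normal_pdf m 1))) => z _ /=.
  by rewrite EFinM.
apply: (le_integrable measurableT _ _ (integrableD measurableT (i 1) (i (-1)))).
  apply/measurable_EFinP; apply: measurable_funM; last exact: measurable_gauss.
  by apply: measurableT_comp => //; exact: measurableT_comp.
move=> z _; rewrite /= lee_fin -!gauss_expR mul1r mulN1r -mulrDr mulrC.
rewrite ger0_norm ?mulr_ge0 ?gauss_ge0 ?expR_ge0// (le_trans _ (ler_norm _))//.
rewrite ler_wpM2l ?gauss_ge0//; have [z0|z0] := leP 0 z.
  by rewrite (ger0_norm z0) lerDl expR_ge0.
by rewrite (ltr0_norm z0) lerDr expR_ge0.
Qed.

Lemma exp_growth_integrable f : exp_growth f -> mu.-integrable setT (EFin \o (fun z => f z * gauss z)).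
Proof.
move=> [mf [A A0 hA]].
have i : mu.-integrable setT (EFin \o (fun z => A * (expR `|z| * gauss z))).
  apply: (eq_integrable measurableT _ _ _ (integrableZl measurableT A integrable_gauss_expR)) => z _ /=.
  by rewrite EFinM.
apply: (le_integrable measurableT _ _ i).
  by apply/measurable_EFinP; apply: measurable_funM => //; exact: measurable_gauss.
move=> z _; rewrite /= lee_fin normrM (ger0_norm (gauss_ge0 z)) (le_trans _ (ler_norm _))//.
by rewrite mulrA ler_wpM2r ?gauss_ge0.
Qed.

Definition gmean (f : R -> R) : R := Rintegral mu setT (fun z => f z * gauss z).

Lemma exp_growth_bounded f M : measurable_fun setT f -> (forall z, `|f z| <= M) -> exp_growth f.
Proof.
move=> mf hM; split=> //; exists M; first exact: le_trans (normr_ge0 (f 0)) (hM 0).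
by move=> z; rewrite (le_trans (hM z))// ler_peMr ?(le_trans _ (hM z))// -expR0 ler_expR.
Qed.

Lemma exp_growth_cst c : exp_growth (fun=> c).
Proof. by apply: (@exp_growth_bounded _ `|c|). Qed.

Lemma exp_growthD f g : exp_growth f -> exp_growth g -> exp_growth (fun z => f z + g z).
Proof.
move=> [mf [A A0 hA]] [mg [B B0 hB]]; split; first exact: measurable_funD.
exists (A + B); first exact: addr_ge0.
by move=> z; rewrite (le_trans (ler_normD _ _))// mulrDl lerD.
Qed.

Lemma exp_growthZ c f : exp_growth f -> exp_growth (fun z => c * f z).
Proof.
move=> [mf [A A0 hA]]; split; first exact: measurable_funM.
by exists (`|c| * A); [exact: mulr_ge0|move=> z; rewrite normrM -mulrA ler_wpM2l].
Qed.

Lemma exp_growthB f g : exp_growth f -> exp_growth g -> exp_growth (fun z => f z - g z).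
Proof.
move=> ef eg; have := exp_growthD ef (exp_growthZ (-1) eg).
by congr exp_growth; apply/funext => z; rewrite mulN1r.
Qed.

Lemma exp_growth_norm f : exp_growth f -> exp_growth (fun z => `|f z|).
Proof.
move=> [mf [A A0 hA]]; split; first exact: measurableT_comp.
by exists A => // z; rewrite normr_id.
Qed.

Lemma exp_growthX n : exp_growth (fun z => z ^+ n).
Proof.
split; first exact: exprn_measurable.
have [K K0 hK] := pow_le_expR R n; exists K => // z.
rewrite normrX (le_trans (hK _ (normr_ge0 z)))// ler_wpM2l// ler_expR.
by have := normr_ge0 z; lra.
Qed.

Lemma gmeanD f g : exp_growth f -> exp_growth g -> gmean (fun z => f z + g z) = gmean f + gmean g.
Proof.
move=> ef eg; rewrite /gmean -RintegralD//; try exact: exp_growth_integrable.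
by apply: eq_Rintegral => z _; rewrite mulrDl.
Qed.

Lemma gmeanZ c f : exp_growth f -> gmean (fun z => c * f z) = c * gmean f.
Proof.
move=> ef; rewrite /gmean -RintegralZl//; last exact: exp_growth_integrable.
by apply: eq_Rintegral => z _; rewrite mulrA.
Qed.

Lemma gmeanB f g : exp_growth f -> exp_growth g -> gmean (fun z => f z - g z) = gmean f - gmean g.
Proof.
move=> ef eg; rewrite /gmean -RintegralB//; try exact: exp_growth_integrable.
by apply: eq_Rintegral => z _; rewrite mulrBl.
Qed.

Lemma gmean_cst c : gmean (fun=> c) = c.
Proof.
rewrite /gmean RintegralZl//; last exact: integrable_normal_pdf.
by rewrite /Rintegral integral_normal_pdf mulr1.
Qed.

Lemma le_gmean f g : exp_growth f -> exp_growth g -> (forall z, f z <= g z) -> gmean f <= gmean g.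
Proof.
move=> ef eg h; apply: le_Rintegral => //; try exact: exp_growth_integrable.
by move=> z _; rewrite ler_wpM2r ?gauss_ge0.
Qed.

Lemma gmean_norm f : exp_growth f -> `|gmean f| <= gmean (fun z => `|f z|).
Proof.
move=> ef; rewrite ler_norml; have en := exp_growth_norm ef.
rewrite -mulN1r -gmeanZ//; apply/andP; split; apply: le_gmean => //.
- exact: exp_growthZ.
- by move=> z; rewrite mulN1r lerNl -normrN ler_norm.
- by move=> z; rewrite ler_norm.
Qed.

Lemma gmean_ge0 f : (forall z, 0 <= f z) -> 0 <= gmean f.
Proof. by move=> h; apply: Rintegral_ge0 => z _; rewrite mulr_ge0 ?gauss_ge0. Qed.

Lemma gmean_ereal f : exp_growth f -> (gmean f)%:E = (\int[mu]_z (f z * gauss z)%:E)%E.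
Proof. by move=> ef; rewrite fineK//; apply: integrable_fin_num => //; exact: exp_growth_integrable. Qed.

Lemma ge0_integral_oppr (f : R -> \bar R) : measurable_fun setT f -> (forall r, 0 <= f r)%E ->
  (\int[mu]_r f r = \int[mu]_r f (- r)%R)%E.
Proof.
move=> mf f0; transitivity (\int[mu]_(r in (-%R : R -> measurableTypeR R) @^-1` setT) (f \o -%R) r)%E; last by [].
rewrite -ge0_integral_pushforward//=.
by apply: eq_measure_integral => //= A mA _; exact/esym/lebesgue_measureN.
Qed.

Lemma gaussN z : gauss (- z) = gauss z.
Proof. by rewrite !gaussE sqrrN. Qed.

(** Symmetry of the density. The reflection formula is for nonnegative integrands, hence exp |z| is
    added on both sides. *)
Lemma gmean_id : gmean (fun z => z) = 0.
Proof.
have eid : exp_growth (fun z : R => z) by have := exp_growthX 1.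
have eN : exp_growth (fun z : R => - z).
  by have := exp_growthZ (-1) eid; congr exp_growth; apply/funext => z; rewrite mulN1r.
have ee : exp_growth (fun z => expR `|z|).
  split; first by apply: measurableT_comp => //; exact: measurableT_comp.
  by exists 1 => // z; rewrite mul1r ger0_norm ?expR_ge0.
have ep := exp_growthD ee eid; have em := exp_growthD ee eN.
have h : gmean (fun z => expR `|z| + z) = gmean (fun z => expR `|z| + - z).
  apply: EFin_inj; rewrite (gmean_ereal ep) (gmean_ereal em).
  have q (z : R) : 0 <= expR `|z| + z.
    by have := expR_ge1Dx `|z|; have := lerNnormlW (lexx `|z|); lra.
  have mg : measurable_fun setT (fun z : R => ((expR `|z| + z) * gauss z)%:E).
    apply/measurable_EFinP; apply: measurable_funM; last exact: measurable_gauss.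
    by case: ep.
  rewrite ge0_integral_oppr//; last by move=> z; rewrite lee_fin mulr_ge0 ?gauss_ge0.
  by apply: eq_integral => z _; rewrite normrN gaussN.
move: h; rewrite !gmeanD//.
have -> : gmean (fun z => - z) = - gmean (fun z => z).
  by rewrite -mulN1r -gmeanZ//; congr gmean; apply/funext => z; rewrite mulN1r.
lra.
Qed.

End gaussian.

Section gaussian_operator.
Variable R : realType.
Implicit Types (f g h : R -> R) (c K L : R).
Notation mu := (@lebesgue_measure R).

(** [block_sd] divides by this second moment. The mass on [1, 2] suffices, where the integrand is at
    least [gauss 2]. *)
Lemma gmean_sqr_gt0 : 0 < gmean (fun z : R => z ^+ 2).
Proof.
have e2 := exp_growthX R 2.
have k0 : 0 < gauss (2 : R).
  by rewrite gaussE mulr_gt0 ?expR_gt0// normal_peak_gt0// oner_neq0.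
apply: (lt_le_trans k0); rewrite -lee_fin (gmean_ereal e2).
have mg : measurable_fun setT (fun z : R => (z ^+ 2 * gauss z)%:E).
  by apply/measurable_EFinP; apply: measurable_funM; [case: e2|exact: measurable_gauss].
apply: (@le_trans _ _ (\int[mu]_(z in `[1%R, 2%R]) (z ^+ 2 * gauss z)%:E)%E); last first.
  by apply: ge0_subset_integral => // z _; rewrite lee_fin mulr_ge0 ?sqr_ge0 ?gauss_ge0.
apply: (@le_trans _ _ (\int[mu]_(z in `[1%R, 2%R]) (gauss 2)%:E)%E).
  rewrite integral_cst//= lebesgue_measure_itv/= lte_fin ltr1n/= -EFinB.
  by rewrite -EFinM lee_fin (_ : 2 - 1 = 1 :> R) ?mulr1//; ring.
apply: ge0_le_integral => //.
- by move=> z _; rewrite lee_fin gauss_ge0.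
- exact: measurable_funTS.
move=> z /=; rewrite in_itv/= => /andP[z1 z2]; rewrite lee_fin.
have g1 : gauss 2 <= gauss z.
  rewrite !gaussE ler_wpM2l ?normal_peak_ge0// ler_expR.
  by nra.
by rewrite (le_trans g1)// ler_peMl ?gauss_ge0//; nra.
Qed.

Lemma ge0_affine_substitution (G : R -> R) (al be : R) : 0 < al -> continuous G -> (forall x, 0 <= G x) ->
  (\int[mu]_x (G x)%:E = \int[mu]_x (G (al * x + be) * al)%:E)%E.
Proof.
move=> al0 cG G0; pose F x := al * x + be.
have dF (x : R) : is_derive x (1 : R) F al.
  by apply: is_derive_eq; rewrite addr0 /GRing.scale/= mulr1.
have F'E : F^`()%classic = cst al.
  by apply/funext => x; rewrite derive1E; exact: derive_val.
rewrite (@increasing_ge0_integration_by_substitutionT _ F)//.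
- by rewrite F'E.
- by move=> x y xy; rewrite /F ltrD2r ltr_pM2l.
- by rewrite F'E => x; exact: cvg_cst.
- by rewrite F'E; exact: is_cvg_cst.
- by rewrite F'E; exact: is_cvg_cst.
- have h : al * x @[x --> -oo] --> -oo by apply: gt0_cvgMrNy => //; exact: cvg_id.
  apply/cvgrNyPle => A; have /cvgrNyPle/(_ (A - be)) := h.
  by apply: filterS => x; rewrite lerBrDr.
- have h : al * x @[x --> +oo] --> +oo by apply: gt0_cvgMry => //; exact: cvg_id.
  apply/cvgryPge => A; have /cvgryPge/(_ (A - be)) := h.
  by apply: filterS => x; rewrite lerBlDr.
Qed.

Definition lipb h K := (forall x y, `|h x - h y| <= K * `|x - y|) /\ (forall x, `|h x| <= K).

Lemma lipb_continuous h K : lipb h K -> continuous h.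
Proof.
move=> [hl hb] x; have K0 : 0 <= K by exact: le_trans (normr_ge0 _) (hb 0).
apply/cvgrPdist_le => e e0; near=> y.
rewrite (le_trans (hl x y))//; apply: (@le_trans _ _ ((K + 1) * `|x - y|)).
  by rewrite ler_wpM2r// lerDl.
rewrite -ler_pdivlMl; last by rewrite ltr_wpDl.
near: y; apply: cvgr_dist_le => //; rewrite mulr_gt0// invr_gt0 ltr_wpDl.
Unshelve. all: by end_near. Qed.

Lemma lipb_measurable h K : lipb h K -> measurable_fun setT h.
Proof. by move=> /lipb_continuous; exact: continuous_measurable_fun. Qed.

(** The mean of h(x + t Z) with Z standard normal: the heat semigroup, parametrised by the standard
    deviation. *)
Definition gsmooth t h x : R := gmean (fun z => h (x + t * z)).

Lemma measurable_affine x t h : measurable_fun setT h -> measurable_fun setT (fun z : R => h (x + t * z)).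
Proof. by move=> mh; apply: measurableT_comp => //; apply: measurable_funD => //; apply: measurable_funM. Qed.

Lemma lipb_growth h K x t : lipb h K -> exp_growth (fun z => h (x + t * z)).
Proof.
move=> hh; apply: (@exp_growth_bounded _ _ K); last by move=> z; case: hh.
by apply: measurable_affine; exact: lipb_measurable hh.
Qed.

Lemma lipb_gsmooth t h K : lipb h K -> lipb (gsmooth t h) K.
Proof.
move=> hh; have [hl hb] := hh; split=> [x y|x].
  rewrite /gsmooth -gmeanB; try exact: lipb_growth hh.
  have eg : exp_growth (fun z => h (x + t * z) - h (y + t * z)).
    by apply: exp_growthB; exact: lipb_growth hh.
  rewrite (le_trans (gmean_norm eg))// -[leRHS](gmean_cst (K * `|x - y|)).
  apply: le_gmean; [exact: exp_growth_norm|exact: exp_growth_cst|] => z.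
  by rewrite (le_trans (hl _ _))// opprD addrACA subrr addr0.
have eg := lipb_growth x t hh.
rewrite (le_trans (gmean_norm eg))// -[leRHS](gmean_cst K).
by apply: le_gmean; [exact: exp_growth_norm|exact: exp_growth_cst|].
Qed.

(** The Taylor expansion is integrated; its linear term vanishes because the Gaussian is centred. *)
Lemma gsmooth_taylor t h (a b : R) K L x : lipb h L -> 0 <= t ->
  (forall y, `|h (x + y) - h x - a * y - b * y ^+ 2 / 2| <= K * `|y| ^+ 3) ->
  `|gsmooth t h x - h x - b * (t ^+ 2 * gmean (fun z => z ^+ 2)) / 2| <=
  K * (t ^+ 3 * gmean (fun z => `|z| ^+ 3)).
Proof.
move=> hh t0 hT.
have e1 : exp_growth (fun z : R => z) by have := exp_growthX R 1.
have e2 := exp_growthX R 2.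
have e3 : exp_growth (fun z : R => `|z| ^+ 3).
  have := exp_growth_norm (exp_growthX R 3); congr exp_growth; apply/funext => z.
  by rewrite normrX.
pose A z := h (x + t * z); have eA : exp_growth A by exact: lipb_growth hh.
have eh := exp_growth_cst (h x).
have ea : exp_growth (fun z => a * t * z) by exact: exp_growthZ.
have eb : exp_growth (fun z => b * t ^+ 2 / 2 * z ^+ 2) by exact: exp_growthZ.
have -> : gsmooth t h x - h x - b * (t ^+ 2 * gmean (fun z => z ^+ 2)) / 2 =
    gmean (fun z => A z - h x - a * t * z - b * t ^+ 2 / 2 * z ^+ 2).
  rewrite gmeanB//; last by apply: exp_growthB => //; exact: exp_growthB.
  rewrite gmeanB//; last exact: exp_growthB.
  by rewrite gmeanB// !gmeanZ// gmean_cst gmean_id /gsmooth /A; ring.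
have eg : exp_growth (fun z => A z - h x - a * t * z - b * t ^+ 2 / 2 * z ^+ 2).
  by do 3! (apply: exp_growthB => //).
rewrite (le_trans (gmean_norm eg))// [leRHS]mulrA -gmeanZ//.
apply: le_gmean; [exact: exp_growth_norm|exact: exp_growthZ|] => z.
have := hT (t * z); rewrite normrM (ger0_norm t0) exprMn mulrA /A.
by congr (`|_| <= _); field.
Qed.

Lemma gsmooth_lip_time s t h K : lipb h K -> forall x,
  `|gsmooth s h x - gsmooth t h x| <= K * `|s - t| * gmean (fun z => `|z|).
Proof.
move=> hh x; have [hl _] := hh.
have e1 : exp_growth (fun z : R => z) by have := exp_growthX R 1.
have en := exp_growth_norm e1.
rewrite /gsmooth -gmeanB; try exact: lipb_growth hh.
have eg : exp_growth (fun z => h (x + s * z) - h (x + t * z)).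
  by apply: exp_growthB; exact: lipb_growth hh.
rewrite (le_trans (gmean_norm eg))// -gmeanZ//.
apply: le_gmean; [exact: exp_growth_norm|exact: exp_growthZ|] => z.
by rewrite (le_trans (hl _ _))// opprD addrACA subrr add0r -mulrBl normrM mulrA.
Qed.

(* Substituting [z := (r u - s y) / t], with [r^2 = s^2 + t^2], rotates the plane:
   the product of the two densities at [(y, z)] is that at [(u, (r y - s u) / t)]. *)
Lemma gauss_rotation (s t r y u : R) : 0 < t -> r ^+ 2 = s ^+ 2 + t ^+ 2 ->
  gauss ((r * u - s * y) / t) * gauss y = gauss u * gauss ((r * y - s * u) / t).
Proof.
move=> t0 rst; have t0' : t != 0 by rewrite gt_eqF.
rewrite !gaussE mulrACA [RHS]mulrACA -!expRD; congr (_ * expR _).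
apply: (@mulIf _ (2 * t ^+ 2)); first by rewrite mulf_neq0// expf_neq0.
have e1 (c d : R) : (- (c / t) ^+ 2 / 2 + - d ^+ 2 / 2) * (2 * t ^+ 2) = - (c ^+ 2 + d ^+ 2 * t ^+ 2).
  by field.
rewrite /= e1 [X in _ = X * _]addrC e1; have -> : t ^+ 2 = r ^+ 2 - s ^+ 2 by rewrite rst addrAC subrr add0r.
ring.
Qed.

Lemma measurable_fun_pair2 (F : R -> R) (p q w : R) : measurable_fun setT F ->
  measurable_fun [set: R * R] (fun z : R * R => F (p * z.1 + q * z.2 + w)).
Proof.
move=> mF; apply: measurableT_comp => //.
by apply: measurable_funD => //; apply: measurable_funD; apply: measurable_funM.
Qed.

(** A sum of two independent centred Gaussians is Gaussian. The substitution makes the total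
    displacement r u the inner variable, Tonelli exchanges the integrals, and after the rotation the
    integral over [y] is that of a density. The sign of [h] is for Tonelli; [gsmooth_comp] removes
    it by adding a constant. *)
Lemma gsmooth_comp_ge0 s t h K : 0 < s -> 0 < t -> lipb h K -> (forall x, 0 <= h x) -> forall x,
  gsmooth s (gsmooth t h) x = gsmooth (Num.sqrt (s ^+ 2 + t ^+ 2)) h x.
Proof.
move=> s0 t0 hh h0 x; set r := Num.sqrt _.
have st0 : 0 < s ^+ 2 + t ^+ 2 by rewrite addr_gt0 ?exprn_gt0.
have r0 : 0 < r by rewrite sqrtr_gt0.
have rst : r ^+ 2 = s ^+ 2 + t ^+ 2 by rewrite sqr_sqrtr// ltW.
have ch := lipb_continuous hh; have mh := lipb_measurable hh.
apply: EFin_inj; rewrite (gmean_ereal (lipb_growth x s (lipb_gsmooth t hh))).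
rewrite (gmean_ereal (lipb_growth x r hh)).
pose G y u : \bar R := (h (x + r * u) * (gauss ((r * u - s * y) / t) * gauss y * (r / t)))%:E.
have G0 y u : (0 <= G y u)%E.
  rewrite lee_fin; apply: mulr_ge0 => //; apply: mulr_ge0; first by rewrite mulr_ge0 ?gauss_ge0.
  by rewrite divr_ge0 ?(ltW r0) ?(ltW t0).
have inner y : ((gsmooth t h (x + s * y) * gauss y)%:E = \int[mu]_u G y u)%E.
  rewrite EFinM (gmean_ereal (lipb_growth _ t hh)) -ge0_integralZr//; first last.
  - by rewrite lee_fin gauss_ge0.
  - by move=> z _; rewrite lee_fin mulr_ge0 ?gauss_ge0.
  - apply/measurable_EFinP; apply: measurable_funM; last exact: measurable_gauss.
    exact: measurable_affine.
  pose H z := h (x + s * y + t * z) * gauss z * gauss y.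
  transitivity (\int[mu]_z (H z)%:E)%E; first by [].
  rewrite (@ge0_affine_substitution H (r / t) (- (s * y / t))).
  - apply: eq_integral => u _; rewrite /H /G.
    have -> : x + s * y + t * (r / t * u + - (s * y / t)) = x + r * u by field; rewrite gt_eqF.
    have -> : r / t * u + - (s * y / t) = (r * u - s * y) / t by field; rewrite gt_eqF.
    by congr EFin; ring.
  - exact: divr_gt0.
  - move=> z; apply: cvgM; last exact: cvg_cst.
    apply: cvgM; last exact: continuous_gauss.
    apply: continuous_comp; last exact: ch.
    by apply: cvgD; [exact: cvg_cst|apply: cvgM; [exact: cvg_cst|exact: cvg_id]].
  - by move=> z; rewrite !mulr_ge0 ?gauss_ge0.
transitivity (\int[mu]_y \int[mu]_u G y u)%E; first by apply: eq_integral => y _; exact: inner.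
have mG : measurable_fun [set: R * R] (fun z : R * R => G z.1 z.2).
  apply/measurable_EFinP; apply: measurable_funM.
    have := @measurable_fun_pair2 h 0 r x mh.
    by apply: eq_measurable_fun => z _; rewrite mul0r add0r addrC.
  apply: measurable_funM => //; apply: measurable_funM.
    have := @measurable_fun_pair2 (@gauss R) (- s / t) (r / t) 0 (@measurable_gauss R).
    by apply: eq_measurable_fun => z _; congr gauss; field; rewrite gt_eqF.
  have := @measurable_fun_pair2 (@gauss R) 1 0 0 (@measurable_gauss R).
  by apply: eq_measurable_fun => z _; congr gauss; rewrite mul1r mul0r !addr0.
transitivity (\int[mu]_u \int[mu]_y G y u)%E.
  exact: (@fubini_tonelli _ _ (measurableTypeR R) (measurableTypeR R) R lebesgue_measure lebesgue_measure
    (fun z => G z.1 z.2) mG (fun z => G0 z.1 z.2)).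
apply: eq_integral => u _.
transitivity (\int[mu]_y ((h (x + r * u) * gauss u)%:E * (gauss (r / t * y + - (s * u / t)) * (r / t))%:E))%E.
  apply: eq_integral => y _; rewrite /G gauss_rotation// -EFinM.
  have -> : r / t * y + - (s * u / t) = (r * y - s * u) / t by field; rewrite gt_eqF.
  by congr EFin; ring.
rewrite ge0_integralZl//.
- rewrite -(@ge0_affine_substitution (@gauss R) (r / t) (- (s * u / t))) ?divr_gt0//.
  + by rewrite integral_normal_pdf mule1.
  + exact: continuous_gauss.
  + exact: gauss_ge0.
- apply/measurable_EFinP; apply: measurable_funM => //.
  apply: (measurableT_comp (@measurable_gauss R)).
  by apply: measurable_funD => //; apply: measurable_funM.
- by move=> y _; rewrite lee_fin mulr_ge0 ?gauss_ge0// divr_ge0// ltW.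
- by rewrite lee_fin mulr_ge0 ?gauss_ge0.
Qed.

Lemma gsmooth_addc t h K c : lipb h K -> forall x,
  gsmooth t (fun y => h y + c) x = gsmooth t h x + c.
Proof.
move=> hh x; rewrite /gsmooth gmeanD ?gmean_cst//; first exact: lipb_growth hh.
exact: exp_growth_cst.
Qed.

Lemma gsmooth0 h : gsmooth 0 h = h.
Proof.
apply/funext => x; rewrite /gsmooth -[RHS]gmean_cst; congr gmean.
by apply/funext => z; rewrite mul0r addr0.
Qed.

Lemma gsmooth_comp s t h K : 0 <= s -> 0 <= t -> lipb h K ->
  gsmooth s (gsmooth t h) = gsmooth (Num.sqrt (s ^+ 2 + t ^+ 2)) h.
Proof.
rewrite le_eqVlt => /predU1P[<- t0 hh|s0].
  by rewrite gsmooth0 expr0n add0r sqrtr_sqr ger0_norm.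
rewrite le_eqVlt => /predU1P[<- hh|t0 hh].
  by rewrite gsmooth0 expr0n addr0 sqrtr_sqr ger0_norm// ltW.
apply/funext => x; have [hl hb] := hh.
have K0 : 0 <= K by exact: le_trans (normr_ge0 _) (hb 0).
have hK : lipb (fun y => h y + K) (K + K).
  split=> [y z|y].
    rewrite opprD addrACA subrr addr0 (le_trans (hl y z))// ler_wpM2r// lerDl//.
  by rewrite (le_trans (ler_normD _ _))// (ger0_norm K0) lerD2r.
have := gsmooth_comp_ge0 s0 t0 hK _ x.
rewrite (gsmooth_addc _ _ hh) (_ : gsmooth t (fun y => h y + K) = fun y => gsmooth t h y + K); last first.
  by apply/funext => y; rewrite (gsmooth_addc _ _ hh).
rewrite (gsmooth_addc _ _ (lipb_gsmooth t hh)) => /(_ _)/addIr; apply => y.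
by have := hb y; rewrite ler_norml => /andP[h1 _]; rewrite -lerBlDr sub0r.
Qed.

Lemma iter_gsmooth t h K n : 0 <= t -> lipb h K ->
  iter n (gsmooth t) h = gsmooth (t * Num.sqrt n%:R) h.
Proof.
move=> t0 hh; elim: n => [|n ih]; first by rewrite sqrtr0 mulr0 gsmooth0.
rewrite iterS ih (gsmooth_comp _ _ hh)// ?mulr_ge0 ?sqrtr_ge0//; congr (gsmooth _ h).
rewrite exprMn sqr_sqrtr//; have -> : t ^+ 2 + t ^+ 2 * n%:R = t ^+ 2 * n.+1%:R by rewrite -natr1; ring.
by rewrite sqrtrM ?sqr_ge0// sqrtr_sqr ger0_norm.
Qed.

End gaussian_operator.

Section exponential_remainder.
Variable R : realType.

(** One integration of the bound. Starting from exp w - 1, repeated use gives the Taylor remainders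
    of the exponential, without the factorials. *)
Lemma MVT_pow_expR (F G : R -> R) k : (forall x : R, is_derive x (1 : R) F (G x)) -> F 0 = 0 ->
  (forall w, `|G w| <= `|w| ^+ k * expR `|w|) -> forall w, `|F w| <= `|w| ^+ k.+1 * expR `|w|.
Proof.
move=> dF F0 hG w.
have cF : forall a b : R, {within `[a, b], continuous F}.
  move=> a b; apply: continuous_subspaceT => x.
  by apply/differentiable_continuous/derivable1_diffP; case: (dF x).
have key c : `|c| <= `|w| -> `|G c| * `|w| <= `|w| ^+ k.+1 * expR `|w|.
  move=> cw; rewrite exprS mulrC -mulrA ler_wpM2l// (le_trans (hG c))//.
  by apply: ler_pM; rewrite ?exprn_ge0 ?expR_ge0 ?ler_expR// lerXn2r ?nnegrE.
have [w0|w0] := leP 0 w.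
  have [c] := MVT_segment w0 (fun x _ => dF x) (cF 0 w).
  rewrite in_itv/= => /andP[c0 cw]; rewrite F0 !subr0 => ->.
  by rewrite normrM key// !ger0_norm.
have [c] := MVT_segment (ltW w0) (fun x _ => dF x) (cF w 0).
rewrite in_itv/= => /andP[cw c0]; rewrite F0 !sub0r => /eqP; rewrite eqr_oppLR => /eqP ->.
rewrite normrN normrM normrN key// !ler0_norm ?(ltW w0)//.
by rewrite lerN2.
Qed.

Lemma expR_remainder1 (w : R) : `|expR w - 1| <= `|w| * expR `|w|.
Proof.
have h1 := expR_ge1Dx w; have h2 := expR_ge1Dx (- w).
have e : expR w * expR (- w) = 1 by rewrite -expRD subrr expR0.
have p := expR_gt0 w.
have u : expR w - 1 <= w * expR w by nra.
have [w0|w0] := leP 0 w.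
  rewrite (ger0_norm w0) ger0_norm//.
  by rewrite subr_ge0 -expR0 ler_expR.
have p1 : 1 <= expR (- w) by rewrite -expR0 ler_expR; lra.
rewrite (ltr0_norm w0) ler0_norm; last by rewrite subr_le0 -expR0 ler_expR ltW.
nra.
Qed.

Lemma expR_remainder2 (w : R) : `|expR w - 1 - w| <= `|w| ^+ 2 * expR `|w|.
Proof.
apply: (@MVT_pow_expR (fun w => expR w - 1 - w) (fun w => expR w - 1) 1).
- by move=> x; apply: is_derive_eq; rewrite ?(subr0, addr0, oppr0).
- by rewrite expR0 subrr subr0.
- by move=> v; rewrite expr1; exact: expR_remainder1.
Qed.

Lemma expR_remainder3 (w : R) : `|expR w - 1 - w - w ^+ 2 / 2| <= `|w| ^+ 3 * expR `|w|.
Proof.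
apply: (@MVT_pow_expR (fun w => expR w - 1 - w - w ^+ 2 / 2) (fun w => expR w - 1 - w) 2).
- move=> x; apply: is_derive_eq; rewrite ?(subr0, addr0, oppr0)//.
  by rewrite /GRing.scale/=; field.
- by rewrite expR0 expr0n mul0r subrr !subr0.
- exact: expR_remainder2.
Qed.

End exponential_remainder.

(** * Taylor expansion of Gaussian averages *)

Section gaussian_regularity.
Variable R : realType.
Implicit Types (h : R -> R) (K L M : R).
Notation mu := (@lebesgue_measure R).

(** The density of the normal law of mean [d] with respect to the standard one (Cameron-Martin). *)
Definition tilt (d z : R) := expR (d * z - d ^+ 2 / 2).

Lemma gauss_shift d z : gauss (z - d) = gauss z * tilt d z.
Proof. by rewrite !gaussE -mulrA -expRD; congr (_ * expR _); field. Qed.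

Lemma tilt_growth d : `|d| <= 1 -> exp_growth (tilt d).
Proof.
move=> d1; split.
  apply: measurableT_comp => //; apply: measurable_funB => //.
exists 1 => // z; rewrite mul1r ger0_norm ?expR_ge0// ler_expR.
have := ler_norm (d * z); rewrite normrM.
have := normr_ge0 z; have := sqr_ge0 d; nra.
Qed.

Lemma tilt_mul_growth d h L x t : `|d| <= 1 -> lipb h L -> exp_growth (fun z => h (x + t * z) * tilt d z).
Proof.
move=> d1 hh; have [mt [A A0 hA]] := tilt_growth d1; have [mg _] := lipb_growth x t hh.
have [_ hb] := hh; have L0 : 0 <= L by exact: le_trans (normr_ge0 _) (hb 0).
split; first exact: measurable_funM.
exists (L * A); first exact: mulr_ge0.
by move=> z; rewrite normrM -mulrA; apply: ler_pM.
Qed.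

(** The translation is transferred from [h] to the Gaussian density, so that smoothness in [y] comes
    from the density. *)
Lemma gsmooth_shift_ge0 t h L x y : 0 < t -> `|y / t| <= 1 -> lipb h L -> (forall x, 0 <= h x) ->
  gsmooth t h (x + y) = gmean (fun z => h (x + t * z) * tilt (y / t) z).
Proof.
move=> t0 d1 hh h0; set d := y / t.
apply: EFin_inj; rewrite (gmean_ereal (lipb_growth _ t hh)) (gmean_ereal (tilt_mul_growth _ _ d1 hh)).
pose H z := h (x + y + t * z) * gauss z.
transitivity (\int[mu]_z (H z)%:E)%E; first by [].
rewrite (@ge0_affine_substitution _ H 1 (- d))//.
- apply: eq_integral => z _; congr EFin; rewrite /H mul1r mulr1 gauss_shift.
  have -> : x + y + t * (z - d) = x + t * z by rewrite /d; field; rewrite gt_eqF.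
  ring.
- move=> z; apply: cvgM; last exact: continuous_gauss.
  apply: continuous_comp; last exact: lipb_continuous hh _.
  by apply: cvgD; [exact: cvg_cst|apply: cvgM; [exact: cvg_cst|exact: cvg_id]].
- by move=> z; rewrite mulr_ge0 ?gauss_ge0.
Qed.

Lemma gsmooth_shift t h L x y : 0 < t -> `|y / t| <= 1 -> lipb h L ->
  gsmooth t h (x + y) = gmean (fun z => h (x + t * z) * tilt (y / t) z).
Proof.
move=> t0 d1 hh; have [hl hb] := hh.
have L0 : 0 <= L by exact: le_trans (normr_ge0 _) (hb 0).
have lL : lipb (fun=> L) L.
  by split=> [u v|u]; [rewrite subrr normr0 mulr_ge0|rewrite ger0_norm].
have hL : lipb (fun u => h u + L) (L + L).
  split=> [u v|u].
    by rewrite opprD addrACA subrr addr0 (le_trans (hl u v))// ler_wpM2r// lerDl.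
  by rewrite (le_trans (ler_normD _ _))// (ger0_norm L0) lerD2r.
have h1 := gsmooth_shift_ge0 x t0 d1 lL (fun=> L0).
have h2 : gsmooth t (fun u => h u + L) (x + y) = gmean (fun z => (h (x + t * z) + L) * tilt (y / t) z).
  apply: (gsmooth_shift_ge0 x t0 d1 hL) => u.
  by have := hb u; rewrite ler_norml => /andP[? _]; rewrite -lerBlDr sub0r.
apply: (@addIr _ (gsmooth t (fun=> L) (x + y))).
rewrite [in LHS]/gsmooth gmean_cst -(gsmooth_addc t L hh) h2 h1 -gmeanD.
- by congr gmean; apply/funext => z; rewrite mulrDl.
- exact: tilt_mul_growth hh.
- exact: (tilt_mul_growth x t d1 lL).
Qed.

(** Second order expansion in [d], with the Hermite polynomials 1, z, z^2 - 1 as coefficients. The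
    exponent is w = d z - d^2 / 2, and the part of w^2 / 2 of order at least three in [d] joins the
    remainder. *)
Lemma tilt_remainder : exists2 C, 0 <= C & forall d z : R, `|d| <= 2^-1 ->
  `|tilt d z - 1 - d * z - d ^+ 2 * (z ^+ 2 - 1) / 2| <= C * `|d| ^+ 3 * expR `|z|.
Proof.
have [K K0 hK] := pow_le_expR R 3.
exists (2 + K * expR 1); first by rewrite addr_ge0// mulr_ge0// expR_ge0.
move=> d z d1; pose w := d * z - d ^+ 2 / 2.
have d0 := normr_ge0 d; have z0 := normr_ge0 z.
have dd : d ^+ 2 = `|d| ^+ 2 by rewrite real_normK ?num_real.
have wd : `|w| <= `|d| * (`|z| + 1).
  rewrite (le_trans (ler_normB _ _))// normrM [`|d ^+ 2 / 2|]ger0_norm; last first.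
    by rewrite divr_ge0// sqr_ge0.
  by rewrite dd; nra.
have e1 : tilt d z - 1 - d * z - d ^+ 2 * (z ^+ 2 - 1) / 2 =
    (expR w - 1 - w - w ^+ 2 / 2) + (- (d ^+ 3 * z / 2) + d ^+ 4 / 8).
  by rewrite /tilt -/w; set E := expR w; rewrite /w; field.
rewrite e1 (le_trans (ler_normD _ _))// addrC [_ * _ * expR _]mulrAC mulrDl mulrDl; apply: lerD.
  have ez := expR_ge1Dx `|z|; rewrite (le_trans (ler_normD _ _))// normrN.
  have -> : `|d ^+ 4 / 8| = `|d| ^+ 4 / 8 by rewrite normrM normrX [`|8^-1|]ger0_norm.
  have -> : `|d ^+ 3 * z / 2| = `|d| ^+ 3 * `|z| / 2 by rewrite normrM normrM normrX [`|2^-1|]ger0_norm.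
  have d3 : 0 <= `|d| ^+ 3 by exact: exprn_ge0.
  have -> : `|d| ^+ 4 = `|d| ^+ 3 * `|d| by rewrite exprSr.
  apply: (@le_trans _ _ (`|d| ^+ 3 * (`|z| + 1))); first by nra.
  by nra.
rewrite (le_trans (expR_remainder3 w))//.
apply: (@le_trans _ _ ((`|d| * (`|z| + 1)) ^+ 3 * expR ((`|z| + 1) / 2))).
  apply: ler_pM; rewrite ?exprn_ge0 ?expR_ge0//.
    by rewrite lerXn2r ?nnegrE// mulr_ge0// addr_ge0.
  by rewrite ler_expR; nra.
have d3 : 0 <= `|d| ^+ 3 by exact: exprn_ge0.
rewrite exprMn; set zz := (`|z| + 1) ^+ 3; set E2 := expR (_ / 2).
rewrite [leRHS](_ : _ = `|d| ^+ 3 * (K * (expR 1 * expR `|z|))); last by ring.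
rewrite -(mulrA (`|d| ^+ 3)) ler_wpM2l//.
have := hK (`|z| + 1); rewrite addr_ge0// => /(_ isT) h3.
apply: (@le_trans _ _ (K * expR ((`|z| + 1) / 8) * expR ((`|z| + 1) / 2))).
  by rewrite ler_wpM2r ?expR_ge0.
rewrite -(mulrA K) ler_wpM2l// /E2 -!expRD ler_expR; lra.
Qed.

(** The constant depends on [t] and on the bound [M], not on the Lipschitz constant of [h]: this
    uniformity serves along the iterates in Lindeberg's argument. *)
Lemma gsmooth_taylor_exists t M : 0 < t -> 0 <= M -> exists2 K, 0 <= K & forall h L x,
  lipb h L -> (forall u, `|h u| <= M) -> exists a b, forall y,
  `|gsmooth t h (x + y) - gsmooth t h x - a * y - b * y ^+ 2 / 2| <= K * `|y| ^+ 3.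
Proof.
move=> t0 M0; have [C C0 hC] := tilt_remainder.
have ee : exp_growth (fun z : R => expR `|z|).
  split; first by apply: measurableT_comp => //; exact: measurableT_comp.
  by exists 1 => // z; rewrite mul1r ger0_norm ?expR_ge0.
pose m := gmean (fun z : R => expR `|z|).
have m0 : 0 <= m by apply: gmean_ge0 => z; exact: expR_ge0.
have e1 : exp_growth (fun z : R => `|z|) by have := exp_growth_norm (exp_growthX R 1).
have e2 := exp_growthX R 2.
pose m1 := gmean (fun z : R => `|z|); have m10 : 0 <= m1 by apply: gmean_ge0.
pose m2 := gmean (fun z : R => z ^+ 2 + 1); have m20 : 0 <= m2.
  by apply: gmean_ge0 => z; rewrite addr_ge0// sqr_ge0.
(* The first term serves |d| <= 1/2, where [tilt_remainder] applies. The others serve |d| > 1/2,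
   where each term of the expansion is at most a multiple of |d|^3 because 1 <= 8 |d|^3. *)
pose K' := M * C * m + 16 * M + 4 * M * m1 + M * m2.
have K'0 : 0 <= K' by rewrite /K' !addr_ge0// ?mulr_ge0.
exists (K' / t ^+ 3); first by rewrite divr_ge0// exprn_ge0// ltW.
move=> h L x hh hM; have [mh _] := lipb_growth x t hh.
have hg q : exp_growth q -> exp_growth (fun z => h (x + t * z) * q z).
  move=> [mq [A A0 hA]]; split; first exact: measurable_funM.
  exists (M * A); first exact: mulr_ge0.
  by move=> z; rewrite normrM -mulrA; apply: ler_pM.
have eid : exp_growth (fun z : R => z) by have := exp_growthX R 1.
have eq2 : exp_growth (fun z : R => z ^+ 2 - 1) by apply: exp_growthB => //; exact: exp_growth_cst.
pose a0 := gmean (fun z => h (x + t * z) * z).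
pose b0 := gmean (fun z => h (x + t * z) * (z ^+ 2 - 1)).
exists (a0 / t), (b0 / t ^+ 2) => y.
pose d := y / t.
have bnd q Q : exp_growth q -> exp_growth Q -> (forall z, `|q z| <= Q z) ->
    `|gmean (fun z => h (x + t * z) * q z)| <= M * gmean Q.
  move=> eq eQ qQ; rewrite (le_trans (gmean_norm (hg _ eq)))// -gmeanZ//.
  apply: le_gmean; [exact: exp_growth_norm (hg _ eq)|exact: exp_growthZ|] => z.
  by rewrite normrM; apply: ler_pM.
have yt3 : `|d| ^+ 3 = `|y| ^+ 3 / t ^+ 3.
  by rewrite /d normrM normfV (gtr0_norm t0) exprMn exprVn.
have -> : K' / t ^+ 3 * `|y| ^+ 3 = K' * `|d| ^+ 3 by rewrite yt3; ring.
have -> : a0 / t * y = d * a0 by rewrite /d; ring.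
have -> : b0 / t ^+ 2 * y ^+ 2 / 2 = d ^+ 2 / 2 * b0 by rewrite /d; field; rewrite gt_eqF.
have d30 : 0 <= `|d| ^+ 3 by exact: exprn_ge0.
have [d2|d2] := leP `|d| 2^-1.
  have d1 : `|d| <= 1 by lra.
  have et := tilt_growth d1.
  rewrite (gsmooth_shift x t0 d1 hh) -/d /gsmooth.
  have -> : gmean (fun z => h (x + t * z) * tilt d z) - gmean (fun z => h (x + t * z)) -
      d * a0 - d ^+ 2 / 2 * b0 =
      gmean (fun z => h (x + t * z) * (tilt d z - 1 - d * z - d ^+ 2 * (z ^+ 2 - 1) / 2)).
    rewrite -!gmeanZ; [|exact: hg|exact: hg].
    have g1 := hg _ et; have g2 := lipb_growth x t hh.
    have g3 := exp_growthZ d (hg _ eid); have g4 := exp_growthZ (d ^+ 2 / 2) (hg _ eq2).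
    rewrite -gmeanB// -gmeanB//; last exact: exp_growthB.
    rewrite -gmeanB//; last by apply: exp_growthB => //; exact: exp_growthB.
    by congr gmean; apply/funext => z; field.
  have er : exp_growth (fun z => tilt d z - 1 - d * z - d ^+ 2 * (z ^+ 2 - 1) / 2).
    apply: exp_growthB.
      apply: exp_growthB; last exact: exp_growthZ.
      by apply: exp_growthB => //; exact: exp_growth_cst.
    by have := exp_growthZ (d ^+ 2 / 2) eq2; congr exp_growth; apply/funext => z; field.
  apply: (le_trans (bnd _ _ er (exp_growthZ (C * `|d| ^+ 3) ee) (fun z => hC d z d2))).
  rewrite gmeanZ// -/m (_ : M * (C * `|d| ^+ 3 * m) = M * C * m * `|d| ^+ 3); last by ring.
  by rewrite ler_wpM2r// /K' -!addrA lerDl !addr_ge0// ?mulr_ge0.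
have gb u : `|gsmooth t h u| <= M.
  have eg := lipb_growth u t hh.
  rewrite (le_trans (gmean_norm eg))// -[leRHS](@gmean_cst R M).
  by apply: le_gmean; [exact: exp_growth_norm|exact: exp_growth_cst|].
have ha : `|a0| <= M * m1 by exact: (bnd _ _ eid e1).
have hb : `|b0| <= M * m2.
  apply: (bnd _ _ eq2); first by apply: exp_growthD => //; exact: exp_growth_cst.
  by move=> z; rewrite (le_trans (ler_normB _ _))// normr1 ger0_norm ?sqr_ge0.
rewrite (le_trans (ler_normB _ _))// (le_trans (lerD (ler_normB _ _) (lexx _)))//.
rewrite (le_trans (lerD (lerD (ler_normB _ _) (lexx _)) (lexx _)))//.
have q1 := gb (x + y); have q2 := gb x.
rewrite (normrM d a0); have -> : `|d ^+ 2 / 2 * b0| = `|d| ^+ 2 / 2 * `|b0|.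
  by rewrite normrM normrM normrX [`|2^-1|]ger0_norm.
move: ha hb q1 q2 d2 d30; set D := `|d|; set A := `|a0|; set B := `|b0| => ha hb q1 q2 d2 d30.
have D0 : 0 < D by lra.
have D1 : 1 <= 8 * D ^+ 3.
  have -> : 8 * D ^+ 3 = (2 * D) ^+ 3 by ring.
  by rewrite exprn_ege1//; lra.
have D2 : D <= 4 * D ^+ 3.
  have : 1 <= 4 * D ^+ 2 by rewrite (_ : 4 * D ^+ 2 = (2 * D) ^+ 2) ?exprn_ege1//; [lra|ring].
  by rewrite exprS; nra.
have D3 : D ^+ 2 / 2 <= D ^+ 3 by rewrite [D ^+ 3]exprS; have := sqr_ge0 D; nra.
have h1 : D * A <= 4 * D ^+ 3 * (M * m1) by apply: ler_pM => //; [exact: ltW|exact: normr_ge0].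
have h2 : D ^+ 2 / 2 * B <= D ^+ 3 * (M * m2).
  by apply: ler_pM => //; [rewrite divr_ge0// sqr_ge0|exact: normr_ge0].
have h3 : M <= M * (8 * D ^+ 3) by rewrite ler_peMr.
have h4 : 0 <= M * C * m * D ^+ 3 by rewrite mulr_ge0// mulr_ge0// mulr_ge0.
have -> : K' * D ^+ 3 = M * C * m * D ^+ 3 + 2 * (M * (8 * D ^+ 3)) + 4 * D ^+ 3 * (M * m1) + D ^+ 3 * (M * m2).
  by rewrite /K'; ring.
by lra.
Qed.

End gaussian_regularity.

(** * Smooth test functions for convergence in distribution *)

Section lipschitz_approximation.
Variable R : realType.
Implicit Types (h : R -> R) (K L M : R).

(** Only [x] is confined to the segment; [y] may leave it, as the supremum over the whole line in
    [lipschitz_approx] requires. *)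
Lemma continuous_unif_on_segment h K eta : continuous h -> 0 < eta ->
  exists2 d, 0 < d & forall x y, `|x| <= K -> `|x - y| < d -> `|h x - h y| <= eta.
Proof.
move=> ch e0.
have /compact_near_coveringP cov := @segment_compact R (- K) K.
have [d /= d0 hd] : \forall d \near 0^'+, `[- K, K]%classic `<=`
    [set x | forall y, `|x - y| < d -> `|h x - h y| <= eta].
  apply: cov => x _.
  have e2 : 0 < eta / 2 by rewrite divr_gt0.
  have /cvgrPdist_le/(_ _ e2)/nbhs_ballP[r /= r0 hr] := ch x.
  have r2 : 0 < r / 2 by rewrite divr_gt0.
  exists (ball x (r / 2), [set d | d < r / 2]).
    split=> /=; first exact: nbhsx_ballx.
    exact: nbhs_right_lt.
  move=> [x' d] /= [xx' dr] y xy.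
  have h1 : `|h x - h x'| <= eta / 2.
    by apply: hr; apply: le_ball xx'; rewrite ler_pdivrMr//; lra.
  have h2 : `|h x - h y| <= eta / 2.
    apply: hr; rewrite [r]splitr; apply: ball_triangle xx' _.
    by rewrite -ball_normE/=; exact: lt_trans dr.
  rewrite -(subrK (h x) (h x')) -addrA (le_trans (ler_normD _ _))// [leRHS]splitr lerD//.
  by rewrite distrC.
exists (d / 2); first by rewrite divr_gt0.
move=> x y xK xy; apply: (hd (d / 2)) => //=.
- by rewrite sub0r normrN gtr0_norm ?divr_gt0// ltr_pdivrMr//; lra.
- by rewrite divr_gt0.
- by rewrite in_itv/= -ler_norml.
Qed.

(* The sup-convolution [x |-> sup_y (h y - L |x - y|)] is L-Lipschitz. *)
Lemma lipschitz_approx h K M eta : continuous h -> (forall x, `|h x| <= M) -> 0 < eta ->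
  exists h1, [/\ exists L, lipb h1 L, forall x, `|h1 x| <= M &
    forall x, `|x| <= K -> `|h x - h1 x| <= eta].
Proof.
move=> ch hM e0; have [d d0 hd] := continuous_unif_on_segment K ch e0.
have M0 : 0 <= M by exact: le_trans (normr_ge0 _) (hM 0).
(* With this slope a point at distance [d] or more contributes at most M - 2 M = - M, hence no more
   than [h x]. *)
pose L := 2 * M / d; have L0 : 0 <= L by rewrite divr_ge0 ?mulr_ge0// ltW.
pose S x := [set h y - L * `|x - y| | y in setT].
have hle x : h x <= M by rewrite (le_trans (ler_norm _) (hM x)).
have hge x : - M <= h x by have := hM x; rewrite ler_norml => /andP[].
have hsup x : has_sup (S x).
  split; first by exists (h x - L * `|x - x|), x.
  by exists M => _ [y _ <-]; rewrite lerBlDr (le_trans (hle y))// lerDl mulr_ge0.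
have ub x y : h y - L * `|x - y| <= sup (S x).
  by apply: ub_le_sup; [case: (hsup x)|exists y].
have leM x c : (forall y, h y - L * `|x - y| <= c) -> sup (S x) <= c.
  by move=> hc; apply: ge_sup => [|_ [y _ <-]]; [case: (hsup x)|exact: hc].
have geh x : h x <= sup (S x) by have := ub x x; rewrite subrr normr0 mulr0 subr0.
have supM x : sup (S x) <= M by apply: leM => y; rewrite lerBlDr (le_trans (hle y))// lerDl mulr_ge0.
have one x y : sup (S x) <= sup (S y) + L * `|x - y|.
  apply: leM => z; rewrite -lerBlDr; apply: le_trans (ub y z).
  rewrite -addrA lerD2l -opprD lerN2 -mulrDr ler_wpM2l//.
  have := ler_normD (y - x) (x - z); rewrite addrA subrK (distrC y x) addrC.
  by move=> h1; rewrite [leRHS]addrC.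
have bM x : `|sup (S x)| <= M.
  by rewrite ler_norml supM (le_trans (hge x)).
exists (fun x => sup (S x)); split => //.
- exists (L + M); split=> [x y|x].
    rewrite (@le_trans _ _ (L * `|x - y|))//; last by rewrite ler_wpM2r// lerDl.
    by rewrite ler_norml; have := one x y; have := one y x; rewrite (distrC y x); lra.
  by rewrite (le_trans (bM x))// lerDr.
move=> x xK; rewrite distrC ger0_norm ?subr_ge0// lerBlDl; apply: leM => y.
have [xy|xy] := ltP `|x - y| d.
  have := hd x y xK xy; rewrite ler_norml => /andP[h1 _].
  by have := mulr_ge0 L0 (normr_ge0 (x - y)); lra.
have : 2 * M <= L * `|x - y|.
  by rewrite /L mulrAC ler_pdivlMr// ler_wpM2l// mulr_ge0.
by have := hle y; have := hge x; lra.
Qed.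

(** The positive width [e] gives a third order Taylor bound, and further smoothing only changes the
    function that is averaged. [M] is recorded because the Taylor constant depends on it. *)
Definition test_function M (g : R -> R) := exists e h1 L, [/\ 0 < e, lipb h1 L,
  forall x, `|h1 x| <= M & g = gsmooth e h1].

Lemma gsmooth_bounded t h L M x : lipb h L -> (forall x, `|h x| <= M) -> `|gsmooth t h x| <= M.
Proof.
move=> hh hM; have eg := lipb_growth x t hh.
rewrite (le_trans (gmean_norm eg))// -[leRHS](@gmean_cst R M).
by apply: le_gmean; [exact: exp_growth_norm|exact: exp_growth_cst|].
Qed.

(** Outside [-K, K] the difference is at most 2 M, hence at most 2 M |x| / K. This linear form is
    meant to be integrated against laws with bounded first moments, which supply tightness. *)
Lemma test_function_approx h K M eta : continuous h -> (forall x, `|h x| <= M) -> 0 < K -> 0 < eta ->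
  exists2 g, test_function M g & forall x, `|h x - g x| <= eta + 2 * M / K * `|x|.
Proof.
move=> ch hM K0 e0; have e2 : 0 < eta / 2 by rewrite divr_gt0.
have [h1 [[L hL] h1M h1h]] := lipschitz_approx K ch hM e2.
have L0 : 0 <= L by case: hL => _ hb; exact: le_trans (normr_ge0 _) (hb 0).
pose m1 := gmean (fun z : R => `|z|); have m10 : 0 <= m1 by apply: gmean_ge0.
pose e := eta / 2 / (L * m1 + 1).
have B0 : 0 < L * m1 + 1 by rewrite ltr_wpDl// mulr_ge0.
have ep : 0 < e by rewrite divr_gt0.
have gh x : `|gsmooth e h1 x - h1 x| <= eta / 2.
  have := gsmooth_lip_time e 0 hL x; rewrite gsmooth0 subr0 (gtr0_norm ep) -/m1 => /le_trans; apply.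
  rewrite (_ : L * e * m1 = eta / 2 * ((L * m1) / (L * m1 + 1))); last by rewrite /e; field; exact: lt0r_neq0.
  by rewrite ler_piMr ?(ltW e2)// ler_pdivrMr// mul1r lerDl.
exists (gsmooth e h1); first by exists e, h1, L.
move=> x.
have M0 : 0 <= M by exact: le_trans (normr_ge0 _) (hM 0).
have [xK|xK] := leP `|x| K.
  apply: (@le_trans _ _ eta).
    rewrite -(subrK (h1 x) (h x)) -addrA (le_trans (ler_normD _ _))// [leRHS]splitr lerD//.
      exact: h1h.
    by rewrite distrC.
  by rewrite lerDl !(mulr_ge0, divr_ge0) ?invr_ge0// ltW.
apply: (@le_trans _ _ (2 * M)).
  rewrite (le_trans (ler_normB _ _))//; have := hM x; have := gsmooth_bounded e x hL h1M; lra.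
rewrite ler_wpDl ?(ltW e0)// mulrAC ler_pdivlMr// ler_wpM2l ?mulr_ge0//; exact: ltW.
Qed.

Lemma test_function_lipb M g : test_function M g -> exists L, lipb g L.
Proof. by move=> [e [h1 [L [e0 hL _ ->]]]]; exists L; exact: lipb_gsmooth. Qed.

(* The Gaussian operators commute, so the iterates keep the same Taylor constant. *)
Lemma test_function_taylor M g : test_function M g -> exists2 K, 0 <= K & forall t j x, 0 <= t ->
  exists a b, forall y, `|iter j (gsmooth t) g (x + y) - iter j (gsmooth t) g x - a * y - b * y ^+ 2 / 2|
    <= K * `|y| ^+ 3.
Proof.
move=> [e [h1 [L [e0 hL hM ->]]]].
have M0 : 0 <= M by exact: le_trans (normr_ge0 _) (hM 0).
have [K K0 hK] := gsmooth_taylor_exists e0 M0; exists K => // t j x t0.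
have tj : 0 <= t * Num.sqrt j%:R by rewrite mulr_ge0 ?sqrtr_ge0.
have -> : iter j (gsmooth t) (gsmooth e h1) = gsmooth e (gsmooth (t * Num.sqrt j%:R) h1).
  rewrite (iter_gsmooth _ t0 (lipb_gsmooth e hL)) (gsmooth_comp tj (ltW e0) hL).
  by rewrite (gsmooth_comp (ltW e0) tj hL) addrC.
apply: hK; first exact: lipb_gsmooth hL.
by move=> u; exact: gsmooth_bounded hL hM.
Qed.

End lipschitz_approximation.

(** * Central limit theorem *)

Lemma cvg_inv_sqrt (R : realType) : (fun n : nat => (Num.sqrt n%:R)^-1 : R) @ \oo --> 0.
Proof.
apply/cvgr0Pnorm_le => e e0.
exists (Num.truncn (e^-1 ^+ 2)).+1 => // n /= hn.
have hn' : e^-1 ^+ 2 <= n%:R.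
  by apply/ltW/(lt_le_trans (truncnS_gt _)); rewrite ler_nat.
rewrite ger0_norm ?invr_ge0 ?sqrtr_ge0// -[leRHS]invrK lef_pV2 ?posrE ?invr_gt0//.
  by rewrite -(@ger0_norm _ e^-1) ?invr_ge0 ?(ltW e0)// -sqrtr_sqr ler_wsqrtr.
by rewrite sqrtr_gt0 ltr0n (leq_trans _ hn).
Qed.

Section blocks.
Context (R : realType) (X : completeNormedModType R) (D : random_series X).

Notation p := (rs_p D).
Notation P := (rs_P D).
Notation tau := (rs_tau D).
Notation tau' := (rs_tau' D).
Notation theta := (shift tau').
Local Notation Ex F := (Rintegral P setT F).

Variables (G : bits -> R) (m0 r : nat).
Hypothesis dG : depends_below m0 G.
Hypothesis sepr : forall n, (r <= n)%N -> forall i j, (i < m0)%N -> (j < m0)%N -> iter n tau i != j.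

Definition block k w := \sum_(l <- iota 0 k) G (iter l theta w).

Let cG : cyl_fun G. Proof. by exists m0. Qed.

Lemma cyl_block k : cyl_fun (block k).
Proof. by apply: cyl_sum => l; exact: cyl_shift. Qed.

Definition block_bits k := [seq iter l tau' i | l <- iota 0 k, i <- iota 0 m0].

Lemma block_depends_on k : depends_on (block_bits k) (block k).
Proof.
move=> w w' e; rewrite /block big_seq [RHS]big_seq; apply: eq_bigr => l lk.
by apply: dG => i im; rewrite !iter_shift; apply: e; apply: allpairs_f => //; rewrite mem_iota.
Qed.

Lemma block_free_of k n : (k + r <= n)%N -> free_of (block_bits k) (fun w => block k (iter n theta w)).
Proof.
move=> krn j b w /allpairsP[[l' i] /= [lk im ->]].
rewrite shift_upd /block; apply: eq_bigr => l _; rewrite shift_upd; apply: dG => j' jm.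
rewrite /upd; case: eqP => // e; move: lk im; rewrite !mem_iota /= !add0n => lk im.
(* As l' < k and k + r <= n, the exponent is at least [r], so [sepr] applies. *)
have : iter (l + n - l') tau i != j'.
  by apply: sepr => //; lia.
rewrite e -iterD (_ : (l + n = (l + n - l') + l')%N); last by lia.
by rewrite iterD (iter_tau'K (@rs_tau'K _ _ D)) addnK eqxx.
Qed.

(** Convolution with the law of [c] times a block, the counterpart of [gsmooth] in the
    replacement. *)
Definition block_avg k (c : R) (h : R -> R) (x : R) := Ex (fun w => h (x + c * block k w)).

(** Blocks of length [k] separated by gaps of length [r] use disjoint bits and have the same law.
    Freezing all blocks but the first turns the expectation into one application of [block_avg]. *)
Lemma Ex_blocks k c Q h x :
  Ex (fun w => h (x + c * \sum_(q < Q) block k (iter (q * (k + r)) theta w))) =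
  iter Q (block_avg k c) h x.
Proof.
elim: Q h => [|Q ih] h.
  by rewrite /= -[RHS](Ex_cst P); apply: eq_Ex => w; rewrite big_ord0 mulr0 addr0.
set s := (k + r)%N in ih *.
pose S w := \sum_(q < Q) block k (iter (q * s) theta w).
have cS : cyl_fun S by apply: cyl_sum => q; apply: cyl_shift; exact: cyl_block.
have cS' := cyl_shift D s cS.
have fS : free_of (block_bits k) (fun w => S (iter s theta w)).
  move=> j b w jk; apply: eq_bigr => q _; rewrite -!iterD.
  by rewrite (@block_free_of k (q * s + s))// leq_addl.
rewrite iterSr -ih.
transitivity (Ex (fun w => block_avg k c h (x + c * S (iter s theta w)))); last first.
  exact: (Ex_shift D s (cyl_comp (fun u => block_avg k c h (x + c * u)) cS)).
rewrite /block_avg -(Ex_indep (rs_p01 D) (@rs_PE _ _ D) (fun u v => h (x + c * v + c * u))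
  (cyl_block k) cS' (@block_depends_on k) fS).
apply: eq_Ex => w; rewrite big_ord_recl/= -addrA -mulrDr; congr (h _); congr (_ + _); congr (_ * _).
rewrite [RHS]addrC; congr (_ + _).
by apply: eq_bigr => q _; rewrite -iterD mulSn addnC.
Qed.

Hypothesis EG : Ex G = 0.

Lemma Ex_block k : Ex (block k) = 0.
Proof.
rewrite /block (Ex_sum P (iota 0 k) (F := fun l w => G (iter l theta w))); last by move=> l; exact: cyl_shift.
by rewrite big1 // => l _; rewrite Ex_shift.
Qed.

(** The scale at which [gsmooth] has the variance of the block, with the second moment of [gauss]
    divided out. *)
Definition block_sd k := Num.sqrt (Ex (fun w => block k w ^+ 2) / gmean (fun z : R => z ^+ 2)).

Lemma block_sd_sqr k : block_sd k ^+ 2 * gmean (fun z : R => z ^+ 2) = Ex (fun w => block k w ^+ 2).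
Proof.
rewrite sqr_sqrtr; first by rewrite divfK// gt_eqF// gmean_sqr_gt0.
by rewrite divr_ge0 ?(ltW (gmean_sqr_gt0 R))//; apply: Ex_ge0 => w; exact: sqr_ge0.
Qed.

(* Lindeberg's replacement of one block by a Gaussian variable of the same variance. *)
Lemma block_replace k M g : test_function M g -> exists2 K, 0 <= K & forall c Q x, 0 <= c ->
  `|iter Q (block_avg k c) g x - iter Q (gsmooth (c * block_sd k)) g x| <=
    Q%:R * (K * c ^+ 3).
Proof.
move=> tg; have [K K0 hK] := test_function_taylor tg.
pose m3 := gmean (fun z : R => `|z| ^+ 3).
(* Third absolute moments of the block and of the Gaussian that replaces it. *)
pose B := Ex (fun w => `|block k w| ^+ 3) + block_sd k ^+ 3 * m3.
have sd0 : 0 <= block_sd k by exact: sqrtr_ge0.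
have B0 : 0 <= B.
  rewrite addr_ge0 ?mulr_ge0 ?exprn_ge0//; last by apply: gmean_ge0 => z; rewrite exprn_ge0.
  by apply: Ex_ge0 => w; rewrite exprn_ge0.
exists (K * B); first exact: mulr_ge0.
have cb := cyl_block k.
move=> c Q' x' c0.
set t := c * block_sd k; have t0 : 0 <= t by rewrite mulr_ge0.
have [L hL] := test_function_lipb tg.
(* The same expansion serves both operators: the linear terms are centred, the quadratic ones agree
   by the choice of [block_sd], and only cubic remainders are left. [K] does not depend on [Q]. *)
have one Q x : `|block_avg k c (iter Q (gsmooth t) g) x - gsmooth t (iter Q (gsmooth t) g) x| <= K * B * c ^+ 3.
  have [a [b hab]] := hK t Q x t0; set u := iter Q _ g in hab *.
  have lu : lipb u L by rewrite /u; elim: Q {hab u} => //= Q; exact: lipb_gsmooth.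
  have h1 := gsmooth_taylor lu t0 hab.
  have cu : cyl_fun (fun w => u (x + c * block k w)) by exact: (cyl_comp (fun y => u (x + c * y)) cb).
  have h2 : `|block_avg k c u x - u x - b * (c ^+ 2 * Ex (fun w => block k w ^+ 2)) / 2| <=
      K * (c ^+ 3 * Ex (fun w => `|block k w| ^+ 3)).
    have -> : block_avg k c u x - u x - b * (c ^+ 2 * Ex (fun w => block k w ^+ 2)) / 2 =
        Ex (fun w => u (x + c * block k w) - u x - a * (c * block k w) - b * (c * block k w) ^+ 2 / 2).
      rewrite ExB; [|exact: (cyl_comp (fun y => u (x + c * y) - u x - a * (c * y)) cb)
        |exact: (cyl_comp (fun y => b * (c * y) ^+ 2 / 2) cb)].
      rewrite ExB; [|exact: (cyl_comp (fun y => u (x + c * y) - u x) cb)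
        |exact: (cyl_comp (fun y => a * (c * y)) cb)].
      rewrite ExB//; last exact: cyl_cst.
      rewrite Ex_cst; have -> : Ex (fun w => a * (c * block k w)) = 0.
        rewrite (@eq_Ex _ P _ (fun w => a * c * block k w)); last by move=> w; rewrite mulrA.
        by rewrite ExZ// Ex_block mulr0.
      rewrite subr0; congr (_ - _).
      rewrite [RHS](@eq_Ex _ P _ (fun w => b * c ^+ 2 / 2 * block k w ^+ 2)); last by move=> w; field.
      by rewrite ExZ; [field|exact: (cyl_comp (fun y => y ^+ 2) cb)].
    have c3 : cyl_fun (fun w => u (x + c * block k w) - u x - a * (c * block k w) - b * (c * block k w) ^+ 2 / 2).
      exact: (cyl_comp (fun y => u (x + c * y) - u x - a * (c * y) - b * (c * y) ^+ 2 / 2) cb).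
    rewrite (le_trans (Ex_norm P c3))// mulrA -ExZ; last exact: (cyl_comp (fun y => `|y| ^+ 3) cb).
    apply: le_Ex; [exact: (cyl_comp Num.norm c3)|exact: (cyl_comp (fun y => K * c ^+ 3 * `|y| ^+ 3) cb)|].
    by move=> w; rewrite (le_trans (hab _))// normrM exprMn (ger0_norm c0) mulrA.
  have e2 : c ^+ 2 * Ex (fun w => block k w ^+ 2) = t ^+ 2 * gmean (fun z : R => z ^+ 2).
    by rewrite -block_sd_sqr /t exprMn mulrA.
  move: h1 h2; rewrite e2 -/m3.
  have -> : K * (t ^+ 3 * m3) = K * (block_sd k ^+ 3 * m3) * c ^+ 3 by rewrite /t; ring.
  rewrite /B; set e1 := _ / 2; rewrite !ler_norml => /andP[? ?] /andP[? ?].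
  by apply/andP; split; lra.
(* Averaging contracts the uniform distance, so the errors of successive replacements add up. *)
have contr u v x d : (forall y, `|u y - v y| <= d) -> `|block_avg k c u x - block_avg k c v x| <= d.
  move=> h; have cc (f : R -> R) : cyl_fun (fun w => f (x + c * block k w)) := cyl_comp (fun y => f (x + c * y)) cb.
  rewrite /block_avg -ExB//.
  have cd := cc (fun y => u y - v y).
  rewrite (le_trans (Ex_norm P cd))// -[leRHS](Ex_cst P); apply: le_Ex => //; last exact: cyl_cst.
  exact: (cyl_comp Num.norm cd).
elim: Q' x' => [|Q ih] x; first by rewrite /= subrr normr0 mul0r.
rewrite -[X in `|X|](subrKA (block_avg k c (iter Q (gsmooth t) g) x)) (le_trans (ler_normD _ _))//.
rewrite -natr1 mulrDl mul1r; apply: lerD; last exact: one.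
by apply: contr => y; exact: ih.
Qed.

End blocks.

(** The long blocks consist of the positions whose residue modulo [s] is below [k]; what remains is
    made of the gaps and the incomplete last period. *)
Lemma size_block_remainder n s k : (0 < s)%N -> (k <= s)%N ->
  let L := [seq q * s + l | q <- iota 0 (n %/ s), l <- iota 0 k]%N in
  uniq L /\ exists2 rem, perm_eq (iota 0 n) (L ++ rem) & (size rem + n %/ s * k = n)%N.
Proof.
move=> s0 ks L.
have uL : uniq L.
  apply: allpairs_uniq; [exact: iota_uniq|exact: iota_uniq|].
  move=> [q l] [q' l'] /allpairsP[[a b] /= [_]]; rewrite mem_iota => /= bk [-> ->].
  move=> /allpairsP[[a' b'] /= [_]]; rewrite mem_iota => /= bk' [-> ->] e.
  have bs : (b < s)%N by exact: leq_trans ks.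
  have bs' : (b' < s)%N by exact: leq_trans ks.
  have := congr1 (modn^~ s) e; rewrite !modnMDl !modn_small// => eb.
  have := congr1 (divn^~ s) e; rewrite !divnMDl// !divn_small// !addn0 => ea.
  by rewrite ea eb.
set rem := [seq i <- iota 0 n | i \notin L]; have pe : perm_eq (iota 0 n) (L ++ rem).
  apply: uniq_perm; first exact: iota_uniq.
    rewrite cat_uniq uL filter_uniq ?iota_uniq// andbT.
    by apply/hasPn => i; rewrite mem_filter => /andP[].
  move=> i; rewrite mem_cat mem_filter; case: (boolP (i \in L)) => //= /allpairsP[[q l] /= []].
  rewrite !mem_iota /= !add0n => qn lk ->.
  have ls : (l < s)%N by exact: leq_trans ks.
  by apply: (@leq_trans (n %/ s * s)); [nia|exact: leq_trunc_div].
split=> //; exists rem => //; have := perm_size pe.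
by rewrite size_cat size_allpairs !size_iota addnC => <-.
Qed.

Section cylinder_clt.
Context (R : realType) (X : completeNormedModType R) (D : random_series X).

Notation p := (rs_p D).
Notation P := (rs_P D).
Notation tau := (rs_tau D).
Notation tau' := (rs_tau' D).
Notation theta := (shift tau').
Local Notation Ex F := (Rintegral P setT F).

Variables (G : bits -> R) (A : R).
Hypothesis cG : cyl_fun G.
Hypothesis EG : Ex G = 0.
Hypothesis A0 : 0 <= A.
Hypothesis varG : forall L : seq nat, uniq L ->
  Ex (fun w => (\sum_(l <- L) G (iter l theta w)) ^+ 2) <= (size L)%:R * A ^+ 2.

Lemma Ex_norm_sum_le L : uniq L ->
  Ex (fun w => `|\sum_(l <- L) G (iter l theta w)|) <= A * Num.sqrt (size L)%:R.
Proof.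
move=> uL; have cs : cyl_fun (fun w => \sum_(l <- L) G (iter l theta w)).
  by apply: cyl_sum => l; exact: cyl_shift.
rewrite (le_trans (ler_norm _))// (le_trans (Ex_sqr_le P (cyl_comp Num.norm cs)))//.
rewrite -[leRHS]ger0_norm ?mulr_ge0 ?sqrtr_ge0// -sqrtr_sqr ler_wsqrtr// exprMn sqr_sqrtr// mulrC.
rewrite (@eq_Ex _ P _ (fun w => (\sum_(l <- L) G (iter l theta w)) ^+ 2)); first exact: varG.
by move=> w; rewrite real_normK ?num_real.
Qed.

(** The deviation [sigma] depends on [e]: blocks are taken so long that the gaps contribute at most
    [e] in mean after normalisation. The bound on [sigma], which sees [G] only through [A], later
    allows a cluster point to be taken. *)
Lemma cylinder_clt e : 0 < e -> exists2 sigma,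
  0 <= sigma <= Num.sqrt (A ^+ 2 / gmean (fun z : R => z ^+ 2)) &
  forall M g L eta, test_function M g -> lipb g L -> 0 < eta -> \forall n \near \oo,
    `|Ex (fun w => g ((Num.sqrt n%:R)^-1 * \sum_(l <- iota 0 n) G (iter l theta w))) - gsmooth sigma g 0| <=
    L * e + eta.
Proof.
move=> e0; have [m0 dG] := cG.
have [r hr] := tau_separated (@rs_tau_free _ _ D) (iota 0 m0) (iota 0 m0).
have sepr n : (r <= n)%N -> forall i j, (i < m0)%N -> (j < m0)%N -> iter n tau i != j.
  by move=> rn i j im jm; apply: hr => //; rewrite mem_iota.
(* For large n the discarded terms number at most e' n, so by [Ex_norm_sum_le] their normalised sum
   has mean absolute value at most A sqrt(e') <= e. *)
pose e' := (e / (A + 1)) ^+ 2; have A1 : 0 < A + 1 by rewrite ltr_wpDl.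
have e'0 : 0 < e' by rewrite exprn_gt0// divr_gt0.
(* This [k] makes the gaps a fraction at most e' / 2 of each period. *)
pose k := (Num.truncn (2 * r%:R / e')).+1; pose s := (k + r)%N.
have s0 : 0 < s%:R :> R by rewrite ltr0n.
have rs : r%:R / s%:R <= e' / 2.
  rewrite ler_pdivrMr//; have : 2 * r%:R / e' < k%:R by exact: truncnS_gt.
  rewrite ltr_pdivrMr// => h; have : k%:R <= s%:R :> R by rewrite ler_nat leq_addr.
  have := ler0n R r; nra.
pose sd := block_sd D G k; have sd0 : 0 <= sd by exact: sqrtr_ge0.
pose g2 := gmean (fun z : R => z ^+ 2); have g20 : 0 < g2 by exact: gmean_sqr_gt0.
(* Standard deviation per unit of time: one block in each period of length [s]. *)
pose sg := sd / Num.sqrt s%:R; have sg0 : 0 <= sg by rewrite divr_ge0 ?sqrtr_ge0.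
exists sg.
  rewrite sg0 -[leLHS]ger0_norm// -sqrtr_sqr ler_wsqrtr// ler_pdivlMr//.
  rewrite /sg expr_div_n [Num.sqrt s%:R ^+ 2]sqr_sqrtr ?ler0n// mulrAC block_sd_sqr ler_pdivrMr//.
  rewrite (le_trans (varG (iota_uniq _ _)))// size_iota mulrC ler_wpM2l ?sqr_ge0//.
  by rewrite ler_nat leq_addr.
move=> M g L eta tg lg eta0; have [gl gb] := lg.
have L0 : 0 <= L by exact: le_trans (normr_ge0 _) (gb 0).
pose m1 := gmean (fun z : R => `|z|); have m10 : 0 <= m1 by exact: gmean_ge0.
have [K K0 hK] := block_replace dG EG k tg.
pose B := L * sg * s%:R * m1; have B0 : 0 <= B by rewrite !mulr_ge0// ltW.
(* Smallness required of [c], the inverse of sqrt n: [c <= 1] gives c^2 <= c, and the other bounds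
   control the last period, the Lindeberg error, and the replacement of [Q] by n / s. *)
pose d := Num.min 1 (Num.min (e' / 2 / s%:R) (Num.min (eta / 2 / (K + 1)) (eta / 2 / (B + 1)))).
have d0 : 0 < d by rewrite !lt_min ltr01 !divr_gt0// ltr_wpDl.
have /cvgr0Pnorm_le/(_ _ d0)[N _ hN] := @cvg_inv_sqrt R.
exists N.+1 => // n /= Nn; have := hN n (ltnW Nn); rewrite /=.
set c := (Num.sqrt n%:R)^-1; have n0 : 0 < n%:R :> R by rewrite ltr0n (leq_trans _ Nn).
have c0 : 0 < c by rewrite invr_gt0 sqrtr_gt0.
have cn : c ^+ 2 * n%:R = 1 by rewrite exprVn sqr_sqrtr ?ler0n// mulVf// gt_eqF.
rewrite gtr0_norm// /d !le_min => /and4P[c1 cs cK cB].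
rewrite ler_pdivlMr// in cs; rewrite ler_pdivlMr ?ltr_wpDl// in cK; rewrite ler_pdivlMr ?ltr_wpDl// in cB.
have cc : c ^+ 2 <= c by rewrite expr2 ler_piMr// ltW.
have [] := @size_block_remainder n s k (leq_trans (ltn0Sn _) (leq_addr _ _)) (leq_addr _ _).
set Q := (n %/ s)%N; set BL := [seq _ | _ <- _, _ <- _] => uB [rem pe szr].
have sQ : s%:R * Q%:R <= n%:R :> R by rewrite -natrM ler_nat mulnC leq_trunc_div.
have sQ1 : n%:R <= s%:R * Q%:R + s%:R :> R.
  rewrite -natrM -natrD ler_nat mulnC -mulSnr ltnW// -ltn_divLR//.
pose SB w := \sum_(q < Q) block D G k (iter (q * s) theta w).
pose SR w := \sum_(l <- rem) G (iter l theta w).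
have cSB : cyl_fun SB by apply: cyl_sum => q; apply: cyl_shift; exact: cyl_block dG _.
have cSR : cyl_fun SR by apply: cyl_sum => q; exact: cyl_shift.
have SE w : \sum_(l <- iota 0 n) G (iter l theta w) = SB w + SR w.
  rewrite (perm_big _ pe) big_cat/=; congr (_ + _).
  rewrite /BL big_allpairs_dep/= /SB -(big_mkord xpredT (fun q => block D G k (iter (q * s) theta w))).
  rewrite /index_iota subn0; apply: eq_bigr => q _; apply: eq_bigr => l _.
  by rewrite addnC iterD.
have ur : uniq rem by have := iota_uniq 0 n; rewrite (perm_uniq pe) cat_uniq => /and3P[].
have step1 : `|Ex (fun w => g (c * \sum_(l <- iota 0 n) G (iter l theta w))) - Ex (fun w => g (c * SB w))| <= L * e.
  rewrite (@eq_Ex _ P _ (fun w => g (c * (SB w + SR w)))); last by move=> w; rewrite SE.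
  have cd : cyl_fun (fun w => g (c * (SB w + SR w)) - g (c * SB w)).
    exact: (cyl_comp2 (fun x y => g (c * (x + y)) - g (c * x)) cSB cSR).
  rewrite -ExB; [|exact: (cyl_comp2 (fun x y => g (c * (x + y))) cSB cSR)|exact: (cyl_comp (fun x => g (c * x)) cSB)].
  rewrite (le_trans (Ex_norm P cd))//.
  apply: (@le_trans _ _ (L * c * Ex (fun w => `|SR w|))).
    rewrite -ExZ; last exact: (cyl_comp Num.norm cSR).
    apply: le_Ex; [exact: (cyl_comp Num.norm cd)|exact: (cyl_comp (fun x => L * c * `|x|) cSR)|].
    move=> w; rewrite (le_trans (gl _ _))// -mulrBr addrAC subrr add0r normrM (gtr0_norm c0) mulrA.
    exact: lexx.
  rewrite -mulrA ler_wpM2l//.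
  apply: (@le_trans _ _ (c * (A * Num.sqrt (size rem)%:R))); first by rewrite ler_pM2l// Ex_norm_sum_le.
  have szr' : c ^+ 2 * (size rem)%:R <= e'.
    have : (size rem)%:R + Q%:R * k%:R = n%:R :> R by rewrite -natrM -natrD szr.
    have sE : s%:R = k%:R + r%:R :> R by rewrite -natrD.
    move=> h; have h1 : (size rem)%:R <= Q%:R * r%:R + s%:R :> R by nra.
    apply: (@le_trans _ _ (c ^+ 2 * (n%:R * (r%:R / s%:R) + s%:R))).
      rewrite ler_wpM2l ?sqr_ge0// (le_trans h1)// lerD2r mulrA ler_pdivlMr// mulrAC ler_wpM2r//.
      by rewrite mulrC.
    rewrite mulrDr mulrA cn mul1r [leRHS]splitr lerD//.
    by rewrite (le_trans _ cs)// ler_wpM2r// ltW.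
  have : Num.sqrt (c ^+ 2 * (size rem)%:R) <= e / (A + 1).
    by rewrite -[leRHS]ger0_norm ?divr_ge0 ?(ltW e0) ?(ltW A1)// -sqrtr_sqr ler_wsqrtr.
  rewrite sqrtrM ?sqr_ge0// sqrtr_sqr gtr0_norm// => h.
  rewrite mulrCA (le_trans (ler_wpM2l A0 h))// mulrA ler_pdivrMr// mulrC ler_wpM2l ?(ltW e0)//.
  by rewrite lerDl.
have step2 : `|Ex (fun w => g (c * SB w)) - gsmooth (c * sd * Num.sqrt Q%:R) g 0| <= eta / 2.
  rewrite (@eq_Ex _ P _ (fun w => g (0 + c * SB w))); last by move=> w; rewrite add0r.
  rewrite (Ex_blocks dG sepr) -(iter_gsmooth _ _ lg) ?mulr_ge0 ?(ltW c0)//.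
  rewrite (le_trans (hK c Q 0 (ltW c0)))// (le_trans _ cK)//.
  have Qn : Q%:R <= n%:R :> R by rewrite ler_nat leq_div.
  apply: (@le_trans _ _ (n%:R * (K * c ^+ 3))); first by rewrite ler_wpM2r ?mulr_ge0 ?exprn_ge0// ltW.
  rewrite (_ : n%:R * (K * c ^+ 3) = K * c * (c ^+ 2 * n%:R)); last by ring.
  by rewrite cn mulr1 mulrC ler_wpM2l ?(ltW c0)// lerDl.
have step3 : `|gsmooth (c * sd * Num.sqrt Q%:R) g 0 - gsmooth sg g 0| <= eta / 2.
  rewrite (le_trans (gsmooth_lip_time _ _ lg 0))// -/m1.
  pose u : R := s%:R * Q%:R * c ^+ 2.
  have u0 : 0 <= u by rewrite mulr_ge0 ?sqr_ge0// mulr_ge0.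
  have u1 : u <= 1 by rewrite -cn /u mulrC ler_wpM2l ?sqr_ge0.
  have ul : 1 - s%:R * c <= u.
    have := ler_wpM2l (sqr_ge0 c) sQ1; rewrite cn /u.
    by have := ler_wpM2r (ltW s0) cc; lra.
  have -> : c * sd * Num.sqrt Q%:R = sg * Num.sqrt u.
    rewrite /u sqrtrM; last exact: mulr_ge0.
    rewrite [Num.sqrt (s%:R * _)]sqrtrM ?ler0n// sqrtr_sqr (gtr0_norm c0) /sg.
    by field; rewrite gt_eqF// sqrtr_gt0.
  have su : u <= Num.sqrt u <= 1.
    apply/andP; split; last by rewrite -[leRHS]sqrtr1 ler_wsqrtr.
    by rewrite -[leLHS]ger0_norm// -sqrtr_sqr ler_wsqrtr// expr2 ler_piMr.
  move/andP : su => [su1 su2].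
  have h : `|sg * Num.sqrt u - sg| <= sg * (s%:R * c).
    rewrite -[X in _ - X]mulr1 -mulrBr normrM ger0_norm// ler_wpM2l// distrC ger0_norm ?subr_ge0//; lra.
  apply: (@le_trans _ _ (L * (sg * (s%:R * c)) * m1)).
    by rewrite ler_wpM2r// ler_wpM2l.
  rewrite (_ : _ * m1 = c * B); last by rewrite /B; ring.
  by rewrite (le_trans _ cB)// ler_wpM2l ?(ltW c0)// lerDl.
move: step1 step2 step3; rewrite !ler_norml => /andP[? ?] /andP[? ?] /andP[? ?].
by apply/andP; split; lra.
Qed.

End cylinder_clt.

(** * Integrals against the centred Gaussian law *)

Section gaussian_law.
Variable R : realType.
Local Notation mu := (@lebesgue_measure R).

Lemma normal_pdf_scale (sigma z : R) : 0 < sigma -> normal_pdf 0 sigma (sigma * z) * sigma = gauss z.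
Proof.
move=> s0; have s0' : sigma != 0 by rewrite gt_eqF.
rewrite gaussE normal_pdfE// /normal_fun subr0 mulrAC.
have -> : - (sigma * z) ^+ 2 / (sigma ^+ 2 *+ 2) = - z ^+ 2 / 2 by rewrite -mulr_natr; field.
congr (_ * _); rewrite /normal_peak expr1n mul1r.
rewrite -[sigma ^+ 2 * pi *+ 2]mulrnAr.
by rewrite sqrtrM ?sqr_ge0// sqrtr_sqr gtr0_norm// invfM mulrAC mulVf// mul1r.
Qed.

(** The density is identified with the Radon-Nikodym derivative, and the substitution y = sigma z
    brings it to [gauss]. *)
Lemma integral_normal_prob (sigma : R) (h : R -> R) M : 0 < sigma -> continuous h ->
  (forall x, 0 <= h x <= M) ->
  (\int[normal_prob 0 sigma]_y (h y)%:E = (gmean (fun z => h (sigma * z)))%:E)%E.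
Proof.
move=> s0 ch hM; have s0' : sigma != 0 by rewrite gt_eqF.
have mh : measurable_fun setT h := continuous_measurable_fun ch.
have h0 x : 0 <= h x by have /andP[] := hM x.
have nh x : `|h x| <= M by rewrite ger0_norm//; have /andP[] := hM x.
have ih : (normal_prob 0 sigma).-integrable setT (EFin \o h).
  apply: measurable_bounded_integrable => //.
    by rewrite (le_lt_trans (probability_le1 _ _)) ?ltry.
  by exists M; split; [exact: num_real|move=> x Mx y _; apply: (le_trans (nh y)); exact: ltW].
have dom := normal_prob_dominates (0 : R) sigma.
transitivity (\int[mu]_y ((h y)%:E * (normal_pdf 0 sigma y)%:E))%E.
  rewrite -(Radon_Nikodym_change_of_variables dom measurableT ih).
  apply: ae_eq_integral => //.
  - apply: emeasurable_funM; first exact/measurable_EFinP.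
    by apply: (measurable_int mu); apply: Radon_Nikodym_integrable; exact: dom.
  - by apply: emeasurable_funM; apply/measurable_EFinP => //; exact: measurable_normal_pdf.
  - apply: ae_eqe_mul2l => /=.
    rewrite Radon_NikodymE//=; case: cid => /= g [g1 g2 g3].
    apply: integral_ae_eq => //=.
    + by apply/measurable_EFinP; exact: measurable_normal_pdf.
    + by move=> E _ mE; rewrite -g3.
transitivity (\int[mu]_y (h y * normal_pdf 0 sigma y)%:E)%E.
  by apply: eq_integral => y _; rewrite EFinM.
rewrite (@ge0_affine_substitution R (fun y => h y * normal_pdf 0 sigma y) sigma 0)//.
- rewrite gmean_ereal; last first.
    apply: (@exp_growth_bounded _ _ M); last by move=> z; exact: nh.
    by apply: measurableT_comp => //; exact: measurable_funM.
  by apply: eq_integral => z _; rewrite addr0 -mulrA normal_pdf_scale.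
- by move=> x; apply: continuousM; [exact: ch|exact: continuous_normal_pdf].
- by move=> x; rewrite mulr_ge0// normal_pdf_ge0.
Qed.

Lemma integral_centered_gaussian (sigma : R) (h : R -> R) M : 0 <= sigma -> continuous h ->
  (forall x, `|h x| <= M) ->
  (\int[centered_gaussian sigma]_y (h y)%:E = (gsmooth sigma h 0)%:E)%E.
Proof.
move=> s0 ch hM; have mh : measurable_fun setT h := continuous_measurable_fun ch.
have [e|sn] := eqVneq sigma 0.
  rewrite e gsmooth0 (_ : centered_gaussian 0 = \d_(0 : measurableTypeR R)); last first.
    by apply/funext => A; rewrite /centered_gaussian eqxx.
  by rewrite integral_dirac ?diracT ?mul1e//; exact/measurable_EFinP.
rewrite (_ : centered_gaussian sigma = normal_prob 0 sigma); last first.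
  by apply/funext => A; rewrite /centered_gaussian (negbTE sn).
(* The two measurable structures on [R] have the same measurable sets but different displays. *)
have sp : 0 < sigma by rewrite lt_def sn.
have ih c : (normal_prob 0 sigma).-integrable setT (EFin \o (fun x => h x + c)).
  apply: measurable_bounded_integrable => //.
  - by rewrite (le_lt_trans (probability_le1 _ _)) ?ltry.
  - exact: measurable_funD.
  exists (M + `|c|); split; [exact: num_real|move=> x Mx y _; apply: le_trans (ltW Mx)].
  by rewrite (le_trans (ler_normD _ _))// lerD2r.
have bd x : 0 <= h x + M <= M + M.
  by have := hM x; rewrite ler_norml => /andP[? ?]; apply/andP; split; lra.
have cM : continuous (fun x => h x + M) by move=> x; apply: continuousD; [exact: ch|exact: cst_continuous].
have := @integral_normal_prob sigma (fun x => h x + M) (M + M) sp cM bd.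
have -> : gmean (fun z => h (sigma * z) + M) = gsmooth sigma h 0 + M.
  rewrite gmeanD; [|apply: (@exp_growth_bounded _ _ M) => //|exact: exp_growth_cst].
    by rewrite gmean_cst /gsmooth; congr (gmean _ + _); apply/funext => z; rewrite add0r.
  by apply: measurableT_comp => //; exact: measurable_funM.
have i0 := ih 0; rewrite (_ : (fun x => h x + 0) = h) in i0; last by apply/funext => x; rewrite addr0.
under eq_integral do rewrite EFinD.
have iM : (normal_prob 0 sigma).-integrable setT (EFin \o (fun=> M)) by exact: finite_measure_integrable_cst.
rewrite integralD//.
rewrite integral_cst// [X in (_ * X)%E]probability_setT mule1.
have := integrable_fin_num measurableT i0; rewrite /=.
set I := (\int[_]_y (h y)%:E)%E => fI; rewrite -(fineK fI) -EFinD => -[/addIr e].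
have mid : measurable_fun setT ((fun x => x) : measurableTypeR R -> R).
  by move=> _ B mB; rewrite setTI.
transitivity (\int[pushforward (normal_prob 0 sigma) ((fun x => x) : measurableTypeR R -> R)]_y (h y)%:E)%E.
  by [].
rewrite integral_pushforward//; last exact/measurable_EFinP.
by rewrite -e; apply/esym; exact: fineK fI.
Qed.

End gaussian_law.

Section clt.
Context (R : realType) (X : completeNormedModType R) (D : random_series X).

Notation P := (rs_P D).
Notation theta := (shift (rs_tau' D)).
Notation V := (rvec D).
Local Notation Ex F := (Rintegral P setT F).

Variables (f : X -> R) (C A : R).
Hypothesis fC : lip_exp f C.
Hypothesis wA : forall s, uniq s -> \sum_(i <- s) wgt D i <= A.

Local Notation F := (fun w => f (V w)).
Hypothesis F0 : Ex F = 0.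

Let A0 : 0 <= C * A.
Proof.
case: fC => C0 _; rewrite mulr_ge0//.
by have := @wA [::] isT; rewrite big_nil.
Qed.

Definition normalized_sum n w := (Num.sqrt n%:R)^-1 * \sum_(l < n) F (iter l theta w).

Local Notation W := normalized_sum.

Let Sg : R := Num.sqrt ((C * A) ^+ 2 / gmean (fun z : R => z ^+ 2)).

Let inv_sqrt_le1 n : (Num.sqrt n%:R)^-1 * Num.sqrt n%:R <= 1 :> R.
Proof.
case: n => [|n]; first by rewrite sqrtr0 mulr0.
by rewrite mulVf// gt_eqF// sqrtr_gt0.
Qed.

Let normr_inv_sqrt n : `|(Num.sqrt n%:R)^-1| = (Num.sqrt n%:R)^-1 :> R.
Proof. by rewrite ger0_norm// invr_ge0. Qed.

Lemma normalized_sum_integrable n : P.-integrable setT (EFin \o W n).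
Proof.
have [G [_ _ _ iF _]] := cylinder_approx fC wA F0 ltr01.
by apply: (eq_integrable measurableT _ _ _ (integrableZl measurableT (Num.sqrt n%:R)^-1 (iF n))) => w _ /=; rewrite EFinM.
Qed.

Lemma normalized_sum_approx e : 0 < e -> exists G : bits -> R,
  [/\ cyl_fun G, Ex G = 0,
     forall L, uniq L -> Ex (fun w => (\sum_(l <- L) G (iter l theta w)) ^+ 2) <= (size L)%:R * (C * A) ^+ 2 &
     forall n, Ex (fun w => `|W n w - (Num.sqrt n%:R)^-1 * \sum_(l <- iota 0 n) G (iter l theta w)|) <= e].
Proof.
move=> e0; have [G [cG EG vG iF dG]] := cylinder_approx fC wA F0 e0.
exists G; split=> // n; set c := (Num.sqrt n%:R)^-1.
have c0 : 0 <= c by rewrite invr_ge0.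
have iG : P.-integrable setT (EFin \o (fun w => \sum_(l < n) G (iter l theta w))).
  by apply: cyl_integrable; apply: cyl_sum => l; exact: cyl_shift.
have iB : P.-integrable setT (EFin \o (fun w => `|\sum_(l < n) F (iter l theta w) - \sum_(l < n) G (iter l theta w)|)).
  have h := integrable_abse (integrableB measurableT (iF n) iG).
  by apply: (eq_integrable measurableT _ _ _ h) => w _.
rewrite (@eq_Ex _ P _ (fun w => c * `|\sum_(l < n) F (iter l theta w) - \sum_(l < n) G (iter l theta w)|)).
  rewrite RintegralZl//; apply: (@le_trans _ _ (c * (Num.sqrt n%:R * e))); first by rewrite ler_wpM2l.
  by rewrite mulrA ler_piMl ?inv_sqrt_le1// ltW.
move=> w; rewrite /W /normalized_sum -/c.
have -> : \sum_(l <- iota 0 n) G (iter l theta w) = \sum_(l < n) G (iter l theta w).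
  by rewrite -(big_mkord xpredT (fun l => G (iter l theta w))) /index_iota subn0.
by rewrite -mulrBr normrM ger0_norm.
Qed.

(** A first moment bound uniform in [n], obtained from one fixed approximation [G]. *)
Lemma normalized_sum_tight n : Ex (fun w => `|W n w|) <= C * A + 1.
Proof.
have [G [cG EG vG dG]] := normalized_sum_approx ltr01.
pose U w := (Num.sqrt n%:R)^-1 * \sum_(l <- iota 0 n) G (iter l theta w).
have cS : cyl_fun (fun w => \sum_(l <- iota 0 n) G (iter l theta w)).
  by apply: cyl_sum => l; exact: cyl_shift.
have cU : cyl_fun U by exact: (cyl_comp (fun x => (Num.sqrt n%:R)^-1 * x) cS).
have iU := cyl_integrable P cU; have iW := normalized_sum_integrable n.
have inU := cyl_integrable P (cyl_comp Num.norm cU).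
have iWn : P.-integrable setT (EFin \o (fun w => `|W n w|)) by have := integrable_abse iW.
have iD : P.-integrable setT (EFin \o (fun w => `|W n w - U w|)).
  have h := integrable_abse (integrableB measurableT iW iU).
  by apply: (eq_integrable measurableT _ _ _ h) => w _.
apply: (@le_trans _ _ (Ex (fun w => `|U w| + `|W n w - U w|))).
  apply: le_Rintegral => //.
    by apply: (eq_integrable measurableT _ _ _ (integrableD measurableT inU iD)) => w _.
  by move=> w _; rewrite (le_trans _ (ler_normD _ _))// addrC subrK.
rewrite RintegralD//; apply: lerD; last exact: dG.
rewrite (@eq_Ex _ P _ (fun w => (Num.sqrt n%:R)^-1 * `|\sum_(l <- iota 0 n) G (iter l theta w)|)); last first.
  by move=> w; rewrite /U normrM normr_inv_sqrt.
rewrite ExZ; last exact: (cyl_comp Num.norm cS).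
have h := Ex_norm_sum_le cG A0 vG (iota_uniq 0 n); rewrite size_iota in h.
have c0 : 0 <= (Num.sqrt n%:R)^-1 :> R by rewrite invr_ge0.
by rewrite (le_trans (ler_wpM2l c0 h))// mulrCA ler_piMr ?inv_sqrt_le1.
Qed.

Let measurable_W n : measurable_fun setT (W n).
Proof. by have /measurable_int/measurable_EFinP := normalized_sum_integrable n. Qed.

Let integrable_comp_W n h M : continuous h -> (forall x, `|h x| <= M) ->
  P.-integrable setT (EFin \o (fun w => h (W n w))).
Proof.
move=> ch hM; apply: (@bounded_integrable _ _ _ M) => [|w]; last exact: hM.
by apply: measurableT_comp (measurable_W n); exact: continuous_measurable_fun.
Qed.

(** Half of [L * e] comes from approximating [W n] in mean by the sum built on [G], half from the
    gaps between the blocks of that sum. This bound does not improve as [n] grows, hence [sigma]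
    depends on [e]. *)
Lemma clt_approx e : 0 < e -> exists2 sigma, 0 <= sigma <= Sg &
  forall M g L eta, test_function M g -> lipb g L -> 0 < eta -> \forall n \near \oo,
    `|Ex (fun w => g (W n w)) - gsmooth sigma g 0| <= L * e + eta.
Proof.
move=> e0; have e2 : 0 < e / 2 by rewrite divr_gt0.
have [G [cG EG vG dG]] := normalized_sum_approx e2.
have [sg hsg hG] := cylinder_clt cG EG A0 vG e2.
exists sg => // M g L eta tg lg eta0; have := hG M g L eta tg lg eta0.
apply: filterS => n h; have [gl gb] := lg.
have cg := lipb_continuous lg.
have L0 : 0 <= L by exact: le_trans (normr_ge0 _) (gb 0).
pose U w := (Num.sqrt n%:R)^-1 * \sum_(l <- iota 0 n) G (iter l theta w).
have cS : cyl_fun (fun w => \sum_(l <- iota 0 n) G (iter l theta w)).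
  by apply: cyl_sum => l; exact: cyl_shift.
have cU : cyl_fun U by exact: (cyl_comp (fun x => (Num.sqrt n%:R)^-1 * x) cS).
have iU := cyl_integrable P cU; have iW := normalized_sum_integrable n.
have igU := cyl_integrable P (cyl_comp g cU).
have igW := integrable_comp_W n cg gb.
have iD : P.-integrable setT (EFin \o (fun w => `|W n w - U w|)).
  have h' := integrable_abse (integrableB measurableT iW iU).
  by apply: (eq_integrable measurableT _ _ _ h') => w _.
have igD : P.-integrable setT (EFin \o (fun w => g (W n w) - g (U w))).
  by apply: (eq_integrable measurableT _ _ _ (integrableB measurableT igW igU)) => w _.
have : `|Ex (fun w => g (W n w)) - Ex (fun w => g (U w))| <= L * (e / 2).
  rewrite -RintegralB// (le_trans (le_normr_Rintegral _ _))//.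
  apply: (@le_trans _ _ (L * Ex (fun w => `|W n w - U w|))); last by rewrite ler_wpM2l.
  rewrite -RintegralZl//; apply: le_Rintegral => //.
  - by have := integrable_abse igD.
  - by apply: (eq_integrable measurableT _ _ _ (integrableZl measurableT L iD)) => w _ /=; rewrite EFinM.
move: h; rewrite -/(U _) !ler_norml => /andP[? ?] /andP[? ?]; apply/andP; split; lra.
Qed.

(* The variances furnished by [clt_approx] for e = 1/(k+1) lie in a compact interval. *)
Lemma clt_test_functions : exists2 sigma, 0 <= sigma &
  forall M g, test_function M g -> Ex (fun w => g (W n w)) @[n --> \oo] --> gsmooth sigma g 0.
Proof.
have /choice[sg hsg] : forall k, exists sigma, 0 <= sigma <= Sg /\
  forall M g L eta, test_function M g -> lipb g L -> 0 < eta -> \forall n \near \oo,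
    `|Ex (fun w => g (W n w)) - gsmooth sigma g 0| <= L * k.+1%:R^-1 + eta.
  move=> k; have [|s s0 hs] := @clt_approx k.+1%:R^-1; first by rewrite invr_gt0.
  by exists s.
(* A cluster point is enough: the estimate holds for every [k], so a single large [k] with [sg k]
   near [s] settles all large [n]. *)
have [|s [s0 cs]] := @segment_compact R 0 Sg (sg @ \oo) _.
  by exists 0 => // k _ /=; rewrite in_itv/=; case: (hsg k).
have {}s0 : 0 <= s by move: s0; rewrite /= in_itv/= => /andP[].
exists s => // M g tg; have [L lg] := test_function_lipb tg; have [_ gb] := lg.
have L0 : 0 <= L by exact: le_trans (normr_ge0 _) (gb 0).
pose m1 := gmean (fun z : R => `|z|); have m10 : 0 <= m1 by exact: gmean_ge0.
apply/cvgrPdist_le => e e0.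
pose d := e / 3 / (L * m1 + 1).
have B1 : 0 < L * m1 + 1 by rewrite ltr_wpDl// mulr_ge0.
have d0 : 0 < d by rewrite !divr_gt0.
pose N := Num.truncn (3 * L / e).
have [_ [[k Nk <-] kd]] := cs (sg @` [set k | (N <= k)%N]) (ball s d)
  (ex_intro2 _ _ N I (fun k Nk => ex_intro2 _ _ k Nk erefl)) (nbhsx_ballx s d d0).
have [_ /(_ M g L (e / 3) tg lg)] := hsg k; rewrite divr_gt0// => /(_ isT).
apply: filterS => n h.
have h1 : L * k.+1%:R^-1 <= e / 3.
  rewrite ler_pdivrMr// mulrC -ler_pdivrMr ?divr_gt0//.
  have -> : L / (e / 3) = 3 * L / e by field; exact: lt0r_neq0.
  by rewrite (le_trans (ltW (truncnS_gt _)))// ler_nat.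
have h2 : `|gsmooth s g 0 - gsmooth (sg k) g 0| <= e / 3.
  rewrite (le_trans (gsmooth_lip_time _ _ lg 0))// -/m1.
  move: kd; rewrite -ball_normE/= => /ltW kd.
  apply: (@le_trans _ _ (L * d * m1)); first by rewrite ler_wpM2r// ler_wpM2l.
  rewrite /d (_ : L * _ * m1 = e / 3 * ((L * m1) / (L * m1 + 1))); last by field; exact: lt0r_neq0.
  by rewrite ler_piMr ?divr_ge0 ?(ltW e0)// ler_pdivrMr// mul1r lerDl.
move: h h1 h2; rewrite /= !ler_norml; move: (L / _) => a; move: (gsmooth _ _ _) (gsmooth _ _ _) => x y.
move: (Rintegral _ _ _) => z /andP[? ?] ? /andP[? ?]; apply/andP; split; lra.
Qed.

Lemma clt : exists2 sigma, 0 <= sigma & forall h M, continuous h -> (forall x, `|h x| <= M) ->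
  Ex (fun w => h (W n w)) @[n --> \oo] --> gsmooth sigma h 0.
Proof.
have [s s0 hs] := clt_test_functions; exists s => // h M ch hM; apply/cvgrPdist_le => e e0.
pose m1 := gmean (fun z : R => `|z|); have m10 : 0 <= m1 by exact: gmean_ge0.
have M0 : 0 <= M by exact: le_trans (normr_ge0 _) (hM 0).
(* [B / K] bounds together the linear error terms of [test_function_approx], one under the Gaussian
   and one under [W n]; [K] makes it at most e / 5. The uniform errors and the convergence for [g]
   take three more fifths. *)
pose B := 2 * M * (C * A + 1 + s * m1).
have B0 : 0 <= B by rewrite mulr_ge0 ?mulr_ge0// addr_ge0 ?mulr_ge0// addr_ge0.
pose K := (B + 1) / (e / 5); have K0 : 0 < K by rewrite !divr_gt0// ltr_wpDl.
have e5 : 0 < e / 5 by rewrite divr_gt0.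
have [g tg hg] := test_function_approx ch hM K0 e5.
have [L lg] := test_function_lipb tg; have [_ gb] := lg; have cg := lipb_continuous lg.
have BK : B / K <= e / 5.
  by rewrite ler_pdivrMr// /K mulrC divfK ?gt_eqF// lerDl.
have cg' x : exp_growth (fun z => h (x + s * z)).
  apply: (@exp_growth_bounded _ _ M) => //.
  by apply: measurable_affine; exact: continuous_measurable_fun.
have eabs : exp_growth (fun z : R => `|z|) by have := exp_growth_norm (exp_growthX R 1).
have h1 : `|gsmooth s h 0 - gsmooth s g 0| <= e / 5 + 2 * M / K * (s * m1).
  rewrite /gsmooth -gmeanB//; last exact: lipb_growth lg.
  have eB : exp_growth (fun z => h (0 + s * z) - g (0 + s * z)).
    by apply: exp_growthB => //; exact: lipb_growth lg.
  rewrite (le_trans (gmean_norm eB))// -[X in X + _](@gmean_cst R) -[s * m1]gmeanZ// -gmeanZ; last exact: exp_growthZ.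
  have e2 : exp_growth (fun z : R => 2 * M / K * (s * `|z|)) by apply: exp_growthZ; exact: exp_growthZ.
  rewrite -gmeanD//; last exact: exp_growth_cst.
  apply: le_gmean; [exact: exp_growth_norm|by apply: exp_growthD => //; exact: exp_growth_cst|].
  by move=> z; rewrite (le_trans (hg _))// add0r normrM (ger0_norm s0).
have h2 n : `|Ex (fun w => h (W n w)) - Ex (fun w => g (W n w))| <= e / 5 + 2 * M / K * (C * A + 1).
  have ih := integrable_comp_W n ch hM; have ig := integrable_comp_W n cg gb.
  have iD : P.-integrable setT (EFin \o (fun w => h (W n w) - g (W n w))).
    by apply: (eq_integrable measurableT _ _ _ (integrableB measurableT ih ig)) => w _.
  have iW : P.-integrable setT (EFin \o (fun w => `|W n w|)) by have := integrable_abse (normalized_sum_integrable n).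
  have iZ : P.-integrable setT (EFin \o (fun w => 2 * M / K * `|W n w|)).
    by apply: (eq_integrable measurableT _ _ _ (integrableZl measurableT (2 * M / K) iW)) => w _ /=; rewrite EFinM.
  have ic : P.-integrable setT (EFin \o (fun=> e / 5)) by exact: finite_measure_integrable_cst.
  rewrite -RintegralB// (le_trans (le_normr_Rintegral _ _))//.
  apply: (@le_trans _ _ (Ex (fun w => e / 5 + 2 * M / K * `|W n w|))).
    apply: le_Rintegral => //.
    - by have := integrable_abse iD.
    - by apply: (eq_integrable measurableT _ _ _ (integrableD measurableT ic iZ)) => w _.
  rewrite RintegralD// Ex_cst RintegralZl// lerD2l ler_wpM2l ?normalized_sum_tight//.
  by apply: divr_ge0; [exact: mulr_ge0|exact: ltW].
have := hs M g tg => /cvgrPdist_le/(_ _ e5); apply: filterS => n h3.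
have BE : 2 * M / K * (s * m1) + 2 * M / K * (C * A + 1) <= e / 5.
  by rewrite (le_trans _ BK)// /B -mulrDr [X in _ * X <= _]addrC [leLHS]mulrAC.
have := h2 n; move: h1 h3 BE; rewrite !ler_norml.
move=> /andP[? ?] /andP[? ?] ? /andP[? ?]; apply/andP; split; lra.
Qed.

End clt.

(** * The invariant measure *)

Section law.
Context (R : realType) (X : completeNormedModType R) (D : random_series X).

Notation P := (rs_P D).
Notation T := (rs_T D).
Notation tau' := (rs_tau' D).
Notation theta := (shift tau').
Notation V := (rvec D).
Local Notation Ex F := (Rintegral P setT F).

Let rvec_mfun : {mfun bits >-> borel X} := mfun_Sub (mem_set (measurable_rvec D)).

Definition rlaw : probability (borel X) R := distribution P rvec_mfun.

Let measurable_V (A : set (borel X)) : measurable A -> measurable (V @^-1` A).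
Proof. by move=> mA; rewrite -[_ @^-1` _]setTI; exact: measurable_rvec. Qed.

Lemma rlaw_invariant : T_invariant rlaw T.
Proof.
move=> A mA; rewrite -[RHS](iter_shift_inv (rs_p01 D) (@rs_PE _ _ D) (@rs_tau'K _ _ D) (@rs_p_tau _ _ D) 1 (measurable_V mA)).
by congr (P _); apply/seteqP; split => w; rewrite /preimage/= (rvec_iter_shift D 1).
Qed.

Lemma rlaw_strongly_mixing : strongly_mixing rlaw T.
Proof.
move=> A B mA mB.
have := shift_mixing (rs_p01 D) (@rs_PE _ _ D) (@rs_tau'K _ _ D) (@rs_p_tau _ _ D) (@rs_tau_free _ _ D)
  (measurable_V mA) (measurable_V mB).
rewrite (_ : (fun k => P _) = (fun n => rlaw (A `&` iter n T @^-1` B))) //.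
apply/funext => n; congr (P _).
by apply/seteqP; split => w; rewrite /preimage/= rvec_iter_shift.
Qed.

Lemma rlaw_full_support : (forall (u : X) e, 0 < e -> exists i, `|u - rs_y D i| < e) -> full_support rlaw.
Proof.
move=> dy U oU [u Uu]; have [r /= r0 hr] : nbhs_ball u U by apply/nbhs_ballP; exact: open_nbhs_nbhs.
have r2 : 0 < r / 2 by rewrite divr_gt0.
have [i hi] := dy u _ r2.
apply: (lt_le_trans (rvec_support D i r2)).
apply: le_measure.
- rewrite inE (_ : [set w | _] = V @^-1` [set x : borel X | `|x - rs_y D i| < r / 2]) //.
  apply: measurable_V; apply: sub_sigma_algebra.
  rewrite (_ : [set x | _] = ball (rs_y D i) (r / 2)); first exact: ball_open.
  by apply/seteqP; split => x; rewrite -ball_normE/= distrC.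
- by rewrite inE; apply: measurable_V; exact: sub_sigma_algebra.
move=> w /= h; apply: hr; rewrite [r]splitr -ball_normE/=.
by rewrite -(subrK (rs_y D i) u) -addrA (le_lt_trans (ler_normD _ _))// ltrD// distrC.
Qed.

Lemma rlaw_in_L2 f C : lip_exp f C -> in_L2 rlaw f.
Proof.
move=> fC; have mf := measurable_borel_continuous (lip_exp_continuous fC); split => //.
rewrite (ge0_integral_distribution rvec_mfun) => [|| y]; last by rewrite lee_fin sqr_ge0.
  by have [iF _] := sqr_integrable D fC; exact: (integrable_lty measurableT iF).
by apply/measurable_EFinP; exact: measurable_funX.
Qed.

Lemma Rintegral_rlaw (f : X -> R) : measurable_fun [set: borel X] (f : borel X -> R) ->
  P.-integrable setT (EFin \o (fun w => f (V w))) ->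
  Rintegral rlaw [set: borel X] f = Ex (fun w => f (V w)).
Proof.
move=> mf iF; congr fine; apply: (integral_distribution (X := rvec_mfun)) => //.
exact/measurable_EFinP.
Qed.

Let continuous_iterT n : continuous (iter n T).
Proof.
elim: n => [|n ih] x; first exact: cvg_id.
by apply: continuous_comp; [exact: ih|exact: rs_T_cont].
Qed.

Let measurable_f_iter f C n : lip_exp f C ->
  measurable_fun [set: borel X] ((fun x => f (iter n T x)) : borel X -> R).
Proof.
move=> fC; apply: measurable_borel_continuous => x.
by apply: continuous_comp; [exact: continuous_iterT|exact: lip_exp_continuous fC _].
Qed.

Let integrable_f_iter f C n : lip_exp f C ->
  P.-integrable setT (EFin \o (fun w => f (iter n T (V w)))).
Proof.
move=> fC; have [iF _] := F_integrable D fC.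
have := integrable_iter_shift (rs_p01 D) (@rs_PE _ _ D) (@rs_tau'K _ _ D) (@rs_p_tau _ _ D) n iF.
by apply: eq_integrable => // w _ /=; rewrite rvec_iter_shift.
Qed.

Lemma Cov_rlaw f g C C' n : lip_exp f C -> lip_exp g C' ->
  Cov rlaw (fun x => f (iter n T x)) g =
  Ex (fun w => f (iter n T (V w)) * g (V w)) - Ex (fun w => f (iter n T (V w))) * Ex (fun w => g (V w)).
Proof.
move=> fC gC; rewrite /Cov.
have mf := measurable_f_iter n fC; have mg := measurable_f_iter 0 gC.
have if1 := integrable_f_iter n fC; have ig1 := integrable_f_iter 0 gC.
rewrite (Rintegral_rlaw mf if1) (Rintegral_rlaw mg ig1) Rintegral_rlaw//; first exact: measurable_funM.
have [sf _] := sqr_integrable D fC; have [sg _] := sqr_integrable D gC.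
have sfn := integrable_iter_shift (rs_p01 D) (@rs_PE _ _ D) (@rs_tau'K _ _ D) (@rs_p_tau _ _ D) n sf.
apply: (le_integrable measurableT _ _ (integrableD measurableT sfn sg)).
  by apply/measurable_EFinP; apply: measurable_funM; apply/measurable_EFinP; [exact: (measurable_int _ if1)|exact: (measurable_int _ ig1)].
move=> w _ /=; rewrite lee_fin rvec_iter_shift [leRHS]ger0_norm ?addr_ge0 ?sqr_ge0//.
set a := f _; set b := g _; rewrite ler_norml.
have := sqr_ge0 (a + b); have := sqr_ge0 (a - b); have := sqr_ge0 a; have := sqr_ge0 b.
by move=> ? ? ? ?; apply/andP; split; nra.
Qed.

Lemma clt_rlaw f C A : lip_exp f C -> (forall s, uniq s -> \sum_(i <- s) wgt D i <= A) ->
  Rintegral rlaw [set: borel X] f = 0 -> exists sigma : R, 0 <= sigma /\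
    cvg_in_distribution rlaw (fun n x => (Num.sqrt n%:R)^-1 * \sum_(k < n) f (iter k T x))
      (centered_gaussian sigma).
Proof.
move=> fC wA f0; have mg := measurable_f_iter 0 fC; have ig := integrable_f_iter 0 fC.
rewrite (Rintegral_rlaw mg ig) in f0.
have [s s0 hs] := clt fC wA f0; exists s; split=> // h ch [M hM].
rewrite (integral_centered_gaussian s0 ch hM).
have mh : measurable_fun setT h := continuous_measurable_fun ch.
have E n : (\int[rlaw]_x (h ((Num.sqrt n%:R)^-1 * \sum_(k < n) f (iter k T x)))%:E =
    (Ex (fun w => h (normalized_sum D f n w)))%:E)%E.
  have mW : measurable_fun [set: borel X] ((fun x => h ((Num.sqrt n%:R)^-1 * \sum_(k < n) f (iter k T x))) : borel X -> R).
    apply: measurableT_comp => //; apply: measurable_funM => //.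
    by apply: measurable_sum => k; exact: measurable_f_iter fC.
  have We w : h (normalized_sum D f n w) = h ((Num.sqrt n%:R)^-1 * \sum_(k < n) f (iter k T (V w))).
    by congr (h (_ * _)); apply: eq_bigr => k _; rewrite rvec_iter_shift.
  have iW : P.-integrable setT (EFin \o (fun w => h (normalized_sum D f n w))).
    apply: (@bounded_integrable _ _ _ M) => [|w]; last exact: hM.
    rewrite (funext We); exact: (measurableT_comp mW (measurable_rvec D)).
  rewrite (integral_distribution (X := rvec_mfun)); last 2 first.
  - exact/measurable_EFinP.
  - by move: iW; rewrite (funext We).
  rewrite fineK; last exact: integrable_fin_num.
  by apply: eq_integral => w _ /=; rewrite We.
by rewrite (funext E); apply: cvg_EFin; [near=> n|exact: hs ch hM].
Unshelve. all: by end_near. Qed.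

End law.

(** * Construction of the random series from the orbits *)

Lemma int_nat_bij : exists idx : int -> nat -> nat, exists jj : nat -> int, exists kk : nat -> nat,
  [/\ forall j k, jj (idx j k) = j, forall j k, kk (idx j k) = k & forall i, idx (jj i) (kk i) = i].
Proof.
have /pcard_eqP/unsquash f := card_nat2; have [g fK gK] := @bijTT _ _ f.
pose enc (j : int) := match j with Posz n => n.*2 | Negz n => n.*2.+1 end.
pose dec m := if odd m then Negz m./2 else Posz m./2.
have encK : cancel enc dec.
  by case=> n; rewrite /enc /dec /= odd_double ?doubleK//= uphalf_double.
have decK : cancel dec enc.
  by move=> m; rewrite /dec; case: ifP => o; rewrite /enc /= -[RHS]odd_double_half o.
exists (fun j k => f (enc j, k)), (fun i => dec (g i).1), (fun i => (g i).2); split => [j k|j k|i].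
- by rewrite fK /= encK.
- by rewrite fK.
- by rewrite decK -surjective_pairing gK.
Qed.

(** Around each point of the countable dense set, a point of [D] is chosen at distance below 1 / (m
    + 1) for every m. *)
Lemma dense_sequence (R : realType) (X : normedModType R) (D : set X) : separable X -> dense D ->
  exists x : nat -> X, (forall k, D (x k)) /\ forall (u : X) e, 0 < e -> exists k, `|u - x k| < e.
Proof.
move=> [Dc [cDc dDc]] dD.
have [e0|/unsquash s] := pfcard_geP cDc.
  have [|x [_]] := dDc setT _ openT; first by exists 0.
  by rewrite e0.
have /choice[h hh] : forall nm : nat * nat, exists x, D x /\ `|s nm.1 - x| < nm.2.+1%:R^-1.
  move=> [n m] /=; have [||x [bx Dx]] := dD (ball (s n) m.+1%:R^-1).
  - by exists (s n); apply: ballxx; rewrite invr_gt0.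
  - exact: ball_open.
  - by exists x; split=> //; move: bx; rewrite -ball_normE.
have /pcard_eqP/unsquash f := card_nat2; have [g fK gK] := @bijTT _ _ f.
exists (fun k => h (g k)); split=> [k|u e e0]; first by case: (hh (g k)).
have e2 : 0 < e / 2 by rewrite divr_gt0.
have [||v [bv Dv]] := dDc (ball u (e / 2)).
- by exists u; exact: ballxx.
- exact: ball_open.
have [n _ sn] := @surj _ _ _ _ s v Dv.
pose m := Num.truncn (e / 2)^-1; exists (f (n, m)); rewrite fK.
have [_ h1] := hh (n, m); rewrite /= sn in h1.
move: bv; rewrite -ball_normE/= => h2.
rewrite -(subrK v u) -addrA (le_lt_trans (ler_normD _ _))// [e]splitr ltrD// (lt_le_trans h1)//.
by rewrite -[leRHS]invrK lef_pV2 ?posrE ?invr_gt0//; exact/ltW/truncnS_gt.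
Qed.

Section construction.
Context (R : realType) (X : completeNormedModType R).
Variables (T : {linear X -> X}) (cT : continuous T).
Variables (S : nat -> X -> X) (x : nat -> X).
Hypothesis uT : forall k, uncond_summable (fun n => iter n T (x k)).
Hypothesis uS : forall k, uncond_summable (fun n => S n (x k)).
Hypothesis TS : forall k n, iter n T (S n (x k)) = x k.
Hypothesis TSm : forall k n m, (m < n)%N -> iter m T (S n (x k)) = S (n - m)%N (x k).

Definition orbit k (j : int) : X := match j with Posz n => iter n T (x k) | Negz n => S n.+1 (x k) end.

(** At the junction, from index -1 to 0, this is [TS] with n = 1; further left it is [TSm] with m =
    1. *)
Lemma T_orbit k j : T (orbit k j) = orbit k (j + 1).
Proof.
case: j => [n|[|n]].
- by rewrite (_ : Posz n + 1 = Posz n.+1)//; lia.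
- exact: (TS k 1).
- rewrite (_ : Negz n.+1 + 1 = Negz n); last by lia.
  by have := @TSm k n.+2 1 isT; rewrite subSS subn0.
Qed.

(** [bnd] lets the caller force [p] to be as small as desired in each slice: 0 for the mere
    existence of the measure, [weight_bound] for the decay rates. *)
Lemma exists_random_series (bnd : nat -> R) : (forall k, 0 <= bnd k) ->
  exists (D : random_series X) (jj : nat -> int) (kk : nat -> nat),
  [/\ rs_T D = T, forall i, rs_y D i = orbit (kk i) (jj i),
      injective (fun i => (jj i, kk i)) /\ (forall j k, exists i, jj i = j /\ kk i = k),
      forall n i, jj (iter n (rs_tau D) i) = jj i + n%:Z /\ kk (iter n (rs_tau D) i) = kk i &
      forall i, rs_p D i * bnd (kk i) <= 1].
Proof.
move=> bnd0; have [idx [jj [kk [jjK kkK idxK]]]] := int_nat_bij.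
have inj : injective (fun i => (jj i, kk i)).
  by move=> i i' [ej ek]; rewrite -(idxK i) ej ek idxK.
have tsc k e : 0 < e -> exists J : seq int, forall s, uniq s -> (forall j, j \in s -> j \notin J) ->
    `|\sum_(j <- s) orbit k j| <= e.
  exact: (@two_sided_cauchy R X _ _ (orbit k) (@uT k) (@uS k) (fun=> erefl) (fun=> erefl) e).
have hp k : 0 < 2^-1 ^+ k.+1 :> R by rewrite exprn_gt0.
have /choice[J hJ] := fun k => tsc k _ (hp k).
(* Indices in [J k] are bounded one by one, the others together by the choice of [J k]. *)
pose M k : R := \sum_(j <- undup (J k)) `|orbit k j| + 2^-1 ^+ k.+1.
have M0 k : 0 <= M k by rewrite addr_ge0 ?half_pow_ge0// sumr_ge0.
pose E k : R := (size (J k))%:R * expR (\sum_(l < k.+1) M l).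
have E0 k : 0 <= E k by rewrite mulr_ge0 ?expR_ge0.
(* The 2 keeps the probability below 1, [E k] gives [bad_prob], and [bnd k] the last conclusion. *)
pose q k : R := 2^-1 ^+ k.+1 / (2 + E k + bnd k).
have den k : 0 < 2 + E k + bnd k by rewrite ltr_wpDr// ltr_wpDr.
have hp1 k : 2^-1 ^+ k.+1 <= 1 :> R by rewrite exprn_ile1// invf_le1// ler1n.
have q0 k : 0 < q k by rewrite divr_gt0.
have p01 i : 0 < q (kk i) < 1.
  rewrite q0 ltr_pdivrMr// mul1r (le_lt_trans (hp1 _))//.
  by have := E0 (kk i); have := bnd0 (kk i); lra.
have [P PE] := bernoulli_prob_cylinder p01.
pose tau i := idx (jj i + 1) (kk i); pose tau' i := idx (jj i - 1) (kk i).
have tauK : cancel tau tau' by move=> i; rewrite /tau /tau' jjK kkK addrK idxK.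
have tau'K : cancel tau' tau by move=> i; rewrite /tau /tau' jjK kkK subrK idxK.
have p_tau i : q (kk (tau i)) = q (kk i) by rewrite kkK.
have itau n i : jj (iter n tau i) = jj i + n%:Z /\ kk (iter n tau i) = kk i.
  elim: n => [|n [ihj ihk]]; first by rewrite addr0.
  by rewrite /= jjK kkK ihj ihk; split=> //; lia.
have tau_free i n m : iter n tau i = iter m tau i -> n = m.
  by move=> /(congr1 jj); have [-> _] := itau n i; have [-> _] := itau m i; lia.
pose y i := orbit (kk i) (jj i).
have Ty i : T (y i) = y (tau i) by rewrite /y jjK kkK T_orbit.
have slice k s : uniq s -> (forall i, i \in s -> kk i = k) ->
    uniq (map jj s) /\ \sum_(i <- s) y i = \sum_(j <- map jj s) orbit k j.
  move=> us sk; split.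
    rewrite map_inj_in_uniq// => i i' iS iS' e; apply: inj.
    by rewrite e (sk i)// (sk i').
  rewrite big_map big_seq [RHS]big_seq; apply: eq_bigr => i iS; by rewrite /y (sk i).
have slice_notin k (L : seq int) s : (forall i, i \in s -> kk i = k /\ i \notin [seq idx j k | j <- L]) ->
    forall j, j \in map jj s -> j \notin L.
  move=> h _ /mapP[i iS ->]; have [ik] := h i iS; apply: contraNN => jL.
  by rewrite -(idxK i) ik map_f.
have slice_bound k s : uniq s -> (forall i, i \in s -> kk i = k) -> `|\sum_(i <- s) y i| <= M k.
  move=> us sk; have [uj ->] := slice k s us sk; move: (map jj s) uj => {us sk}s us.
  rewrite (bigID (mem (J k)))/= (le_trans (ler_normD _ _))// lerD//.
    rewrite (le_trans (ler_norm_sum _ _ _))// -big_filter.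
    rewrite (perm_big [seq j <- undup (J k) | j \in s]); last first.
      apply: uniq_perm; rewrite ?filter_uniq ?undup_uniq// => j.
      by rewrite !mem_filter mem_undup andbC.
    by rewrite big_filter big_mkcond/=; apply: ler_sum => j _; case: ifP.
  rewrite -big_filter; apply: hJ; first by rewrite filter_uniq.
  by move=> j; rewrite mem_filter => /andP[].
have slice_small k s : uniq s -> (forall i, i \in s -> kk i = k /\ i \notin [seq idx j k | j <- J k]) ->
    `|\sum_(i <- s) y i| <= 2^-1 ^+ k.+1.
  move=> us sk; have [uj ->] := slice k s us (fun i iS => (sk i iS).1).
  by apply: hJ => //; exact: slice_notin sk.
have slice_cauchy k e : 0 < e -> exists L : seq nat, forall s, uniq s ->
    (forall i, i \in s -> kk i = k /\ i \notin L) -> `|\sum_(i <- s) y i| <= e.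
  move=> e0; have [L hL] := tsc k e e0; exists [seq idx j k | j <- L] => s us sk.
  have [uj ->] := slice k s us (fun i iS => (sk i iS).1).
  by apply: hL => //; exact: slice_notin sk.
have bad_prob k : (\sum_(i <- [seq idx j k | j <- J k]) q (kk i)) * expR (\sum_(l < k.+1) M l) <= 2^-1 ^+ k.+1.
  rewrite big_map (eq_bigr (fun=> q k)); last by move=> j _; rewrite kkK.
  rewrite big_const_seq count_predT iter_addr_0 -[q k *+ _]mulr_natl [leLHS]mulrAC -/(E k) mulrC /q.
  rewrite mulrAC ler_pdivrMr// ler_wpM2l ?half_pow_ge0//.
  by have := bnd0 k; lra.
exists (@RandomSeries R X (q \o kk) p01 P PE tau tau' tauK tau'K p_tau tau_free y T cT Ty kk
  (fun k => [seq idx j k | j <- J k]) M M0 slice_bound slice_small slice_cauchy bad_prob), jj, kk.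
split=> //.
- by split=> // j k; exists (idx j k).
- move=> i /=; rewrite /q mulrAC ler_pdivrMr// mul1r; apply: (@le_trans _ _ (bnd (kk i))).
    by rewrite ler_piMl.
  by have := E0 (kk i); lra.
Qed.

End construction.

(** The finitely many early terms enter [K] as ratios; for the later ones n + 1 <= 2 n costs the
    factor 2^a. *)
Lemma eventually_le_pw (R : realType) (a : R) (u : nat -> R) : 0 < a -> (forall n, 0 <= u n) ->
  (exists C, \forall n \near \oo, u n <= C * n%:R `^ (- a)) ->
  exists2 K, 0 <= K & forall n, u n <= K * pw a n.
Proof.
move=> a0 u0 [C [N _ hN]]; pose K := `|C| * 2 `^ a + \sum_(m < N.+1) u m / pw a m.
have pwp m : 0 < pw a m by exact: powR_gt0.
have s0 : 0 <= \sum_(m < N.+1) u m / pw a m by apply: sumr_ge0 => m _; rewrite divr_ge0// ltW.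
have c0 : 0 <= `|C| * 2 `^ a by rewrite mulr_ge0 ?powR_ge0.
exists K; first exact: addr_ge0.
move=> n; rewrite mulrDl; have [nN|Nn] := ltnP n N.+1.
  rewrite ler_wpDl ?mulr_ge0 ?(ltW (pwp n))// -ler_pdivrMr//.
  by rewrite (bigD1 (Ordinal nN))//= lerDl sumr_ge0// => m _; rewrite divr_ge0// ltW.
rewrite ler_wpDr ?mulr_ge0 ?(ltW (pwp n))//; apply: le_trans (hN n (ltnW Nn)) _.
have n0 : (0 : R) < n%:R by rewrite ltr0n (leq_ltn_trans _ Nn).
apply: (@le_trans _ _ (`|C| * n%:R `^ (- a))); first by rewrite ler_wpM2r ?powR_ge0// ler_norm.
rewrite -mulrA ler_wpM2l// /pw !powRN ler_pdivlMr ?powR_gt0// mulrC ler_pdivrMr ?powR_gt0//.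
rewrite -powRM ?ler0n//; apply: ge0_ler_powR; rewrite ?nnegrE ?mulr_ge0 ?(ltW a0) ?(ltW n0)//.
by rewrite -natrM ler_nat; lia.
Qed.

Section decay.
Context (R : realType) (X : completeNormedModType R) (D : random_series X).
Variables (jj : nat -> int) (kk : nat -> nat) (K : nat -> R) (a : R).
Hypothesis a2 : 1 / 2 < a.
Hypothesis K0 : forall k, 0 <= K k.
Hypothesis inj : injective (fun i => (jj i, kk i)).
Hypothesis jj_tau : forall n i, jj (iter n (rs_tau D) i) = jj i + n%:Z /\ kk (iter n (rs_tau D) i) = kk i.
Hypothesis yK : forall i, `|rs_y D i| <= K (kk i) * pw a `|jj i|%N.

(** The square answers the square root of [p] in [wgt]: if [p] is at most the inverse of this
    number, the weight is at most 2^-(k+1) times the decay of the orbit. *)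
Definition weight_bound k : R := (Num.sqrt (expR 1 * 2) * K k * expR (K k / 8) * 2 ^+ k.+1) ^+ 2.

Hypothesis pK : forall i, rs_p D i * weight_bound (kk i) <= 1.

Let a0 : 0 < a. Proof. by apply: lt_trans a2; rewrite divr_gt0. Qed.

Lemma wgt_decay i : wgt D i <= 2^-1 ^+ (kk i).+1 * pw a `|jj i|%N.
Proof.
set k := kk i; set v := pw _ _; pose c : R := Num.sqrt (expR 1 * 2).
have c0 : 0 <= c by exact: sqrtr_ge0.
have v0 : 0 <= v by exact: pw_ge0.
have p0 : 0 <= Num.sqrt (rs_p D i) by exact: sqrtr_ge0.
pose B := c * K k * expR (K k / 8).
have B0 : 0 <= B by rewrite mulr_ge0 ?expR_ge0// mulr_ge0.
have h : wgt D i <= Num.sqrt (rs_p D i) * B * v.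
  have hy := yK i; rewrite -/k -/v in hy.
  have hyK : `|rs_y D i| <= K k by rewrite (le_trans hy)// ler_piMr ?pw_le1.
  rewrite /wgt -/c (_ : _ * B * v = c * (Num.sqrt (rs_p D i) * (K k * v) * expR (K k / 8))); last by rewrite /B; ring.
  rewrite ler_wpM2l//; apply: ler_pM; rewrite ?mulr_ge0 ?expR_ge0//.
    by rewrite ler_wpM2l.
  by rewrite ler_expR ler_wpM2r.
rewrite (le_trans h)// ler_wpM2r// -[2^-1 ^+ _]mul1r exprVn ler_pdivlMr ?exprn_gt0//.
have : Num.sqrt (rs_p D i * weight_bound k) <= 1 by rewrite -[leRHS]sqrtr1 ler_wsqrtr.
have p0' : 0 <= rs_p D i by have /andP[/ltW] := rs_p01 D i.
rewrite sqrtrM// /weight_bound sqrtr_sqr ger0_norm ?mulr_ge0 ?exprn_ge0//.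
by rewrite !mulrA.
Qed.

Lemma sum_wgt_bounded : 1 < a -> exists A, forall s, uniq s -> \sum_(i <- s) wgt D i <= A.
Proof.
move=> a1; have [S hS] := sum_pw_bounded a1; exists (2 * S) => s us.
apply: le_trans (sum_slices_le inj (fun m => pw_ge0 a m) hS us).
by apply: ler_sum => i _; exact: wgt_decay.
Qed.

(** One of the two slice factors is bounded by 1. The two terms of [pw_shift_mul] are each summed
    over the slices and over both signs, whence the 4. *)
Lemma sum_wgt_shift : exists S, forall n N, (0 < n)%N ->
  \sum_(i < N) wgt D (iter n (rs_tau D) i) * wgt D i <= S * rate a n.
Proof.
have [S hS] := sum_pw_min a2; exists (4 * S) => n N n0.
pose b i : R := 2^-1 ^+ (kk i).+1.
have b1 i : 0 <= b i <= 1 by rewrite /b exprn_ge0//= exprn_ile1// invf_le1// ler1n.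
pose v := pw_min a n.
have v0 m : 0 <= v m by exact: pw_min_ge0.
have inj' : injective (fun i => (jj i + n%:Z, kk i)).
  by move=> i i' [ej ek]; apply: inj; rewrite ek (addIr _ ej).
have h1 := sum_slices_le inj v0 (fun N => hS n N n0) (iota_uniq 0 N).
have h2 := sum_slices_le inj' v0 (fun N => hS n N n0) (iota_uniq 0 N).
rewrite (_ : 4 * S * _ = 2 * (S * rate a n) + 2 * (S * rate a n)); last by ring.
apply: le_trans (lerD h2 h1); rewrite -big_split/=.
rewrite -(big_mkord xpredT (fun i => wgt D (iter n (rs_tau D) i) * wgt D i)) /index_iota subn0.
apply: ler_sum => i _; have := wgt_decay (iter n (rs_tau D) i); have [-> ->] := jj_tau n i.
have := wgt_decay i; rewrite -/(b i) -mulrDr => w1 w2.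
have /andP[bi0 bi1] := b1 i.
apply: (le_trans (ler_pM (wgt_ge0 D _) (wgt_ge0 D _) w2 w1)).
rewrite mulrACA; apply: ler_pM; rewrite ?mulr_ge0 ?pw_ge0//.
  by rewrite ler_piMr.
exact: pw_shift_mul.
Qed.

Lemma Cov_rlaw_decay f g : is_poly f -> is_poly g -> exists C, forall n, (0 < n)%N ->
  `|Cov (rlaw D) (fun x => f (iter n (rs_T D) x)) g| <= C * rate a n.
Proof.
move=> /poly_lip_exp[C fC] /poly_lip_exp[C' gC]; have [S hS] := sum_wgt_shift.
exists (C * C' * S) => n n0; rewrite (Cov_rlaw D n fC gC) -mulrA.
by apply: (cov_bound fC gC) => N; exact: hS.
Qed.

End decay.

Theorem theorem4p1 (R : realType) (X : completeNormedModType R)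
  (T : {linear X -> X}) (D : set X) (S : nat -> X -> X) :
  separable X -> continuous T -> dense D ->
  (forall x, D x ->
     [/\ uncond_summable (fun n => iter n T x),
         uncond_summable (fun n => S n x),
         (forall n, iter n T (S n x) = x) &
         (forall n m, (m < n)%N -> iter m T (S n x) = S (n - m)%N x)]) ->
  (exists mu : probability (borel X) R,
     [/\ T_invariant mu T, full_support mu, strongly_mixing mu T &
         forall f : X -> R, continuous_polynomial f -> in_L2 mu f])
  /\
  (forall alpha : R, 1 / 2 < alpha ->
     (forall x, D x ->
        (exists C : R, \forall n \near \oo,
            `|iter n T x| <= C * n%:R `^ (- alpha)) /\
        (exists C : R, \forall n \near \oo,
            `|S n x| <= C * n%:R `^ (- alpha))) ->
     exists mu : probability (borel X) R,
       [/\ T_invariant mu T, full_support mu, strongly_mixing mu T &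
           forall f : X -> R, continuous_polynomial f -> in_L2 mu f]
       /\
       (forall f g : X -> R, is_poly f -> is_poly g ->
          exists C : R,
            [/\ alpha < 1 -> forall n, (0 < n)%N ->
                  `|Cov mu (fun x => f (iter n T x)) g| <= C * n%:R `^ (1 - 2 * alpha),
                alpha = 1 -> forall n, (0 < n)%N ->
                  `|Cov mu (fun x => f (iter n T x)) g| <= C * (ln (n%:R + 1) / n%:R) &
                1 < alpha -> forall n, (0 < n)%N ->
                  `|Cov mu (fun x => f (iter n T x)) g| <= C * n%:R `^ (- alpha)])
       /\
       (1 < alpha ->
          forall f : X -> R, is_poly f ->
            Rintegral mu [set: borel X] f = 0 ->
            exists sigma : R, 0 <= sigma /\
              cvg_in_distribution mu
                (fun n x => (Num.sqrt n%:R)^-1 * \sum_(k < n) f (iter k T x))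
                (centered_gaussian sigma))).
Proof.
move=> sX cT dD hS; have [x [xD xdense]] := dense_sequence sX dD.
have uT k : uncond_summable (fun n => iter n T (x k)) by have [] := hS _ (xD k).
have uS k : uncond_summable (fun n => S n (x k)) by have [] := hS _ (xD k).
have TS k n : iter n T (S n (x k)) = x k by have [] := hS _ (xD k).
have TSm k n m : (m < n)%N -> iter m T (S n (x k)) = S (n - m)%N (x k).
  by have [_ _ _] := hS _ (xD k); exact.
have build := exists_random_series cT uT uS TS TSm.
have good E jj kk : rs_T E = T -> (forall i, rs_y E i = orbit T S x (kk i) (jj i)) ->
    (forall j k, exists i, jj i = j /\ kk i = k) ->
    [/\ T_invariant (rlaw E) T, full_support (rlaw E), strongly_mixing (rlaw E) T &
      forall f : X -> R, continuous_polynomial f -> in_L2 (rlaw E) f].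
  move=> eT ey sur; split.
  - by rewrite -eT; exact: rlaw_invariant.
  - apply: rlaw_full_support => u e e0; have [k hk] := xdense u e e0.
    (* The dense points are the entries of index 0 of their orbits. *)
    by have [i [ji ki]] := sur 0 k; exists i; rewrite ey ji ki.
  - by rewrite -eT; exact: rlaw_strongly_mixing.
  - by move=> f [/poly_lip_exp[C fC] _]; exact: rlaw_in_L2 fC.
split.
  have [E [jj [kk [eT ey [_ sur] _ _]]]] := build (fun=> 0) (fun=> lexx 0).
  by exists (rlaw E); exact: (good E jj kk).
move=> a a2 hO; have a0 : 0 < a by apply: lt_trans a2; rewrite divr_gt0.
(* The decay constants vary with the point [x k] without uniformity, which [weight_bound]
   compensates by a smaller [p] in slice [k]. *)
have /choice[K hK] : forall k, exists K, 0 <= K /\ forall j, `|orbit T S x k j| <= K * pw a `|j|%N.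
  move=> k; have [hT hSk] := hO _ (xD k).
  have [K1 K10 h1] := eventually_le_pw a0 (fun n => normr_ge0 (iter n T (x k))) hT.
  have [K2 K20 h2] := eventually_le_pw a0 (fun n => normr_ge0 (S n (x k))) hSk.
  exists (K1 + K2); split; first exact: addr_ge0.
  move=> [n|n] /=; rewrite mulrDl.
    by rewrite ler_wpDr ?mulr_ge0 ?pw_ge0//; exact: h1.
  by rewrite ler_wpDl ?mulr_ge0 ?pw_ge0//; exact: h2.
have K0 k : 0 <= K k by case: (hK k).
have [E [jj [kk [eT ey [inj sur] jjt pb]]]] := build (weight_bound K) (fun k => sqr_ge0 _).
have yK i : `|rs_y E i| <= K (kk i) * pw a `|jj i|%N by rewrite ey; case: (hK (kk i)).
exists (rlaw E); split; first exact: (good E jj kk).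
split.
  move=> f g pf pg; have [C hC] := Cov_rlaw_decay a2 K0 inj jjt yK pb pf pg.
  rewrite eT in hC; exists C; split=> ha n n0; apply: (le_trans (hC n n0)); rewrite /rate.
  - by rewrite ha.
  - by rewrite ha ltxx eqxx.
  - by rewrite ltNge (ltW ha)/= gt_eqF.
move=> a1 f /poly_lip_exp[C fC]; rewrite -eT.
have [A hA] := sum_wgt_bounded a2 K0 inj yK pb a1.
exact: clt_rlaw fC hA.
Qed.
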